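(* Let $\gamma<0$ and suppose that assumptions (A.1)–(A.4) of the context hold. Then, for every initial state $x\in E$, $$\frac{\lambda^\gamma_\delta}{\delta}=\sup_{V\in\mathbb{V}_\delta}J_\gamma(x,V),$$ i.e. the optimal value of the dyadic long-run risk sensitive impulse control problem $\sup_{V\in\mathbb{V}_\delta}J_\gamma(x,V)$ is given by the constant $\lambda^\gamma_\delta$ from the solution of the Bellman equation in the context.
   Context: Setting. $E=\mathbb{R}^d$, $U\subseteq E$ is compact, $\delta>0$ is fixed, and $X=(X_t)_{t\ge0}$ is a continuous-time Feller–Markov process with values in $E$, defined on a filtered probability space satisfying the usual conditions. $\mathbb{P}_x,\mathbb{E}_x$ denote probability and expectation for the uncontrolled process started at $x\in E$. The functions $f:E\to\mathbb{R}$ (reward) and $c:E\times U\to\mathbb{R}_-$ (shift cost) are given. Impulse control. An admissible impulse control strategy is a sequence $V=\{(\tau_i,\xi_i)\}_{i\ge1}$ of strictly increasing (possibly infinite) Markov times $\tau_i$ and $U$-valued random variables $\xi_i$ (determined by the information available at time $\tau_i$). Under $V$, at time $\tau_i$ the process is shifted from its current state to $\xi_i$ and then follows its uncontrolled Markov dynamics until the next impulse. $\mathbb{P}_{(x,V)}$, $\mathbb{E}_{(x,V)}$ denote probability and expectation for the controlled process started at $x$ (standard construction), and $X_{\tau_i^-}$ is the state of the process just before the $i$-th impulse is applied. $\mathbb{V}_\delta$ is the set of dyadic strategies, i.e. admissible strategies for which all $\tau_i$ take values in $\{n\delta: n=0,1,2,\dots\}\cup\{\infty\}$. Entropic utility: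 $\mu^\gamma_{(x,V)}(Z):=\frac1\gamma\ln\mathbb{E}_{(x,V)}[\exp(\gamma Z)]$ for $\gamma\neq0$ and $\mu^0_{(x,V)}(Z):=\mathbb{E}_{(x,V)}[Z]$; $\mu_x^\gamma$ is the same quantity for the uncontrolled process started at $x$. Objective: with $T_n:=n\delta$, $$J_\gamma(x,V):=\liminf_{n\to\infty}\frac1{T_n}\,\mu^\gamma_{(x,V)}\Big(\int_0^{T_n}f(X_s)\,ds+\sum_{i=1}^\infty \mathbf 1_{\{\tau_i\le T_n\}}c(X_{\tau_i^-},\xi_i)\Big).$$ Weighted space: $\omega:E\to\mathbb{R}_+$ is a fixed continuous function, and $C_\omega(E)$ is the space of continuous $g:E\to\mathbb{R}$ with $\|g\|_\omega:=\sup_{x\in E}\frac{|g(x)|}{1+\omega(x)}<\infty$. Assumptions: (A.1) $f$ is continuous and $\|f\|_\omega<\infty$. (A.2) $c$ is continuous, there exists $c_0<0$ such that $c(x,\xi)\le c_0$ for all $x\in E$, $\xi\in U$, and $\|\hat c\|_\omega<\infty$, where $\hat c(x):=\inf_{\xi\in U}c(x,\xi)$. (A.3) There exist a constant $b_1\in(0,1)$ and finite functions $M_1,M_2:\mathbb{R}\to\mathbb{R}$ such that for all $\gamma\in\mathbb{R}$ and $x\in E$: $\mu_x^\gamma\big(\int_0^\delta\omega(X_s)\,ds\big)\le\omega(x)+M_1(\gamma)$ and $\mu_x^\gamma(\omega(X_\delta))\le b_1\omega(x)+M_2(\gamma)$. (A.4) For every $R>0$ there exist $d>0$ and a probability measure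 $\nu$ on $E$ with $\nu(U)>0$ such that $\inf_{x\in C_R}\mathbb{P}_x[X_\delta\in A]\ge d\,\nu(A)$ for all Borel $A\subseteq E$, where $C_R=\{x\in E:\omega(x)\le R\}$. Bellman equation: under (A.1)–(A.4), for each $\gamma<0$ there are $w^\gamma_\delta\in C_\omega(E)$ (unique up to an additive constant) and a unique $\lambda^\gamma_\delta\in\mathbb{R}$ such that for all $x\in E$ $$w^\gamma_\delta(x)+\lambda^\gamma_\delta=\max\Big\{\mu_x^\gamma\Big(\int_0^\delta f(X_s)\,ds+w^\gamma_\delta(X_\delta)\Big),\ \sup_{\xi\in U}\Big(\mu_\xi^\gamma\Big(\int_0^\delta f(X_s)\,ds+w^\gamma_\delta(X_\delta)\Big)+c(x,\xi)\Big)\Big\};$$ this defines $\lambda^\gamma_\delta$. *)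

(* Defs.v *)
From HB Require Import structures.
From mathcomp Require Import all_boot all_order all_algebra.
From mathcomp Require Import all_classical all_reals all_analysis.

Set Implicit Arguments.
Unset Strict Implicit.
Unset Printing Implicit Defensive.
Import Order.TTheory GRing.Theory Num.Theory.
Import numFieldNormedType.Exports.
Local Open Scope classical_set_scope.
Local Open Scope ring_scope.
Local Open Scope ereal_scope.

(* Time is a real number, constrained to be nonnegative where it matters.     *)

Definition borel {R : realType} {d : nat} : set (set 'rV[R]_d) := <<s open >>.

(* R^d as a measurable space; convertible to ['rV[R]_d].                      *)
Definition state (R : realType) (d : nat) :=
  g_sigma_algebraType (@open 'rV[R]_d).

Section functions.
Context {R : realType} {d : nat}.
Implicit Types (omega g : 'rV[R]_d -> R).

Definition weighted_norm omega g : \bar R :=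
  ereal_sup [set (`|g x| / (1 + omega x))%:E | x in [set: 'rV[R]_d]].

Definition C_omega omega : set ('rV[R]_d -> R) :=
  [set g | continuous g /\ weighted_norm omega g < +oo].

Definition C_zero : set ('rV[R]_d -> R) :=
  [set g | continuous g /\
    forall e : R, (0 < e)%R ->
      exists M : R, forall x, (M <= `|x|)%R -> (`|g x| < e)%R].

End functions.

Definition entropic_utility {R : realType} {dT : measure_display}
    {T : measurableType dT} (mu : {measure set T -> \bar R})
    (gamma : R) (Z : T -> \bar R) : \bar R :=
  if gamma == 0%R then \int[mu]_o Z o
  else (gamma^-1)%:E * lne (\int[mu]_o expeR (gamma%:E * Z o)).

Section filtered_space.
Context {R : realType} {d : nat} {dO : measure_display}.
Context {Omega : measurableType dO}.

Definition filtration (F : R -> set (set Omega)) : Prop :=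
  [/\ forall t : R, (0 <= t)%R -> sigma_algebra setT (F t),
      forall t : R, (0 <= t)%R -> F t `<=` measurable
    & forall s t : R, (0 <= s)%R -> (s <= t)%R -> F s `<=` F t].

(* Usual conditions relative to the whole family (P x): right-continuity, and *)
(* F 0 contains the sets that are negligible under every P x.                 *)
Definition usual_conditions (F : R -> set (set Omega))
    (P : R.-pker (state R d) ~> Omega) : Prop :=
  (forall t : R, (0 <= t)%R ->
     \bigcap_(u in [set u | (t < u)%R]) F u `<=` F t) /\
  (forall N, (forall x, (P x).-negligible N) -> F 0%R N).

Definition cadlag (p : R -> 'rV[R]_d) : Prop :=
  (forall t : R, (0 <= t)%R -> p u @[u --> t^'+] --> p t) /\
  (forall t : R, (0 < t)%R -> cvg (p u @[u --> t^'-])).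

End filtered_space.

(* A Feller-Markov process on a filtered space: [fm_law x] is P_x. The        *)
(* transition semigroup preserves C_0; its strong continuity is then implied  *)
(* by the right-continuity of the paths.                                      *)
Record feller_markov (R : realType) (d : nat) (dO : measure_display)
    (Omega : measurableType dO) := FellerMarkov {
  fm_X :> R -> Omega -> 'rV[R]_d;
  fm_F : R -> set (set Omega);
  fm_law : R.-pker (state R d) ~> Omega;
  fm_filtration : filtration fm_F;
  fm_usual : usual_conditions fm_F fm_law;
  fm_adapted : forall (t : R) B, (0 <= t)%R -> borel B ->
    fm_F t (fm_X t @^-1` B);
  fm_cadlag : forall o, cadlag (fm_X ^~ o);
  fm_start : forall x, fm_law x [set o | fm_X 0%R o = x] = 1;
  fm_markov : forall x (s t : R) A B,
    (0 <= s)%R -> (0 <= t)%R -> fm_F s A -> borel B ->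
    fm_law x (A `&` fm_X (s + t)%R @^-1` B) =
    \int[fm_law x]_(o in A) fm_law (fm_X s o) (fm_X t @^-1` B);
  fm_feller : forall (t : R) g, (0 <= t)%R -> C_zero g ->
    C_zero (fun x => \int[fm_law x]_o g (fm_X t o))%R }.

(* The controlled process is built on a countable product of copies of the    *)
(* sample space: coordinate k carries the k-th leg, that is the uncontrolled  *)
(* motion started right after the k-th impulse (at time 0 for k = 0), with    *)
(* its own clock starting from 0.                                             *)

Section impulse_control.
Context {R : realType} {d : nat} {dO : measure_display}.
Context {Omega : measurableType dO}.
Variable X : feller_markov R d Omega.

Definition leg_events (K : set nat) : set (set (nat -> Omega)) :=
  \bigcup_(k in K)
    preimage_set_system setT (fun o : nat -> Omega => o k) measurable.

Definition legs := g_sigma_algebraType (leg_events setT).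

(* [tau n] and [xi n] are the time and the target of the (n+1)-st impulse.    *)
Record strategy := Strategy {
  tau : nat -> (nat -> Omega) -> \bar R;
  xi : nat -> (nat -> Omega) -> 'rV[R]_d }.

Implicit Types V : strategy.

Definition leg_start V (k : nat) (o : nat -> Omega) : \bar R :=
  if k is k'.+1 then tau V k' o else 0.

(* The information available at time t from the legs 0, ..., n: on leg k, the *)
(* clock of which is started at [leg_start V k], the events of F s with       *)
(* leg_start V k + s <= t. It only depends on the first n impulses.           *)
Definition info V (n : nat) (t : R) : set (set (nat -> Omega)) :=
  <<s [set B | exists k (s : R) A, [/\ (k <= n)%N, (0 <= s)%R, fm_F X s A &
      B = [set o | leg_start V k o + s%:E <= t%:E /\ A (o k)]]] >>.

Definition info_oo V (n : nat) : set (set (nat -> Omega)) :=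
  <<s \bigcup_(t in [set t | (0 <= t)%R]) info V n t >>.

Definition info_tau V (n : nat) : set (set (nat -> Omega)) :=
  [set A | info_oo V n A /\
     forall t : R, (0 <= t)%R ->
       info V n t (A `&` [set o | tau V n o <= t%:E])].

Record admissible (U : set 'rV[R]_d) V : Prop := Admissible {
  tau_ge0 : forall n o, 0 <= tau V n o;
  tau_incr : forall n o, tau V n o < +oo -> tau V n o < tau V n.+1 o;
  tau_infty : forall n o, tau V n o = +oo -> tau V n.+1 o = +oo;
  tau_markov : forall n (t : R), (0 <= t)%R ->
    info V n t [set o | tau V n o <= t%:E];
  xi_target : forall n o, U (xi V n o);
  xi_info : forall n B, borel B -> info_tau V n (xi V n @^-1` B) }.

Definition dyadic (delta : R) V : Prop :=
  forall n o, tau V n o = +oo \/ exists k : nat, tau V n o = (k%:R * delta)%:E.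

(* P_(x,V): leg 0 has law P_x and, given the legs 0, ..., n, leg n+1 has law  *)
(* P_(xi V n). This determines the measure. The part of a leg that lies after *)
(* the next impulse is not seen by the controlled process.                    *)
Definition controlled_law V (x : 'rV[R]_d) (Q : probability legs R) : Prop :=
  (forall A, measurable A -> Q [set o | A (o 0%N)] = fm_law X x A) /\
  (forall n A B, measurable A -> <<s leg_events `I_n.+1 >> B ->
     Q (B `&` [set o | A (o n.+1)]) = \int[Q]_(o in B) fm_law X (xi V n o) A).

Definition active_leg V (t : R) (o : nat -> Omega) : nat :=
  xget 0%N [set k | leg_start V k o <= t%:E < tau V k o].

Definition controlled V (t : R) (o : nat -> Omega) : 'rV[R]_d :=
  let k := active_leg V t o in X (t - fine (leg_start V k o))%R (o k).

Definition pre_impulse V (n : nat) (o : nat -> Omega) : 'rV[R]_d :=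
  X (fine (tau V n o) - fine (leg_start V n o))%R (o n).

Definition total_reward (f : 'rV[R]_d -> R) (c : 'rV[R]_d * 'rV[R]_d -> R)
    V (T : R) (o : nat -> Omega) : \bar R :=
  \int[lebesgue_measure]_(s in `[0%R, T]) (f (controlled V s o))%:E +
  \sum_(0 <= n <oo)
    (if tau V n o <= T%:E then (c (pre_impulse V n o, xi V n o))%:E else 0).

Definition objective (delta gamma : R) f c V (Q : probability legs R)
    : \bar R :=
  limn_einf (fun n : nat => ((n%:R * delta)^-1)%:E *
    entropic_utility Q gamma (total_reward f c V (n%:R * delta))).

Section model.
Variables (U : set 'rV[R]_d) (delta : R).
Variables (f : 'rV[R]_d -> R) (c : 'rV[R]_d * 'rV[R]_d -> R).
Variable omega : 'rV[R]_d -> R.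

Definition assumption_reward : Prop := C_omega omega f.

Definition assumption_cost : Prop :=
  [/\ {within setT `*` U, continuous c},
      exists2 c0 : R, (c0 < 0)%R &
        forall x xi, U xi -> (c (x, xi) <= c0)%R
    & weighted_norm omega (fun x => inf [set c (x, xi) | xi in U]) < +oo].

Definition assumption_growth : Prop :=
  exists (b1 : R) (M1 M2 : R -> R), (0 < b1 < 1)%R /\
    forall gamma x,
      entropic_utility (fm_law X x) gamma
        (fun o => \int[lebesgue_measure]_(s in `[0%R, delta])
                    (omega (X s o))%:E) <= (omega x + M1 gamma)%:E /\
      entropic_utility (fm_law X x) gamma (fun o => (omega (X delta o))%:E)
        <= (b1 * omega x + M2 gamma)%:E.

Definition assumption_minorization : Prop :=
  forall r : R, (0 < r)%R ->
    exists (m : R) (nu : probability (state R d) R),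
      [/\ (0 < m)%R, 0 < nu U & forall A, borel A ->
        m%:E * nu A <= ereal_inf
          [set fm_law X x (X delta @^-1` A) | x in [set x | (omega x <= r)%R]]].

Definition step_utility (gamma : R) (w : 'rV[R]_d -> R) (x : 'rV[R]_d)
    : \bar R :=
  entropic_utility (fm_law X x) gamma
    (fun o => \int[lebesgue_measure]_(s in `[0%R, delta]) (f (X s o))%:E +
              (w (X delta o))%:E).

Definition bellman (gamma : R) (w : 'rV[R]_d -> R) (lambda : R) : Prop :=
  forall x, (w x + lambda)%:E =
    maxe (step_utility gamma w x)
         (ereal_sup [set step_utility gamma w xi + (c (x, xi))%:E | xi in U]).

End model.
End impulse_control.

Arguments legs {dO} Omega.
Arguments strategy R d {dO} Omega.

(* Main.v *)
Require Import Defs.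
From mathcomp Require Import all_boot all_order all_algebra.
From mathcomp Require Import all_classical all_reals all_analysis measurable_realfun finmap ring lra.
Set Implicit Arguments.
Unset Strict Implicit.
Unset Printing Implicit Defensive.
Import Order.TTheory GRing.Theory Num.Theory.
Import numFieldNormedType.Exports.
Local Open Scope classical_set_scope.
Local Open Scope ring_scope.
Local Open Scope ereal_scope.

(** Dyadic strategies act on the grid of the multiples of [delta], where the controlled
  process is a Markov chain once its state is read after the possible impulse
  ([markov_step]), and where the total reward is a sum of one-period rewards and
  impulse costs ([total_rewardE]). Let [r] be the certainty equivalent of the reward of
  one uncontrolled period and of the terminal value [w]. The Bellman equation says that
  [r <= w + lambda], that [r xi + c (y, xi) <= w y + lambda] for every target [xi], and
  that one of the two is an equality up to an arbitrarily small error
  ([bellman_certainty_equivalent]). Hence the exponential of [gamma] times the sum of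
  the utility collected up to time [n * delta], of [w] at the current state and of
  [- n * lambda] has a nondecreasing mean under every strategy, and a mean that grows
  at an arbitrarily small rate when the impulses are made where waiting is not optimal,
  to nearly optimal targets. Were [w] bounded, taking logarithms and dividing by [n]
  would give the theorem.

  In general [w] is of the order of [1 + omega], and the difficulty is to remove its
  value at the horizon. The risk parameter is perturbed for this. Convexity of the
  logarithmic moments shows that the one-step inequalities survive at [theta * gamma]
  for the upper bound, [theta < 1], and at [p * gamma] for the lower bound, [p > 1], up
  to an error proportional to [1 - theta], respectively [p - 1], and to [1 + omega] at
  the state after the impulse ([step_mean_rescale]). Hoelder's inequality leads back to
  the parameter [gamma] at the price of an exponential moment that involves the sum of
  these errors and a large multiple of [1 + omega] at the horizon. The growth assumption
  makes [omega] a Lyapunov function and impulses only move the state into the compact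
  set [U], so this moment grows at a rate that does not depend on the large multiple
  ([weight_growth]); Hoelder's inequality multiplies the rate by a factor that vanishes
  with the perturbation. This gives [utility_le_bellman] and [utility_ge_bellman].

  For the second of them a strategy has to be produced: a nearly optimal target is
  chosen measurably along a sequence that is dense in [U] ([measurable_selector]), and
  the impulses are the visits of the grid chain to the region where waiting is not
  optimal ([stationary_admissible], [stationary_impulse]).

  The Markov property on the grid is proved by cutting the sample space according to
  the active leg and its starting time: on each cell the information at time [n * delta]
  is carried by one leg seen from a deterministic local time ([info_leg_past]), where
  the Markov property of the uncontrolled process extends from positions on finite
  grids to paths ([path_markov_set]). Time integrals are functions of paths through
  their Riemann sums, since the paths are right-continuous with left limits. *)

(** * Integrals determined on generators *)

Section standard_machine.
Context d (T : measurableType d) (R : realType).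
Import HBNNSimple.

(** The standard machine as an induction principle: a nonnegative measurable
  function is an increasing limit of positive combinations of indicators. *)
Lemma ge0_measurable_ind (P : (T -> \bar R) -> Prop) :
  (forall A, measurable A -> P (fun x => (\1_A x)%:E)) ->
  (forall (r : R) (f : T -> \bar R), (0 <= r)%R -> measurable_fun setT f ->
     (forall x, 0 <= f x) -> P f -> P (fun x => r%:E * f x)) ->
  (forall f g : T -> \bar R, measurable_fun setT f -> (forall x, 0 <= f x) ->
     measurable_fun setT g -> (forall x, 0 <= g x) ->
     P f -> P g -> P (fun x => f x + g x)) ->
  (forall u : nat -> T -> \bar R, (forall n, measurable_fun setT (u n)) ->
     (forall n x, 0 <= u n x) -> (forall x, nondecreasing_seq (u ^~ x)) ->
     (forall n, P (u n)) -> P (fun x => limn (u ^~ x))) ->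
  forall f, measurable_fun setT f -> (forall x, 0 <= f x) -> P f.
Proof.
move=> P1 PZ PD Plim f mf f0.
pose f_ := nnsfun_approx measurableT mf.
have -> : f = (fun x => limn (fun n => (f_ n x)%:E)).
  by apply/funext => x; apply/esym/cvg_lim => //; exact: cvg_nnsfun_approx.
apply: (Plim (fun n x => (f_ n x)%:E)).
- by move=> n; exact/measurable_EFinP.
- by move=> n x; rewrite lee_fin.
- by move=> x a b ab; rewrite lee_fin; exact/lefP/nd_nnsfun_approx.
move=> n; set h := f_ n.
have -> : (fun x => (h x)%:E) = (fun x =>
    \sum_(y <- fset_set (range h)) (y%:E * (\1_(h @^-1` [set y]) x)%:E)).
  apply/funext => x; rewrite fimfunE fsbig_finite//= -sumEFin.
  by apply: eq_bigr => y _; rewrite EFinM.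
have : forall y, y \in (fset_set (range h) : seq R) -> (0 <= y)%R.
  by move=> y; rewrite -[_ \in _]/(y \in fset_set _) in_fset_set// => /set_mem[x _ <-].
elim: (fset_set (range h) : seq R) => [_|y s IH ys].
  under eq_fun do rewrite big_nil.
  have -> : (fun=> 0) = (fun x : T => (\1_(set0 : set T) x)%:E) :> (T -> \bar R).
    by apply/funext => x; rewrite indic0.
  exact: P1.
under eq_fun do rewrite big_cons.
have m1 z : measurable (h @^-1` [set z]) by exact: measurable_sfunP.
have mi z : measurable_fun setT (fun x => (\1_(h @^-1` [set z]) x)%:E : \bar R).
  by apply/measurable_EFinP.
have y0 : (0 <= y)%R by apply: ys; rewrite inE eqxx.
have s0 z : z \in s -> (0 <= z)%R by move=> zs; apply: ys; rewrite inE zs orbT.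
apply: PD.
- exact: measurable_funeM.
- by move=> x; rewrite mule_ge0// lee_fin.
- by apply: emeasurable_sum => z; exact: measurable_funeM.
- move=> x; rewrite big_seq; apply: sume_ge0 => z zs.
  by rewrite mule_ge0// lee_fin// s0.
- by apply: PZ => //; exact: P1.
- exact: IH.
Qed.

End standard_machine.

Section integral_identities.
Context (R : realType).

(** The factor [a] may be infinite: the products are then constant from the first
  nonzero term on. *)
Lemma ge0_limeMr (u : (\bar R)^nat) (a : \bar R) :
  (forall n, 0 <= u n) -> nondecreasing_seq u -> 0 <= a ->
  limn (fun n => u n * a) = limn u * a.
Proof.
move=> u0 ndu a0; apply/cvg_lim => //.
have cu : u @ \oo --> limn u by exact: ereal_nondecreasing_is_cvgn.
move: a a0 => [r r0| _ |//]; first by apply: cvgeZr.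
have le_u n : u n <= limn u by by apply: lime_ge => //; exists n => // k; exact: ndu.
have [u_eq0|/existsNP[k /eqP uk]] := pselect (forall n, u n = 0).
  have -> : u = cst 0 by apply/funext.
  by rewrite lim_cst//= mul0e; exact: cvg_cst.
have uk0 : 0 < u k by rewrite lt0e uk u0.
rewrite [limn u * _]gt0_muley ?(lt_le_trans uk0)//.
apply: cvg_near_cst; exists k => // n /= kn.
by rewrite gt0_muley// (lt_le_trans uk0)// ndu.
Qed.

(** Here [b] is a version of the conditional expectation of [a] given [K], and the
  conclusion pulls out the known factor [g]. Both sides are additive and monotone
  in [g], so that indicators are enough. *)
Lemma ge0_integralM_sub_sigma d (T : measurableType d)
    (m : {measure set T -> \bar R}) (K : set (set T)) (a b : T -> \bar R) :
  <<s K >> `<=` measurable ->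
  measurable_fun setT a -> (forall x, 0 <= a x) ->
  measurable_fun setT b -> (forall x, 0 <= b x) ->
  (forall B, <<s K >> B -> \int[m]_(x in B) a x = \int[m]_(x in B) b x) ->
  forall g : g_sigma_algebraType K -> \bar R,
  measurable_fun setT g -> (forall x, 0 <= g x) ->
  \int[m]_x (g x * a x) = \int[m]_x (g x * b x).
Proof.
move=> Km ma a0 mb b0 ab.
have K2 g : measurable_fun [set: g_sigma_algebraType K] g ->
    measurable_fun [set: T] (g : T -> \bar R).
  by move=> mg _ Y mY; apply: Km; exact: mg.
apply: ge0_measurable_ind.
- move=> B KB; under eq_integral do rewrite muleC.
  under [RHS]eq_integral do rewrite muleC.
  have e h : (fun x : T => h x * (\1_B x)%:E) = h \_ B :> (T -> \bar R).
    apply/funext => x; rewrite /patch indicE.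
    by case: (x \in B); rewrite (mule1,mule0).
  by rewrite !e -!integral_mkcond; exact: ab.
- move=> r f r0 mf f0 IH.
  under eq_integral do rewrite -muleA.
  under [RHS]eq_integral do rewrite -muleA.
  rewrite !ge0_integralZl ?IH//; do ?[by move=> *; rewrite mule_ge0];
    by apply: emeasurable_funM => //; exact: K2.
- move=> f g mf f0 mg g0 IHf IHg.
  under eq_integral do rewrite ge0_muleDl//.
  under [RHS]eq_integral do rewrite ge0_muleDl//.
  rewrite !ge0_integralD ?IHf ?IHg//; do ?[by move=> *; rewrite mule_ge0];
    by apply: emeasurable_funM => //; exact: K2.
- move=> u mu u0 ndu IH.
  under eq_integral do rewrite -ge0_limeMr//.
  under [RHS]eq_integral do rewrite -ge0_limeMr//.
  rewrite !monotone_convergence//; first by congr (limn _); exact/funext.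
  + by move=> n; apply: emeasurable_funM => //; exact: K2.
  + by move=> n x _; rewrite mule_ge0.
  + by move=> x _ i j ij; rewrite lee_wpmul2r// ndu.
  + by move=> n; apply: emeasurable_funM => //; exact: K2.
  + by move=> n x _; rewrite mule_ge0.
  + by move=> x _ i j ij; rewrite lee_wpmul2r// ndu.
Qed.

(** Indicators turn the conclusion into the last hypothesis. The kernels live on
  another space, observed through [b], because the conditional law of a path is
  that of the path [b] of a restarted process. *)
Lemma ge0_integral_disintegration d1 d2 d3 (T : measurableType d1)
    (S : measurableType d2) (S' : measurableType d3)
    (m : {measure set T -> \bar R}) (D : set T)
    (a : T -> S) (k : T -> {measure set S' -> \bar R}) (b : S' -> S) :
  measurable D -> measurable_fun setT a -> measurable_fun setT b ->
  (forall G, measurable G -> measurable_fun setT (k ^~ G)) ->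
  (forall G, measurable G ->
     m (D `&` a @^-1` G) = \int[m]_(t in D) k t (b @^-1` G)) ->
  forall phi : S -> \bar R, measurable_fun setT phi -> (forall x, 0 <= phi x) ->
  \int[m]_(t in D) phi (a t) = \int[m]_(t in D) \int[k t]_s phi (b s).
Proof.
move=> mD ma mb mk mDk.
have mfb (f : S -> \bar R) : measurable_fun setT f ->
    measurable_fun setT (fun s => f (b s)).
  by move=> mf; exact: measurableT_comp.
have ms (f : S -> \bar R) : measurable_fun setT f -> (forall x, 0 <= f x) ->
    measurable_fun D (fun t => \int[k t]_s f (b s)).
  move=> mf f0; apply: measurable_funTS.
  by apply: (measurable_fun_integral_kernel mk) => //; exact: mfb.
have mc (f : S -> \bar R) : measurable_fun setT f ->
    measurable_fun D (fun t => f (a t)).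
  by move=> mf; apply: measurable_funTS; exact: measurableT_comp.
have e1 (Y : Type) (c : Y -> S) (G : set S) :
    (fun t => (\1_G (c t))%:E) = (fun t => (\1_(c @^-1` G) t)%:E) :> (Y -> \bar R).
  by apply/funext => t; rewrite !indicE.
apply: ge0_measurable_ind.
- move=> G mG.
  rewrite e1 integral_indic//; last by rewrite -[X in measurable X]setTI; exact: ma.
  under [RHS]eq_integral.
    move=> t _; rewrite e1 integral_indic// ?setIT; last first.
      by rewrite -[X in measurable X]setTI; exact: mb.
    over.
  by rewrite /= -mDk// setIC.
- move=> r f r0 mf f0 IH.
  under [RHS]eq_integral do rewrite (ge0_integralZl _ _ (mfb f mf))//.
  rewrite !ge0_integralZl ?IH//; do ?[by move=> *; rewrite ?mule_ge0// integral_ge0];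
    by first [exact: ms|exact: mc].
- move=> f g mf f0 mg g0 IHf IHg.
  under [RHS]eq_integral => t _.
    rewrite ge0_integralD//; [over|exact: mfb|exact: mfb].
  rewrite [LHS]ge0_integralD//; [|exact: mc|exact: mc].
  rewrite [RHS]ge0_integralD ?IHf ?IHg//; do ?[by move=> *; rewrite integral_ge0];
    exact: ms.
- move=> u mu u0 ndu IH.
  under [RHS]eq_integral => t _.
    rewrite monotone_convergence//; [over|by move=> n; exact: mfb].
  rewrite !monotone_convergence//; first by congr (limn _); exact/funext.
  + by move=> n; exact: ms.
  + by move=> n x _; exact: integral_ge0.
  + move=> x _ i j ij; apply: ge0_le_integral => //; do ?exact: mfb.
    by move=> y _; exact: ndu.
  + by move=> n; exact: mc.
Qed.


Let addeIr (x a b : \bar R) : x \is a fin_num -> a + x = b + x -> a = b.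
Proof. by move=> fx e; rewrite -[a](addeK _ fx) e addeK. Qed.

(** Both sides are finite measures of [G]; the kernels being probabilities, the two
  measures have the same mass, which makes the equality stable under complements. *)
Lemma disintegration_pi_system d1 d2 d3 (T : measurableType d1)
    (S : measurableType d2) (S' : measurableType d3) (C : set (set S))
    (m : {measure set T -> \bar R}) (D : set T)
    (a : T -> S) (k : T -> {measure set S' -> \bar R}) (b : S' -> S) :
  fin_num_fun m -> @measurable _ S = <<s C>> -> setI_closed C ->
  measurable D -> measurable_fun setT a -> measurable_fun setT b ->
  (forall G, measurable G -> measurable_fun setT (k ^~ G)) ->
  (forall t, k t setT = 1) ->
  (forall G, C G -> m (D `&` a @^-1` G) = \int[m]_(t in D) k t (b @^-1` G)) ->
  forall G, measurable G ->
    m (D `&` a @^-1` G) = \int[m]_(t in D) k t (b @^-1` G).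
Proof.
move=> finm SC CI mD ma mb mk k1 mDk G mG.
have mpa B : measurable B -> measurable (a @^-1` B).
  by move=> mB; rewrite -[X in measurable X]setTI; exact: ma.
have mpb B : measurable B -> measurable (b @^-1` B).
  by move=> mB; rewrite -[X in measurable X]setTI; exact: mb.
have mkb B : measurable B -> measurable_fun D (fun t => k t (b @^-1` B)).
  by move=> mB; apply: measurable_funTS; apply: mk; exact: mpb.
have PT : m (D `&` a @^-1` setT) = \int[m]_(t in D) k t (b @^-1` setT).
  rewrite !preimage_setT setIT.
  by under eq_integral do rewrite k1; rewrite integral_cst// mul1e.
apply: (dynkin_induction (G := C)
  (P := fun G => m (D `&` a @^-1` G) = \int[m]_(t in D) k t (b @^-1` G))) => //.
- move=> B mB IH.
  have fin : m (D `&` a @^-1` B) \is a fin_num.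
    by apply: finm; apply: measurableI => //; exact: mpa.
  apply: (@addeIr (m (D `&` a @^-1` B))) => //.
  rewrite [in RHS]IH -ge0_integralD//; [|exact: mkb (measurableC _)|exact: mkb].
  rewrite -measureU//=; first last.
  + by apply/seteqP; split => // t [[_ nB] [_ Bt]]; exact: nB.
  + by apply: measurableI => //; exact: mpa.
  + by apply: measurableI => //; apply: mpa; exact: measurableC.
  rewrite -setIUr -preimage_setU setUC setUv PT.
  apply: eq_integral => t _; rewrite -measureU//=; first last.
  + by apply/seteqP; split => // u [nB Bu]; exact: nB.
  + exact: mpb.
  + by apply: mpb; exact: measurableC.
  by rewrite -preimage_setU setUC setUv.
- move=> F mF tF IH.
  have eT (u : (\bar R)^nat) :
      \sum_(0 <= i <oo | i \in [set: nat]) u i = \sum_(0 <= i <oo) u i.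
    by apply: eq_eseriesl => i; rewrite in_setT.
  rewrite preimage_bigcup setI_bigcupr measure_bigcup//=; first last.
  + apply/trivIset_setIl/trivIsetP => i j _ _ ij.
    by move/trivIsetP : tF => /(_ _ _ I I ij) e; rewrite -preimage_setI e preimage_set0.
  + by move=> i _; apply: measurableI => //; exact: mpa.
  rewrite eT; transitivity (\int[m]_(t in D) \sum_(0 <= i <oo) k t (b @^-1` F i)).
    rewrite integral_nneseries//; last by move=> i; exact: mkb.
    by apply: eq_eseriesr => i _; exact: IH.
  apply: eq_integral => t _; rewrite preimage_bigcup measure_bigcup//= ?eT//.
  + by move=> i _; exact: mpb.
  + apply/trivIsetP => i j _ _ ij.
    by move/trivIsetP : tF => /(_ _ _ I I ij) e; rewrite -preimage_setI e preimage_set0.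
- by rewrite -SC.
Qed.

(** The sets on which the two integrals agree form a lambda-system; integrability
  of [f] allows the subtraction that complements require. *)
Lemma eq_integral_pi_system d (T : measurableType d)
    (m : {measure set T -> \bar R}) (C : set (set T))
    (f g : T -> \bar R) :
  C `<=` measurable -> setI_closed C -> C setT ->
  measurable_fun setT f -> measurable_fun setT g ->
  (forall t, 0 <= f t) -> (forall t, 0 <= g t) ->
  \int[m]_t f t < +oo ->
  (forall B, C B -> \int[m]_(t in B) f t = \int[m]_(t in B) g t) ->
  forall B, <<s C>> B -> \int[m]_(t in B) f t = \int[m]_(t in B) g t.
Proof.
move=> Cm CI CT mf mg f0 g0 foo fg.
have sCm : <<s C>> `<=` measurable.
  by apply: smallest_sub => //; exact: sigma_algebra_measurable.
move=> B CB.
suff : <<s C>> `<=` [set B | measurable B /\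
    \int[m]_(t in B) f t = \int[m]_(t in B) g t].
  by move=> /(_ _ CB)[].
apply: lambda_system_subset => //; last by move=> A CA; split; [exact: Cm|exact: fg].
apply/dynkin_lambda_system; split.
- by split; [exact: measurableT|exact: fg].
- move=> A [mA IH]; split; first exact: measurableC.
  have fin : \int[m]_(t in A) f t \is a fin_num.
    rewrite ge0_fin_numE ?integral_ge0//; apply: le_lt_trans foo.
    exact: ge0_subset_integral.
  apply: (@addeIr (\int[m]_(t in A) f t)) => //.
  rewrite [in RHS]IH -!ge0_integral_setU//.
  + by rewrite setUC setUv; exact: fg.
  + exact: measurableC.
  + exact: measurable_funTS.
  + by rewrite disj_set2E setICl.
  + exact: measurableC.
  + exact: measurable_funTS.
  + by rewrite disj_set2E setICl.
- move=> F tF IH; split; first by apply: bigcup_measurable => i _; exact: (IH i).1.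
  rewrite !ge0_integral_bigcup//.
  + by apply: eq_eseriesr => i _; exact: (IH i).2.
  + by move=> i; exact: (IH i).1.
  + exact: measurable_funTS.
  + by move=> i; exact: (IH i).1.
  + exact: measurable_funTS.
Qed.

End integral_identities.

(** * Riemann sums of right-continuous functions with left limits *)

Section cadlag_riemann.
Context (R : realType).
Implicit Types (g : R -> R) (a b u : R).

Lemma compact_locally_bounded (W : normedModType R) (K : set W) (h : W -> R) :
  compact K ->
  (forall t, K t -> exists e M : R, (0 < e)%R /\
     forall v, K v -> (`|t - v| < e)%R -> (h v <= M)%R) ->
  exists M : R, forall t, K t -> (h t <= M)%R.
Proof.
move=> /compact_near_coveringP C loc.
have := C nat \oo (fun n t => K t -> (h t <= n%:R)%R) _.
case=> [t /= Kt|n _ Hn].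
  have [e [M [e0 H]]] := loc t Kt.
  near=> u n => /= Ku.
  apply: (@le_trans _ _ M); last by near: n; exact: nbhs_infty_ger.
  by apply: H => //; near: u; exact: nbhsx_ballx.
by exists n%:R => t Kt; exact: (Hn n (leqnn n) t).
Unshelve. all: by end_near. Qed.

(** Right-continuity bounds [g] on the right of each point and the left limit bounds
  it on the left; compactness makes the bound uniform. *)
Lemma cadlag_bounded g a b :
  (forall t, t \in `[a, b] -> g u @[u --> t^'+] --> g t) ->
  (forall t, t \in `]a, b] -> cvg (g u @[u --> t^'-])) ->
  exists M : R, forall t, t \in `[a, b] -> (`|g t| <= M)%R.
Proof.
move=> gr gl.
have loc t : t \in `[a, b] -> exists e M : R, (0 < e)%R /\
    forall u, u \in `[a, b] -> (`|t - u| < e)%R -> (`|g u| <= M)%R.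
  move=> tab.
  have [e1 /= e10 H1] : \forall u \near t^'+, (`|g u| <= `|g t| + 1)%R.
    by apply: (cvgr_norm_le (g t)); [exact: gr|rewrite ltrDl].
  have [e2 [L [e20 H2]]] : exists e L : R, (0 < e)%R /\
      forall u, u \in `[a, b] -> (`|t - u| < e)%R -> (u < t)%R -> (`|g u| <= L)%R.
    have [ta|ta] := leP t a.
      exists 1%R, 0%R; split => // u; rewrite in_itv/= => /andP[au _] _ ut.
      by move: (le_lt_trans au ut); rewrite ltNge ta.
    have /gl : t \in `]a, b].
      by move: tab; rewrite !in_itv/= ta => /andP[].
    move=> /cvg_ex[l gtl].
    have [e2 /= e20 H2] : \forall u \near t^'-, (`|g u| <= `|l| + 1)%R.
      by apply: (cvgr_norm_le l); [exact: gtl|rewrite ltrDl].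
    by exists e2, (`|l| + 1)%R; split => // u _ tu ut; exact: H2.
  exists (Num.min e1 e2), (Num.max (`|g t| + 1) L)%R.
  split; first by rewrite lt_min e10.
  move=> u uab; rewrite lt_min => /andP[u1 u2].
  have [ut|tu|<-] := ltgtP u t.
  - by rewrite le_max H2 ?orbT.
  - by rewrite le_max H1.
  - by rewrite le_max lerDl ler01.
by apply: (@compact_locally_bounded R^o _ (fun t => `|g t|)%R (@segment_compact R a b)).
Qed.


Section riemann.
Variables (g : R -> R) (a T : R).
Hypotheses (T0 : (0 < T)%R)
  (gr : forall t, t \in `[a, (a + T)%R] -> g u @[u --> t^'+] --> g t)
  (gl : forall t, t \in `]a, (a + T)%R] -> cvg (g u @[u --> t^'-])).

Let h (N : nat) : R := (T / N.+1%:R)%R.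

Let h0 N : (0 < h N)%R. Proof. by rewrite divr_gt0// ltr0n. Qed.

Let cell N i : set R := `](a + i%:R * h N)%R, (a + i.+1%:R * h N)%R]%classic.

(* the value at the right end of each cell is the one that right-continuity
  controls *)
Let step N u : R :=
  (\sum_(i < N.+1) g (a + i.+1%:R * h N) * \1_(cell N i) u)%R.

Let cellN N : (N.+1%:R * h N = T)%R.
Proof. by rewrite /h mulrC divfK// pnatr_eq0. Qed.

Let cell_ex N u : u \in `]a, (a + T)%R] -> exists i : 'I_N.+1, cell N i u.
Proof.
rewrite in_itv/= => /andP[au uaT].
have ex : exists i, (u <= a + i.+1%:R * h N)%R by exists N; rewrite cellN.
case: (ex_minnP ex) => i ui mi.
have iN : (i < N.+1)%N by rewrite ltnS; apply: mi; rewrite cellN.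
exists (Ordinal iN); rewrite /cell /= in_itv/= ui andbT.
case: {iN} i ui mi => [|j] _ mi; first by rewrite mul0r addr0.
by rewrite ltNge; apply/negP => /mi; rewrite ltnn.
Qed.

Let cell_inj N i j u : cell N i u -> cell N j u -> i = j.
Proof.
wlog ij : i j / (i < j)%N => [H|] ci cj.
  by have [ij|ij|//] := ltngtP i j; [exact: H|exact/esym/H].
move: ci cj; rewrite /cell /= !in_itv/= => /andP[_ ui] /andP[uj _].
have := lt_le_trans uj ui; rewrite ltrD2l ltr_pM2r// ltr_nat ltnS.
by rewrite leqNgt ij.
Qed.

Let stepE N u (i : 'I_N.+1) : cell N i u -> step N u = g (a + i.+1%:R * h N)%R.
Proof.
move=> ci; rewrite /step (bigD1 i)//= big1 ?addr0.
  by rewrite indicE mem_set// mulr1.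
move=> j ji; rewrite indicE memNset ?mulr0// => cj.
by move/eqP: ji; apply; apply/val_inj; exact: cell_inj cj ci.
Qed.

Let step_cvg u : u \in `]a, (a + T)%R] -> step N u @[N --> \oo] --> g u.
Proof.
move=> uaT; have uaT' : u \in `[a, (a + T)%R].
  by move: uaT; rewrite !in_itv/= => /andP[/ltW -> ->].
apply/cvgrPdist_lt => e e0.
have [d /= d0 Hd] : \forall v \near u^'+, (`|g u - g v| < e)%R.
  by have /cvgrPdist_lt/(_ _ e0) := gr uaT'.
have : \forall N \near \oo, (h N < d)%R.
  have : h N @[N --> \oo] --> 0%R.
    rewrite -(mulr0 T); apply: cvgM; first exact: cvg_cst.
    exact: cvg_harmonic.
  by move=> /cvgrPdist_lt/(_ d d0); apply: filterS => N; rewrite sub0r normrN gtr0_norm.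
apply: filterS => N hd.
have [i ci] := cell_ex N uaT.
rewrite (stepE ci); set v := (a + _)%R.
move: ci; rewrite /cell/= in_itv/= -/v => /andP[iu].
rewrite le_eqVlt => /predU1P[->|uv]; first by rewrite subrr normr0.
apply: Hd => //=; rewrite ltr0_norm ?subr_lt0// opprB.
apply: le_lt_trans hd; rewrite lerBlDr /v -natr1 mulrDl mul1r addrA addrC lerD2l.
exact: ltW.
Qed.

Let step_bounded (M : R) : (forall t, t \in `[a, (a + T)%R] -> (`|g t| <= M)%R) ->
  forall N u, u \in `]a, (a + T)%R] -> (`|step N u| <= M)%R.
Proof.
move=> gM N u uaT; have [i ci] := cell_ex N uaT; rewrite (stepE ci); apply: gM.
rewrite in_itv/= lerDl mulr_ge0 ?ler0n ?(ltW (h0 _))//= lerD2l.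
by rewrite -(cellN N) ler_wpM2r ?(ltW (h0 _))// ler_nat.
Qed.

Let mstep N : measurable_fun `]a, (a + T)%R] (step N).
Proof.
apply: measurable_funTS; apply: measurable_sum => i.
by apply: measurable_funM => //; apply: measurable_indic; exact: measurable_itv.
Qed.

Lemma cadlag_measurable : measurable_fun `[a, (a + T)%R] g.
Proof.
rewrite -(setU1itv false) ?bnd_simp ?lerDl ?ltW//.
apply/measurable_funU => //; split; first exact: measurable_fun_set1.
by apply: (measurable_fun_cvg (h := step)) => // u /= /step_cvg.
Qed.

Lemma cadlag_integrable :
  lebesgue_measure.-integrable `[a, (a + T)%R] (EFin \o g).
Proof.
have [M gM] := cadlag_bounded gr gl.
apply: measurable_bounded_integrable => //.
- by apply: compact_finite_measure; exact: segment_compact.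
- exact: cadlag_measurable.
exists M; split=> [|x Mx]; [exact: num_real|]; move=> t taT; apply: ltW; apply: le_lt_trans Mx.
exact: gM.
Qed.

(** The Riemann sums are the integrals of step functions that converge pointwise
  and are uniformly bounded. *)
Lemma cadlag_riemann_cvg :
  (\sum_(i < N.+1) T / N.+1%:R * g (a + i.+1%:R * (T / N.+1%:R)))%:E
    @[N --> \oo] --> \int[lebesgue_measure]_(u in `[a, (a + T)%R]) (g u)%:E.
Proof.
have [M gM] := cadlag_bounded gr gl.
rewrite -integral_itv_obnd_cbnd; last first.
  apply/measurable_EFinP; apply: measurable_funS cadlag_measurable => //.
  by apply: subset_itvr; rewrite bnd_simp.
have -> : (fun N => (\sum_(i < N.+1) T / N.+1%:R *
    g (a + i.+1%:R * (T / N.+1%:R)))%:E) =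
    (fun N => \int[lebesgue_measure]_(u in `]a, (a + T)%R]) (step N u)%:E).
  apply/funext => N.
  have mc i : measurable (cell N i) by exact: measurable_itv.
  have int1 i : lebesgue_measure.-integrable `]a, (a + T)%R] (EFin \o \1_(cell N i)).
    apply: integrableS measurableT _ _ _ => //; exact: integrable_indic_itv.
  have intc (c : R) i : lebesgue_measure.-integrable `]a, (a + T)%R]
      (fun u => (c * \1_(cell N i) u)%:E).
    have -> : (fun u => (c * \1_(cell N i) u)%:E) =
        (fun u => c%:E * (EFin \o \1_(cell N i)) u).
      by apply/funext => u; rewrite EFinM.
    exact: integrableZl.
  under eq_integral do rewrite -sumEFin.
  rewrite (integral_sum _ (fun i : 'I_N.+1 => intc (g (a + i.+1%:R * h N))%R i))//.
  rewrite -sumEFin; apply: eq_bigr => i _.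
  under eq_integral do rewrite EFinM.
  rewrite integralZl//; last exact: int1.
  rewrite integral_indic//; last exact: mc.
  rewrite setIidl.
    rewrite [X in _ * X](_ : _ = (h N)%:E) -?EFinM 1?mulrC//.
    rewrite [LHS]lebesgue_measure_itv/= lte_fin ltrD2l ltr_pM2r// ltr_nat ltnSn.
    rewrite -EFinB; congr _%:E.
    by rewrite opprD addrACA subrr add0r -mulrBl -natr1 addrAC subrr add0r mul1r.
  move=> u; rewrite /cell/= !in_itv/= => /andP[iu ui]; apply/andP; split.
    by apply: le_lt_trans iu; rewrite lerDl mulr_ge0// ltW.
  apply: le_trans ui _; rewrite lerD2l -(cellN N) ler_wpM2r ?(ltW (h0 _))//.
  by rewrite ler_nat.
apply: (@dominated_cvg _ _ _ lebesgue_measure `]a, (a + T)%R] (measurable_itv _)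
  (fun N u => (step N u)%:E) (EFin \o g) (cst M%:E)) => //.
- move=> N; apply/measurable_EFinP; exact: mstep.
- by move=> u /= uaT; apply: cvg_EFin; [exact: nearW|exact: step_cvg].
- apply: (@measurable_bounded_integrable _ _ _ _ (cst M)) => //.
    apply: le_lt_trans (compact_finite_measure (@segment_compact R a (a + T)%R)).
    apply: le_measure; [by apply/mem_set; exact: measurable_itv|by apply/mem_set; exact: measurable_itv|].
    by move=> t /=; rewrite !in_itv/= => /andP[/ltW -> ->].
  by exists `|M|%R; split=> [|x Mx t _ /=]; [exact: num_real|exact: ltW].
- by move=> N u uaT; rewrite /= lee_fin; exact: step_bounded.
Qed.

End riemann.

End cadlag_riemann.

(** * Path functionals of the uncontrolled process *)

Section path_space.
Context (R : realType) (d : nat) (delta : R).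

(** Cylinders over the uniform grids of the interval from 0 to [delta]. A uniform
  grid lets the Markov property be iterated with a fixed time step, and common
  refinements make these cylinders a pi-system. *)
Definition path_cylinder : set (set (R -> 'rV[R]_d)) :=
  [set G | exists N (B : nat -> set 'rV[R]_d), (forall i, borel (B i)) /\
    G = [set p | forall i, (i <= N.+1)%N -> B i (p (i%:R * (delta / N.+1%:R)))%R]].

Definition path_space := g_sigma_algebraType path_cylinder.

Lemma borel_sigma_algebra : sigma_algebra setT (@borel R d).
Proof. exact: smallest_sigma_algebra. Qed.

Lemma borelT : borel (setT : set 'rV[R]_d).
Proof. exact: (@measurableT _ (state R d)). Qed.

Lemma path_cylinder_setI : setI_closed path_cylinder.
Proof.
move=> _ _ [N [B [mB ->]]] [M [B' [mB' ->]]].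
pose K := (N.+1 * M.+1)%N.
have K0 : (0 < K)%N by rewrite muln_gt0.
have eN i : (i%:R * (delta / N.+1%:R) = (i * M.+1)%:R * (delta / K%:R) :> R)%R.
  rewrite /K !natrM invfM -!mulrA; congr (_ * _)%R.
  by rewrite [RHS]mulrCA [in RHS](mulrCA M.+1%:R) mulfV ?mulr1// pnatr_eq0.
have eM i : (i%:R * (delta / M.+1%:R) = (i * N.+1)%:R * (delta / K%:R) :> R)%R.
  by rewrite /K !natrM invfM -!mulrA; congr (_ * _)%R;
     rewrite [RHS]mulrCA mulVKf// pnatr_eq0.
pose C k := (\bigcap_(i in [set i | (i <= N.+1)%N /\ k = (i * M.+1)%N]) B i) `&`
            (\bigcap_(i in [set i | (i <= M.+1)%N /\ k = (i * N.+1)%N]) B' i).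
exists K.-1, C; split.
  move=> k; apply: (@measurableI _ (state R d)).
    have [[j Pj]|/forallNP H] := pselect (exists i, (i <= N.+1)%N /\ k = (i * M.+1)%N).
      by apply: (@bigcap_measurable _ (state R d)); [exists j|move=> i _; exact: mB].
    rewrite (_ : \bigcap_(i in _) _ = setT); first exact: borelT.
    by apply/seteqP; split => // x _ i Pi; have := H i.
  have [[j Pj]|/forallNP H] := pselect (exists i, (i <= M.+1)%N /\ k = (i * N.+1)%N).
    by apply: (@bigcap_measurable _ (state R d)); [exists j|move=> i _; exact: mB'].
  rewrite (_ : \bigcap_(i in _) _ = setT); first exact: borelT.
  by apply/seteqP; split => // x _ i Pi; have := H i.
rewrite prednK//; apply/seteqP; split => p /=.
  move=> [H1 H2] k kK; split => i [iN ->].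
    by rewrite -eN; exact: H1.
  by rewrite -eM; exact: H2.
move=> H; split => i iN.
  have [|+ _] := H (i * M.+1)%N; first by rewrite leq_mul2r iN orbT.
  by rewrite eN => /(_ i); apply.
have [|_ +] := H (i * N.+1)%N; first by rewrite /K mulnC leq_mul2l iN orbT.
by rewrite eM => /(_ i); apply.
Qed.

Lemma measurable_path_coordinate N i : (i <= N.+1)%N ->
  measurable_fun setT
    ((fun p => p (i%:R * (delta / N.+1%:R)))%R : path_space -> state R d).
Proof.
move=> iN _ B mB; rewrite setTI; apply: sub_sigma_algebra.
exists N, (fun j => if j == i then B else setT); split.
  by move=> j; case: ifP => _; [exact: mB|exact: borelT].
apply/seteqP; split => p /=.
  by move=> Bp j jN; case: eqP => [->|//].
by move=> /(_ i iN); rewrite eqxx.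
Qed.

End path_space.

Section markov_property.
Context (R : realType) (d : nat) (dO : measure_display).
Context (Omega : measurableType dO) (X : feller_markov R d Omega).
Implicit Types (s t : R) (x : state R d) (phi : state R d -> \bar R).

Lemma sigma_algebra_fm_F t : (0 <= t)%R -> sigma_algebra setT (fm_F X t).
Proof. by have [+ _ _] := fm_filtration X; apply. Qed.

Lemma fm_F_measurable t A : (0 <= t)%R -> fm_F X t A -> measurable A.
Proof. by move=> t0; have [_ + _] := fm_filtration X; apply. Qed.

Lemma fm_F_le s t A : (0 <= s)%R -> (s <= t)%R -> fm_F X s A -> fm_F X t A.
Proof. by move=> s0 st; have [_ _ +] := fm_filtration X; apply. Qed.

Lemma fm_FT t : (0 <= t)%R -> fm_F X t setT.
Proof.
move=> /sigma_algebra_fm_F[F0 FC _].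
by rewrite -(setD0 setT); exact: FC.
Qed.

Lemma fm_FI t A B : (0 <= t)%R -> fm_F X t A -> fm_F X t B -> fm_F X t (A `&` B).
Proof.
move=> t0 FA FB.
have -> : fm_F X t = @measurable _ (g_sigma_algebraType (fm_F X t)).
  exact/esym/sigma_algebra_id/sigma_algebra_fm_F.
by apply: measurableI; exact: sub_sigma_algebra.
Qed.

Lemma measurable_fm t : (0 <= t)%R -> measurable_fun setT (X t : Omega -> state R d).
Proof.
by move=> t0 _ B mB; rewrite setTI; apply: (fm_F_measurable t0); exact: fm_adapted.
Qed.

Lemma measurable_fm_law t G : (0 <= t)%R -> measurable G ->
  measurable_fun setT (fun o => fm_law X (X t o) G).
Proof.
move=> t0 mG; apply: (measurableT_comp (measurable_kernel (fm_law X) G mG)).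
exact: measurable_fm.
Qed.

Lemma fm_markov_fun x s t A phi : (0 <= s)%R -> (0 <= t)%R -> fm_F X s A ->
  measurable_fun setT phi -> (forall y, 0 <= phi y) ->
  \int[fm_law X x]_(o in A) phi (X (s + t)%R o) =
  \int[fm_law X x]_(o in A) \int[fm_law X (X s o)]_u phi (X t u).
Proof.
move=> s0 t0 FA mphi phi0.
apply: (@ge0_integral_disintegration _ _ _ _ _ (state R d) Omega _ _
   (X (s + t)%R) (fun o => fm_law X (X s o)) (X t)) => //.
- exact: (fm_F_measurable s0).
- by apply: measurable_fm; exact: addr_ge0.
- exact: measurable_fm.
- by move=> G mG; exact: measurable_fm_law.
- by move=> G mG; exact: fm_markov.
Qed.

(** Induction on the number of grid points: the last step is averaged out by the
  Markov property and becomes the terminal function of the shorter grid, which is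
  why the statement carries an arbitrary [phi]. *)
Lemma fm_markov_grid x s h A (B : nat -> set 'rV[R]_d) n phi :
  (0 <= s)%R -> (0 <= h)%R -> fm_F X s A -> (forall i, borel (B i)) ->
  measurable_fun setT phi -> (forall y, 0 <= phi y) ->
  let C t := [set o | forall i, (i <= n)%N -> B i (X (t + i%:R * h)%R o)] in
  \int[fm_law X x]_(o in A `&` C s) phi (X (s + n%:R * h)%R o) =
  \int[fm_law X x]_(o in A)
    \int[fm_law X (X s o)]_(u in C 0%R) phi (X (n%:R * h)%R u).
Proof.
move=> s0 h0 FA mB.
have mr k (psi : state R d -> \bar R) : measurable_fun setT psi -> (forall y, 0 <= psi y) ->
    measurable_fun setT (psi \_ (B k) : state R d -> \bar R) /\
    (forall y, 0 <= (psi \_ (B k)) y).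
  move=> mpsi psi0; split; last by move=> y; rewrite /patch; case: ifP.
  have mBk : measurable (B k : set (state R d)) by exact: mB.
  by apply/(measurable_restrictT _ mBk); exact: measurable_funTS.
have rE k (psi : state R d -> \bar R) t : (fun o => psi (X t o)) \_ (X t @^-1` B k) =
    (fun o => (psi \_ (B k)) (X t o)) :> (Omega -> \bar R) by [].
elim: n phi => [|n IH] phi mphi phi0 C; rewrite {}/C.
  have [mpsi psi0] := mr 0%N phi mphi phi0.
  have CE t : [set o | forall i, (i <= 0)%N -> B i (X (t + i%:R * h)%R o)] =
      X (t + 0%:R * h)%R @^-1` B 0%N.
    by apply/seteqP; split => o /= => [|Bo i]; [exact|rewrite leqn0 => /eqP ->].
  rewrite CE integral_mkcondr rE fm_markov_fun ?mul0r//.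
  apply: eq_integral => o _.
  by rewrite CE -[X in _ = \int[_]_(u in X) _]setTI integral_mkcondr mul0r addr0 rE.
pose C t := [set o | forall i, (i <= n)%N -> B i (X (t + i%:R * h)%R o)].
have CE t : [set o | forall i, (i <= n.+1)%N -> B i (X (t + i%:R * h)%R o)] =
    C t `&` X (t + n.+1%:R * h)%R @^-1` B n.+1.
  apply/seteqP; split => o /= => [H|[H1 H2] i].
    by split=> [i ni|]; apply: H => //; rewrite leqW.
  by rewrite leq_eqVlt => /predU1P[->//|]; rewrite ltnS; exact: H1.
have nh0 : (0 <= n%:R * h)%R by rewrite mulr_ge0.
have FC t : (0 <= t)%R -> fm_F X (t + n%:R * h)%R (C t).
  move=> t0; have tn0 : (0 <= t + n%:R * h)%R by exact: addr_ge0.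
  have -> : fm_F X (t + n%:R * h)%R =
      @measurable _ (g_sigma_algebraType (fm_F X (t + n%:R * h)%R)).
    exact/esym/sigma_algebra_id/sigma_algebra_fm_F.
  rewrite (_ : C t = \bigcap_(i in `I_n.+1) X (t + i%:R * h)%R @^-1` B i)//.
  apply: bigcap_measurable; first by exists 0%N.
  move=> i /= ni; apply: sub_sigma_algebra.
  have ti0 : (0 <= t + i%:R * h)%R by rewrite addr_ge0// mulr_ge0.
  apply: (@fm_F_le (t + i%:R * h)%R) => //; last exact: fm_adapted.
  by rewrite lerD2l ler_wpM2r// ler_nat -ltnS.
have [mpsi psi0] := mr n.+1 phi mphi phi0; set psi := phi \_ (B n.+1).
have tS t : (t + n.+1%:R * h = t + n%:R * h + h)%R by rewrite -natr1 mulrDl mul1r addrA.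
have markov_n t y : (0 <= t)%R -> forall D, fm_F X (t + n%:R * h)%R D ->
  \int[fm_law X y]_(o in D) psi (X (t + n.+1%:R * h)%R o) =
  \int[fm_law X y]_(o in D) \int[fm_law X (X (t + n%:R * h)%R o)]_u psi (X h u).
  by move=> t0 D FD; rewrite tS fm_markov_fun//; exact: addr_ge0.
rewrite CE setIA integral_mkcondr rE markov_n//; last first.
  apply: fm_FI; [exact: addr_ge0| |exact: FC].
  by apply: fm_F_le FA => //; rewrite lerDl.
rewrite (IH (fun y => \int[fm_law X y]_u psi (X h u))); last 2 first.
- apply: (measurable_fun_integral_kernel (measurable_kernel (fm_law X))) => //.
  by apply: (measurableT_comp mpsi); exact: measurable_fm.
- by move=> y; exact: integral_ge0.
apply: eq_integral => o _.
have := markov_n 0%R (X s o) (lexx _) _ (FC _ (lexx _)).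
rewrite !add0r => <-.
by rewrite CE integral_mkcondr add0r.
Qed.

End markov_property.

Section path_functionals.
Context (R : realType) (d : nat) (delta : R) (delta0 : (0 < delta)%R).

Lemma continuous_measurable_state (g : 'rV[R]_d -> R) : continuous g ->
  measurable_fun setT (g : state R d -> R).
Proof.
move=> cg; apply: (measurability _ (RGenOInfty.measurableE R)).
move=> _ [_ [x ->] <-]; rewrite setTI.
apply: sub_sigma_algebra.
by apply: open_comp => [y _|]; [exact: cg|rewrite set_itvE; exact: open_gt].
Qed.

Local Notation path_space := (path_space d delta).

Definition riemann (g : 'rV[R]_d -> R) N (p : path_space) : R :=
  \sum_(i < N.+1) delta / N.+1%:R * g (p (i.+1%:R * (delta / N.+1%:R)))%R.

(** Reading the time integral off its Riemann sums makes it a measurable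
  function of countably many coordinates of the path. *)
Definition path_integral (g : 'rV[R]_d -> R) (p : path_space) : R :=
  fine (limn_esup (fun N => (riemann g N p)%:E)).

Lemma measurable_path_integral g : continuous g ->
  measurable_fun setT (path_integral g).
Proof.
move=> cg; apply: measurableT_comp => //; apply: measurable_fun_limn_esup => N.
apply/measurable_EFinP; apply: measurable_sum => i.
apply: measurable_funM => //.
apply: (measurableT_comp (continuous_measurable_state cg)).
exact: measurable_path_coordinate.
Qed.

Definition path_end (p : path_space) : state R d := p delta.

Lemma measurable_path_end : measurable_fun setT path_end.
Proof.
have := @measurable_path_coordinate R d delta 0 1 isT.
by rewrite divr1 mul1r.
Qed.

Definition path_start (p : path_space) : state R d := p 0%R.

Lemma measurable_path_start : measurable_fun setT path_start.
Proof.
have := @measurable_path_coordinate R d delta 0 0 isT.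
by rewrite mul0r.
Qed.

Context (dO : measure_display).
Context (Omega : measurableType dO) (X : feller_markov R d Omega).

Definition fm_path (s : R) (o : Omega) : path_space := fun u => X (s + u)%R o.

Lemma fm_F_path s G : (0 <= s)%R -> measurable G ->
  fm_F X (s + delta)%R (fm_path s @^-1` G).
Proof.
move=> s0; have sd0 : (0 <= s + delta)%R by rewrite addr_ge0// ltW.
have FE : fm_F X (s + delta)%R =
    @measurable _ (g_sigma_algebraType (fm_F X (s + delta)%R)).
  exact/esym/sigma_algebra_id/sigma_algebra_fm_F.
rewrite FE => mG.
suff : @measurable _ path_space `<=` [set G |
    @measurable _ (g_sigma_algebraType (fm_F X (s + delta)%R)) (fm_path s @^-1` G)].
  exact.
apply: smallest_sub.
  split.
  - by rewrite /= preimage_set0; exact: measurable0.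
  - by move=> A /= mA; rewrite setTD preimage_setC; exact: measurableC.
  - by move=> F mF; rewrite /= preimage_bigcup; exact: bigcupT_measurable.
move=> _ [N [B [mB ->]]] /=.
rewrite (_ : _ @^-1` _ =
    \bigcap_(i in `I_N.+2) X (s + i%:R * (delta / N.+1%:R))%R @^-1` B i)//.
apply: bigcap_measurable; first by exists 0%N.
move=> i /= iN; apply: sub_sigma_algebra.
have i0 : (0 <= i%:R * (delta / N.+1%:R))%R.
  by rewrite mulr_ge0// divr_ge0// ltW.
apply: (@fm_F_le _ _ _ _ _ (s + i%:R * (delta / N.+1%:R))%R).
- exact: addr_ge0.
- rewrite lerD2l mulrCA ler_piMr ?(ltW delta0)// ler_pdivrMr ?ltr0n// mul1r.
  by rewrite ler_nat -ltnS.
- by apply: fm_adapted; [exact: addr_ge0|exact: mB].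
Qed.

Lemma measurable_path s : (0 <= s)%R -> measurable_fun setT (fm_path s).
Proof.
move=> s0 _ G mG; rewrite setTI.
by apply: (@fm_F_measurable _ _ _ _ X (s + delta)%R);
  [rewrite addr_ge0// ltW|exact: fm_F_path].
Qed.

(** Cylinders are covered by [fm_markov_grid] with a constant terminal function, and
  they determine both sides. *)
Lemma path_markov_set x s A G : (0 <= s)%R -> fm_F X s A -> measurable G ->
  fm_law X x (A `&` fm_path s @^-1` G) =
  \int[fm_law X x]_(o in A) fm_law X (X s o) (fm_path 0%R @^-1` G).
Proof.
move=> s0 FA mG.
apply: (@disintegration_pi_system R _ _ _ Omega path_space Omega (@path_cylinder R d delta)
  (fm_law X x) A (fm_path s) (fun o => fm_law X (X s o)) (fm_path 0%R)) => //.
- exact: finite_kernel_measure.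
- exact: path_cylinder_setI.
- exact: fm_F_measurable FA.
- exact: measurable_path.
- exact: measurable_path.
- by move=> H mH; exact: measurable_fm_law.
- by move=> t; exact: prob_kernel.
move=> _ [N [B [mB ->]]].
have h0 : (0 <= delta / N.+1%:R)%R by rewrite divr_ge0// ltW.
have := @fm_markov_grid _ _ _ _ X x s _ A B N.+1 (cst 1) s0 h0 FA mB.
move=> /(_ (measurable_cst _) (fun=> lee01)) /=.
pose C t := [set o | forall i, (i <= N.+1)%N ->
  B i (X (t + i%:R * (delta / N.+1%:R))%R o)].
rewrite -/(C s) -/(C 0%R).
have mC t : (0 <= t)%R -> measurable (C t).
  move=> t0; rewrite (_ : C t =
    \bigcap_(i in `I_N.+2) X (t + i%:R * (delta / N.+1%:R))%R @^-1` B i)//.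
  apply: bigcap_measurable; first by exists 0%N.
  move=> i /= _; rewrite -[X in measurable X]setTI.
  by apply: measurable_fm; [rewrite addr_ge0// mulr_ge0| |exact: mB].
rewrite integral_cst; last first.
  by apply: measurableI; [exact: fm_F_measurable FA|exact: mC].
rewrite mul1e => ->; apply: eq_integral => o _.
by rewrite integral_cst ?mul1e//; exact: mC.
Qed.

Definition path_mean (phi : path_space -> \bar R) (y : state R d) : \bar R :=
  \int[fm_law X y]_o phi (fm_path 0%R o).

Lemma measurable_path_mean phi : measurable_fun setT phi -> (forall p, 0 <= phi p) ->
  measurable_fun setT (path_mean phi).
Proof.
move=> mphi phi0.
apply: (measurable_fun_integral_kernel (measurable_kernel (fm_law X))) => //.
by apply: (measurableT_comp mphi); exact: measurable_path.
Qed.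

Lemma path_mean_ge0 phi y : (forall p, 0 <= phi p) -> 0 <= path_mean phi y.
Proof. by move=> phi0; exact: integral_ge0. Qed.

(** The offset [a] is the position on the time axis of the controlled process of the
  period during which the path is followed. *)
Lemma path_integralE (g : 'rV[R]_d -> R) a s o : continuous g -> (0 <= s)%R ->
  [/\ lebesgue_measure.-integrable `[a, (a + delta)%R]
        (fun u => (g (X (s + (u - a))%R o))%:E)
    & \int[lebesgue_measure]_(u in `[a, (a + delta)%R])
        (g (X (s + (u - a))%R o))%:E = (path_integral g (fm_path s o))%:E].
Proof.
move=> cg s0; have [pr pl] := fm_cadlag X o.
pose k u := g (X (s + (u - a))%R o).
have kr t : t \in `[a, (a + delta)%R] -> k u @[u --> t^'+] --> k t.
  rewrite in_itv/= => /andP[at_ _].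
  apply: (@continuous_cvg _ _ _ _ _ (fun u => X (s + (u - a))%R o) g
    (X (s + (t - a))%R o)); first exact: cg.
  have /= := pr (s + (t - a))%R.
  rewrite addr_ge0 ?subr_ge0// => /(_ isT) H B /H [e /= e0 eB].
  exists e => // u /= ut tu; apply: eB => /=.
    by rewrite opprD addrACA subrr add0r opprB addrA subrK.
  by rewrite ltrD2l ltrD2r.
have kl t : t \in `]a, (a + delta)%R] -> cvg (k u @[u --> t^'-]).
  rewrite in_itv/= => /andP[at_ _].
  have /= := pl (s + (t - a))%R.
  rewrite ltr_wpDl ?subr_gt0// => /(_ isT) /cvg_ex[l Hl].
  apply/cvg_ex; exists (g l).
  apply: (@continuous_cvg _ _ _ _ _ (fun u => X (s + (u - a))%R o) g l).
    exact: cg.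
  move=> B /Hl [e /= e0 eB].
  exists e => // u /= ut tu; apply: eB => /=.
    by rewrite opprD addrACA subrr add0r opprB addrA subrK.
  by rewrite ltrD2l ltrD2r.
have ik := cadlag_integrable delta0 kr kl.
split => //.
have := cadlag_riemann_cvg delta0 kr kl.
have -> : (fun N => (\sum_(i < N.+1) delta / N.+1%:R *
    k (a + i.+1%:R * (delta / N.+1%:R)))%:E) =
    (fun N => (riemann g N (fm_path s o))%:E).
  apply/funext => N; congr _%:E; apply: eq_bigr => i _.
  by rewrite /k /fm_path addrAC subrr add0r.
move=> ck; rewrite /path_integral (cvg_limn_einf_sup ck).2.
by rewrite fineK//; exact: integrable_fin_num.
Qed.

End path_functionals.

(** * The information carried by a dyadic strategy *)

Section sigma_algebra_closure.
Context (T : Type) (G : set (set T)) (SG : sigma_algebra setT G).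

Lemma sigma_set0 : G set0. Proof. by case: SG. Qed.

Lemma sigma_setC A : G A -> G (~` A).
Proof. by case: SG => _ + _ => /[apply]; rewrite setTD. Qed.

Lemma sigma_setT : G setT.
Proof. by rewrite -setC0; exact/sigma_setC/sigma_set0. Qed.

Lemma sigma_cst (P : Prop) : G [set _ | P].
Proof.
have [p|p] := pselect P.
  by rewrite (_ : [set _ | _] = setT); [exact: sigma_setT|apply/seteqP; split].
by rewrite (_ : [set _ | _] = set0); [exact: sigma_set0|apply/seteqP; split].
Qed.

Lemma sigma_bigcup (F : (set T)^nat) : (forall i, G (F i)) -> G (\bigcup_i F i).
Proof. by case: SG => _ _; exact. Qed.

Lemma sigma_setU A B : G A -> G B -> G (A `|` B).
Proof.
move=> GA GB; rewrite -bigcup2E; apply: sigma_bigcup => -[|[|i]]//=.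
exact: sigma_set0.
Qed.

Lemma sigma_setI A B : G A -> G B -> G (A `&` B).
Proof.
by move=> GA GB; rewrite -[A]setCK -[B]setCK -setCU; apply/sigma_setC/sigma_setU;
  exact: sigma_setC.
Qed.

Lemma sigma_setD A B : G A -> G B -> G (A `\` B).
Proof. by move=> GA GB; rewrite setDE; apply: sigma_setI => //; exact: sigma_setC. Qed.

Lemma sigma_bigcup_cond (D : set nat) (F : (set T)^nat) :
  (forall i, D i -> G (F i)) -> G (\bigcup_(i in D) F i).
Proof.
move=> DF; rewrite bigcup_mkcond; apply: sigma_bigcup => i.
by case: ifPn => [/set_mem|_]; [exact: DF|exact: sigma_set0].
Qed.

End sigma_algebra_closure.

Section controlled_process.
Context (R : realType) (d : nat) (delta : R) (delta0 : (0 < delta)%R).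
Context (dO : measure_display) (Omega : measurableType dO).
Context (X : feller_markov R d Omega) (U : set 'rV[R]_d).
Context (V : strategy R d Omega) (admV : admissible X U V) (dyV : dyadic delta V).
Implicit Types (o : nat -> Omega) (n k j : nat) (s t : R).

Local Notation grid n := (n%:R * delta)%:E.

Lemma grid_le n m : (grid n <= grid m) = (n <= m)%N.
Proof. by rewrite lee_fin ler_pM2r// ler_nat. Qed.

Lemma grid_lt n m : (grid n < grid m) = (n < m)%N.
Proof. by rewrite lte_fin ltr_pM2r// ltr_nat. Qed.

Lemma grid_inj n m : grid n = grid m -> n = m.
Proof.
by move=> e; apply/eqP; rewrite eqn_leq -!grid_le e !lexx.
Qed.

Lemma leg_start_ge0 k o : 0 <= leg_start V k o.
Proof. by case: k => [//|k]; exact: (tau_ge0 admV). Qed.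

Lemma leg_start_grid k o : leg_start V k o = +oo \/ exists j, leg_start V k o = grid j.
Proof. by case: k => [|k]; [right; exists 0%N; rewrite mul0r|exact: dyV]. Qed.

Lemma leg_start_le_tau k o : leg_start V k o <= tau V k o.
Proof.
case: k => [|k] /=; first exact: (tau_ge0 admV).
have [too|/eqP] := eqVneq (tau V k o) +oo; first by rewrite too (tau_infty admV).
by move=> /eqP; rewrite -ltey => h; exact/ltW/(tau_incr admV).
Qed.

Lemma leg_start_lt_tau k o : (0 < k)%N -> leg_start V k o < +oo ->
  leg_start V k o < tau V k o.
Proof. by case: k => //= k _; exact: (tau_incr admV). Qed.

Lemma leg_start_mono k l o : (k <= l)%N -> leg_start V k o <= leg_start V l o.
Proof.
move=> /subnK <-; elim: (l - k)%N => [|m IH]; first by rewrite add0n.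
by rewrite addSn (le_trans IH)//; exact: leg_start_le_tau.
Qed.

(** The discrete part of the state after a possible impulse at time [n * delta]: the
  active leg [k] and its starting index [j]. For a given [n], the cells with
  [j <= n] partition the sample space, which reduces statements about the random
  active leg to statements about one leg seen from a deterministic local time. *)
Definition cell n k j : set (nat -> Omega) :=
  [set o | leg_start V k o = grid j /\ grid n < tau V k o].

Lemma cell_inj n k j k' j' o : (j <= n)%N -> (j' <= n)%N ->
  cell n k j o -> cell n k' j' o -> k = k' /\ j = j'.
Proof.
wlog kk' : k j k' j' / (k <= k')%N => [H jn jn' c c'|jn jn' [sk tk] [sk' tk']].
  by have [kk'|/ltnW kk'] := leqP k k';
    [exact: H|have [-> ->] := H _ _ _ _ kk' jn' jn c' c].
move: kk'; rewrite leq_eqVlt => /predU1P[kk'|kk'].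
  by split=> //; apply: grid_inj; rewrite -sk -sk' kk'.
have := leg_start_mono o kk'; rewrite sk' => h.
by move: (lt_le_trans tk h); rewrite grid_lt ltnNge jn'.
Qed.

Lemma cell_ex n o : exists k j, (j <= n)%N /\ cell n k j o.
Proof.
have ex : exists k, grid n < tau V k o.
  have /= : leg_start V n.+2 o = +oo \/ grid n < leg_start V n.+2 o.
    have H k : leg_start V k.+1 o = +oo \/ grid k <= leg_start V k.+1 o.
      elim: k => [|k [IH|IH]]; first by right; rewrite mul0r; exact: leg_start_ge0.
        by left; exact: (tau_infty admV).
      have [->|[j e]] := leg_start_grid k.+2 o; first by left.
      right; rewrite e grid_le -grid_lt -e; apply: (le_lt_trans IH).
      by apply: leg_start_lt_tau => //; apply: le_lt_trans (leg_start_le_tau _ _) _;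
         rewrite -[tau _ _ _]/(leg_start V k.+2 o) e ltry.
    have [->|] := H n.+1; first by left.
    by right; apply: lt_le_trans b; rewrite grid_lt.
  by case=> [e|h]; exists n.+1; rewrite ?e ?ltry.
case: (ex_minnP ex) => k tk mk.
have sk : leg_start V k o <= grid n.
  case: k tk mk => [_ _|k _ mk] /=; first by rewrite lee_fin mulr_ge0// ltW.
  by rewrite leNgt; apply/negP => /mk; rewrite ltnn.
have [e|[j e]] := leg_start_grid k o; first by rewrite e leye_eq in sk.
by exists k, j; split; [rewrite -grid_le -e|].
Qed.

Definition past k : set (set (nat -> Omega)) := <<s leg_events `I_k >>.

Lemma sigma_past k : sigma_algebra setT (past k).
Proof. exact: smallest_sigma_algebra. Qed.

Lemma past_le k l : (k <= l)%N -> past k `<=` past l.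
Proof.
move=> kl; apply: sub_smallest2r; first exact: smallest_sigma_algebra.
move=> B [i /= ik Bi]; exists i => //=; exact: leq_trans ik kl.
Qed.

Lemma past_measurable k : past k `<=` (@measurable _ (legs Omega)).
Proof.
apply: sub_smallest2r; first exact: smallest_sigma_algebra.
by move=> B [i /= ik Bi]; exists i.
Qed.

Lemma past_coordinate k i A : (i < k)%N -> measurable A ->
  past k [set o | A (o i)].
Proof.
move=> ik mA; apply: sub_sigma_algebra; exists i => //=.
by exists A => //; rewrite setTI.
Qed.

Lemma measurable_coordinate i :
  measurable_fun setT ((fun o => o i) : legs Omega -> Omega).
Proof.
move=> _ A mA; rewrite setTI; apply: (@past_measurable i.+1).
exact: past_coordinate.
Qed.

Let info_sub_past n : (forall i t, (i < n)%N -> (0 <= t)%R ->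
    past i.+1 [set o | tau V i o <= t%:E]) ->
  forall t, info X V n t `<=` past n.+1.
Proof.
move=> H t; apply: smallest_sub; first exact: smallest_sigma_algebra.
move=> _ [k [s [A [kn s0 FA ->]]]].
have -> : [set o | leg_start V k o + s%:E <= t%:E /\ A (o k)] =
    [set o | leg_start V k o <= (t - s)%:E] `&` [set o | A (o k)].
  by apply/seteqP; split => o /= [h1 h2]; split => //;
    move: h1; rewrite EFinB leeBrDr.
apply: (sigma_setI (sigma_past _)); last first.
  by apply: past_coordinate; [rewrite ltnS|exact: (fm_F_measurable s0 FA)].
have [ts|ts] := ltP (t - s)%R 0%R.
  rewrite (_ : [set _ | _] = set0); first exact: (sigma_set0 (sigma_past _)).
  apply/seteqP; split => // o /= h.
  by have := le_trans (leg_start_ge0 k o) h; rewrite lee_fin leNgt ts.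
case: k kn {FA} => [|k] kn /=.
  rewrite (_ : [set _ | _] = setT); first exact: (sigma_setT (sigma_past _)).
  by apply/seteqP; split.
by apply: (@past_le k.+1); [exact: leqW|exact: H].
Qed.

(** Whether the impulse that ends leg [n] has occurred depends on legs [0] to [n] and
  on their starting times, that is on earlier impulses: hence a strong induction. *)
Lemma past_tau n t : (0 <= t)%R -> past n.+1 [set o | tau V n o <= t%:E].
Proof.
elim/ltn_ind: n t => n IH t t0.
have H : info X V n t `<=` past n.+1 by apply: info_sub_past => i s si s0; exact: (IH i si s s0).
by apply: H; exact: (tau_markov admV t0).
Qed.

Lemma info_past n t : info X V n t `<=` past n.+1.
Proof. by apply: info_sub_past => i s _ s0; exact: past_tau. Qed.

Lemma past_xi n B : borel B -> past n.+1 (xi V n @^-1` B).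
Proof.
move=> mB; have [+ _] := @xi_info _ _ _ _ _ _ _ admV n _ mB.
apply: smallest_sub; first exact: smallest_sigma_algebra.
by move=> C [t _]; exact: info_past.
Qed.

Lemma past_leg_start k j : past k [set o | leg_start V k o = grid j].
Proof.
case: k => [|k] /=.
  have [->|j0] := eqVneq j 0%N.
    rewrite (_ : [set _ | _] = setT); first exact: (sigma_setT (sigma_past _)).
    by apply/seteqP; split => //= o _; rewrite mul0r.
  rewrite (_ : [set _ | _] = set0); first exact: (sigma_set0 (sigma_past _)).
  apply/seteqP; split => //= o; rewrite -[0]/(0%R%:E) -(mul0r delta).
  by move=> /(@grid_inj 0%N)/esym/eqP; rewrite (negbTE j0).
have m0 i : (0 <= i%:R * delta)%R by rewrite mulr_ge0// ltW.
case: j => [|j].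
  rewrite (_ : [set _ | _] = [set o | tau V k o <= grid 0%N]); first exact: past_tau.
  apply/seteqP; split => o /= h; first by rewrite h.
  by apply/eqP; rewrite eq_le h mul0r (tau_ge0 admV).
rewrite (_ : [set _ | _] = [set o | tau V k o <= grid j.+1] `\`
    [set o | tau V k o <= grid j]).
  by apply: (sigma_setD (sigma_past _)); exact: past_tau.
apply/seteqP; split => o /=.
  by move=> ->; rewrite !grid_le leqnn ltnn.
have [->|[i ->]] := dyV k o; first by rewrite leye_eq => -[].
by rewrite !grid_le => -[h1 /negP]; rewrite -ltnNge => h2; congr (_ * _)%:E;
  congr _%:R; apply/eqP; rewrite eqn_leq h1.
Qed.


(** These rectangles form a pi-system on which the two sources of randomness are
  separated: the legs before [k], and leg [k] up to its local time [s]. *)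
Definition rect k s : set (set (nat -> Omega)) :=
  [set C | exists B A, [/\ past k B, fm_F X s A & C = B `&` [set o | A (o k)]]].

Definition leg_past k s : set (set (nat -> Omega)) := <<s rect k s >>.

Lemma sigma_leg_past k s : sigma_algebra setT (leg_past k s).
Proof. exact: smallest_sigma_algebra. Qed.

Lemma past_leg_past k s : (0 <= s)%R -> past k `<=` leg_past k s.
Proof.
move=> s0 B pB; apply: sub_sigma_algebra; exists B, setT; split => //.
  exact: fm_FT.
by rewrite setIT.
Qed.

Lemma coordinate_leg_past k s A : fm_F X s A -> leg_past k s [set o | A (o k)].
Proof.
move=> FA; apply: sub_sigma_algebra; exists setT, A; split => //.
  exact: (sigma_setT (sigma_past _)).
by rewrite setTI.
Qed.

Lemma leg_past_le k s t : (0 <= s)%R -> (s <= t)%R -> leg_past k s `<=` leg_past k t.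
Proof.
move=> s0 st; apply: sub_smallest2r; first exact: smallest_sigma_algebra.
move=> _ [B [A [pB FA ->]]]; exists B, A; split => //; exact: fm_F_le FA.
Qed.

Lemma leg_past_past k s : (0 <= s)%R -> leg_past k s `<=` past k.+1.
Proof.
move=> s0; apply: smallest_sub; first exact: smallest_sigma_algebra.
move=> _ [B [A [pB FA ->]]]; apply: (sigma_setI (sigma_past _)).
  exact: (past_le (leqnSn k)).
by apply: past_coordinate => //; exact: (fm_F_measurable s0 FA).
Qed.

Lemma grid_ge0 n : (0 <= n%:R * delta)%R.
Proof. by rewrite mulr_ge0// ltW. Qed.

Hint Resolve grid_ge0 : core.

Lemma grid_sub n j : (j <= n)%N ->
  ((n - j)%:R * delta = n%:R * delta - j%:R * delta)%R.
Proof. by move=> jn; rewrite natrB// mulrBl. Qed.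

(** Once the starting time of leg [k] is fixed, a generating event about that leg is
  either visible at the deterministic local time [(n - j) * delta] or void, and a
  generating event about an earlier leg belongs to the past. *)
Lemma info_leg_past n k j B : (j <= n)%N -> info X V k (n%:R * delta)%R B ->
  leg_past k ((n - j)%:R * delta)%R
    (B `&` [set o | leg_start V k o = grid j]).
Proof.
move=> jn iB; set L := [set o | _].
have SL := sigma_leg_past k ((n - j)%:R * delta)%R.
have mL : leg_past k ((n - j)%:R * delta)%R L.
  by apply: past_leg_past => //; exact: past_leg_start.
suff : info X V k (n%:R * delta)%R `<=`
    [set B | leg_past k ((n - j)%:R * delta)%R (B `&` L)] by move=> /(_ _ iB).
apply: smallest_sub.
  split.
  - by rewrite /= set0I; exact: (sigma_set0 SL).
  - move=> A /= mA; rewrite setTD.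
    have -> : ~` A `&` L = L `\` (A `&` L).
      by rewrite setDIr setDv setU0 setIC setDE.
    exact: (sigma_setD SL).
  - by move=> F mF; rewrite /= setI_bigcupl; exact: (sigma_bigcup SL).
move=> _ [i [s [A [ik s0 FA ->]]]] /=.
move: ik; rewrite leq_eqVlt => /predU1P[->|ik].
  have [sn|sn] := leP s ((n - j)%:R * delta)%R.
    rewrite (_ : _ `&` _ = [set o | A (o k)] `&` L).
      by apply: (sigma_setI SL) => //; apply: coordinate_leg_past;
        exact: fm_F_le FA.
    apply/seteqP; split => o /= [H Lo]; first by case: H.
    split => //; split => //; rewrite Lo -EFinD lee_fin; move: sn.
    by rewrite grid_sub// lerBrDl.
  rewrite (_ : _ `&` _ = set0); first exact: (sigma_set0 SL).
  apply/seteqP; split => o // [[+ _] /= Lo]; rewrite Lo -EFinD lee_fin.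
  by move: sn; rewrite grid_sub// ltrBlDl ltNge => /negP.
apply: (sigma_setI SL) => //; apply: past_leg_past => //.
have : info X V i (n%:R * delta)%R [set o | leg_start V i o + s%:E <= grid n /\ A (o i)].
  by apply: sub_sigma_algebra; exists i, s, A.
by move=> /info_past; exact: past_le.
Qed.

Lemma cell_leg_past n k j : (j <= n)%N ->
  leg_past k ((n - j)%:R * delta)%R (cell n k j).
Proof.
move=> jn; set s := (_ * delta)%R.
have SL := sigma_leg_past k s.
have -> : cell n k j = [set o | leg_start V k o = grid j] `\`
    ([set o | tau V k o <= grid n] `&` [set o | leg_start V k o = grid j]).
  apply/seteqP; split => o /= [Lo].
    by rewrite ltNge => /negP h; split => //; case.
  by move=> H; split => //; rewrite ltNge; apply/negP => h; exact: H.
apply: (sigma_setD SL).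
  by apply: (past_leg_past (grid_ge0 _)); exact: past_leg_start.
by apply: info_leg_past => //; exact: (tau_markov admV).
Qed.

(** The information available at time [n * delta], after a possible impulse,
  described cell by cell: on a cell it is carried by a known leg at a known local
  time, where the Markov property of the uncontrolled process applies. *)
Definition known n : set (set (nat -> Omega)) :=
  [set B | forall k j, (j <= n)%N ->
     leg_past k ((n - j)%:R * delta)%R (B `&` cell n k j)].

Lemma sigma_known n : sigma_algebra setT (known n).
Proof.
split.
- by move=> k j jn; rewrite set0I; exact: (sigma_set0 (sigma_leg_past _ _)).
- move=> A KA k j jn; rewrite setTD.
  have -> : ~` A `&` cell n k j = cell n k j `\` (A `&` cell n k j).
    by rewrite setDIr setDv setU0 setIC setDE.
  by apply: (sigma_setD (sigma_leg_past _ _)); [exact: cell_leg_past|exact: KA].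
- move=> F KF k j jn; rewrite setI_bigcupl.
  by apply: (sigma_bigcup (sigma_leg_past _ _)) => i; exact: KF.
Qed.

(* pairs are coded by integers, so that the cells form a sequence *)
Definition cell_enum n (i : nat) : set (nat -> Omega) :=
  if (pickle_inv i : option (nat * nat)) is Some (k, j) then if (j <= n)%N then cell n k j else set0
  else set0.

Lemma bigcup_cell_enum n : \bigcup_i cell_enum n i = setT.
Proof.
apply/seteqP; split => // o _; have [k [j [jn ckj]]] := cell_ex n o.
by exists (choice.pickle (k, j)) => //; rewrite /cell_enum pickleK_inv jn.
Qed.

Lemma trivIset_cell_enum n : trivIset setT (cell_enum n).
Proof.
move=> i1 i2 _ _ [oo]; rewrite /cell_enum => -[].
have := @pickle_invK (nat * nat)%type i1; have := @pickle_invK (nat * nat)%type i2.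
case: (pickle_inv i1) => [[k1 j1]|//]; case: (pickle_inv i2) => [[k2 j2]|//] /= <- <-.
case: ifP => // j1n c1; case: ifP => // j2n c2.
by have [-> ->] := cell_inj j1n j2n c1 c2.
Qed.

Lemma known_measurable n : known n `<=` (@measurable _ (legs Omega)).
Proof.
move=> B KB; rewrite -(setIT B) -(bigcup_cell_enum n) setI_bigcupr.
apply: bigcupT_measurable => i; rewrite /cell_enum.
case: (pickle_inv i : option (nat * nat)) => [[k j]|]; last by rewrite setI0.
case: ifP => [jn|_]; last by rewrite setI0.
by apply: (@past_measurable k.+1); apply: (leg_past_past (grid_ge0 (n - j))); exact: KB.
Qed.

Lemma cellS n k j : cell n.+1 k j `<=` cell n k j.
Proof. by move=> o [Lo h]; split => //; apply: lt_trans h; rewrite grid_lt. Qed.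

Lemma cell_fresh n k : cell n k.+1 n = [set o | tau V k o = grid n].
Proof.
apply/seteqP; split => o /= h; first by case: h.
split => //=; rewrite -h.
by apply: (tau_incr admV); rewrite h ltry.
Qed.

Lemma cell_fresh0 n : cell n.+1 0 n.+1 = set0.
Proof.
apply/seteqP; split => o //= [/=]; rewrite -[0]/(0%R%:E) -(mul0r delta).
by move=> /(@grid_inj 0%N).
Qed.

Lemma cell_before n k o : tau V k o = grid n.+1 ->
  exists j, (j <= n)%N /\ cell n k j o.
Proof.
move=> tk.
have [e|[j e]] := leg_start_grid k o.
  by have := leg_start_le_tau k o; rewrite e tk leye_eq.
exists j; split; last by split => //; rewrite tk grid_lt.
case: k tk e => [_ /=|k tk e].
  by rewrite -[0]/(0%R%:E) -(mul0r delta) => /(@grid_inj 0%N) <-.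
rewrite -ltnS -grid_lt -e -tk; apply: leg_start_lt_tau => //.
by rewrite e ltry.
Qed.

(** A cell at the next grid time is contained in the same cell at time [n * delta],
  unless its leg is fresh; what has been seen on the old leg then belongs to the past
  of the new one. *)
Lemma known_step n (B : set (nat -> Omega)) :
  (forall k j, (j <= n)%N ->
     leg_past k ((n.+1 - j)%:R * delta)%R (B `&` cell n k j)) ->
  known n.+1 B.
Proof.
move=> KB k j; rewrite leq_eqVlt => /predU1P[->|jn].
  rewrite subnn mul0r; case: k => [|k].
    by rewrite cell_fresh0 setI0; exact: (sigma_set0 (sigma_leg_past _ _)).
  apply: past_leg_past => //; rewrite cell_fresh.
  rewrite (_ : _ `&` _ = \bigcup_(j in `I_n.+1)
      (B `&` cell n k j) `&` [set o | tau V k o = grid n.+1]).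
    apply: (sigma_setI (sigma_past _)); last by exact: (@past_leg_start k.+1 n.+1).
    apply: (sigma_bigcup_cond (sigma_past _)) => i /=; rewrite ltnS => ni.
    by apply: (leg_past_past (grid_ge0 (n.+1 - i))); exact: KB.
  rewrite -setI_bigcupr -setIA; congr (_ `&` _).
  apply/seteqP; split => o /= tk; last by case: tk.
  split => //.
  by have [i [ni ci]] := cell_before tk; exists i.
rewrite -{1}(setIidr (@cellS n k j)) setIA.
apply: (sigma_setI (sigma_leg_past _ _)); last by apply: cell_leg_past; exact: leqW.
exact: KB.
Qed.

Let leg_pastS n k j : leg_past k ((n - j)%:R * delta)%R `<=`
  leg_past k ((n.+1 - j)%:R * delta)%R.
Proof.
by apply: leg_past_le => //; rewrite ler_pM2r// ler_nat; apply: leq_sub2r; exact: leqnSn.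
Qed.

Lemma known_segment n (B : set (nat -> Omega)) (A : nat -> set Omega) :
  (forall i, fm_F X (i.+1%:R * delta)%R (A i)) ->
  (forall k j, (j <= n)%N ->
     B `&` cell n k j = [set o | A (n - j)%N (o k)] `&` cell n k j) ->
  known n.+1 B.
Proof.
move=> FA BA; apply: known_step => k j jn; rewrite BA//.
apply: (sigma_setI (sigma_leg_past _ _)); last first.
  by apply: leg_pastS; exact: cell_leg_past.
by rewrite subSn//; exact: coordinate_leg_past.
Qed.

Lemma known_le n : known n `<=` known n.+1.
Proof. by move=> B KB; apply: known_step => k j jn; by apply: leg_pastS; exact: KB. Qed.


(** * The controlled process on the time grid *)

Definition act n o : nat := active_leg V (n%:R * delta)%R o.

Definition loc n o : R := (n%:R * delta - fine (leg_start V (act n o) o))%R.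

Lemma act_cell n k j o : (j <= n)%N -> cell n k j o -> act n o = k.
Proof.
move=> jn ckj; rewrite /act /active_leg; case: xgetP => [l _ /= /andP[sl tl]|].
  have [e|[i e]] := leg_start_grid l o; first by rewrite e leye_eq in sl.
  have li : (i <= n)%N by rewrite -grid_le -e.
  by have [] := cell_inj li jn (conj e tl) ckj.
by case: ckj => sk tk /(_ k) /=; rewrite sk grid_le jn tk.
Qed.

Lemma loc_cell n k j o : (j <= n)%N -> cell n k j o ->
  loc n o = ((n - j)%:R * delta)%R.
Proof.
by move=> jn ckj; rewrite /loc (act_cell jn ckj); case: ckj => -> _; rewrite grid_sub.
Qed.

(** The sigma-algebra on paths reads them up to time [delta] only; what the leg does
  after the next possible impulse stays invisible. *)
Definition segment n o : path_space d delta := fm_path delta X (loc n o) (o (act n o)).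

(** An impulse is recognised by an active leg of age zero; the initial leg also has
  age zero at time 0, but no impulse precedes it. *)
Definition impulse n o : bool := (0 < act n o)%N && (loc n o == 0%R).

Definition target n o : 'rV[R]_d := xi V (act n o).-1 o.

(** At an impulse time the active leg is already the new one, so the state before the
  impulse is read at the end of the preceding segment. *)
Definition pre n o : state R d :=
  if n is n'.+1 then path_end (segment n' o) else X 0%R (o 0%N).

Definition post n o : state R d := if impulse n o then target n o else pre n o.

Lemma segment_cell n k j o : (j <= n)%N -> cell n k j o ->
  segment n o = fm_path delta X ((n - j)%:R * delta)%R (o k).
Proof. by move=> jn ckj; rewrite /segment (loc_cell jn ckj) (act_cell jn ckj). Qed.

Lemma impulse_cell n k j o : (j <= n)%N -> cell n k j o ->
  impulse n o = (0 < k)%N && (j == n).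
Proof.
move=> jn ckj; rewrite /impulse (act_cell jn ckj) (loc_cell jn ckj).
rewrite mulf_eq0 (gt_eqF delta0) orbF pnatr_eq0 subn_eq0.
by rewrite eqn_leq jn.
Qed.

Lemma pre_noimpulse n o : ~~ impulse n o -> pre n o = path_start (segment n o).
Proof.
have [k [j [jn ckj]]] := cell_ex n o.
rewrite (impulse_cell jn ckj) (segment_cell jn ckj) /path_start /fm_path addr0.
case: n jn ckj => [|n] jn ckj.
  move: jn ckj; rewrite leqn0 => /eqP -> [].
  by case: k => [|k] //=; rewrite subnn mul0r.
rewrite negb_and -leqNgt leqn0 => H.
have jn' : (j <= n)%N.
  case/orP: H => [/eqP k0|]; last by move: jn; rewrite leq_eqVlt => /orP[->|].
  by move: ckj; rewrite k0; case: (ltngtP j n.+1) jn => // -> _; rewrite cell_fresh0.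
rewrite /= /path_end (segment_cell jn' (cellS ckj)) /fm_path.
by rewrite subSn// -natr1 mulrDl mul1r.
Qed.

(** Being known at time [n * delta] is encoded as measurability on this space. *)
Definition info_space n := g_sigma_algebraType (known n).

Lemma measurable_info_space n : (@measurable _ (info_space n)) = known n.
Proof. exact/sigma_algebra_id/sigma_known. Qed.

Lemma known_impulse n : known n [set o | impulse n o].
Proof.
move=> k j jn.
have [h|h] := boolP ((0 < k)%N && (j == n)).
  rewrite (_ : _ `&` _ = cell n k j); first exact: cell_leg_past.
  apply/seteqP; split => [ o []//|o ckj]; split => //=.
  by rewrite (impulse_cell jn ckj).
rewrite (_ : _ `&` _ = set0); first exact: (sigma_set0 (sigma_leg_past _ _)).
apply/seteqP; split => o //= [+ ckj].
by rewrite (impulse_cell jn ckj) (negbTE h).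
Qed.

Lemma known_target n B : borel B -> known n ([set o | impulse n o] `&` target n @^-1` B).
Proof.
move=> mB k j jn.
have [/andP[k0 /eqP jE]|h] := boolP ((0 < k)%N && (j == n)); last first.
  rewrite (_ : _ `&` _ = set0); first exact: (sigma_set0 (sigma_leg_past _ _)).
  apply/seteqP; split => o //= [[+ _] ckj].
  by rewrite (impulse_cell jn ckj) (negbTE h).
rewrite (_ : _ `&` _ = (xi V k.-1 @^-1` B) `&` cell n k j).
  apply: (sigma_setI (sigma_leg_past _ _)); last exact: cell_leg_past.
  apply: past_leg_past => //; rewrite -[k in past k]prednK//.
  exact: past_xi.
apply/seteqP; split => o [+ ckj]; rewrite /target /= (act_cell jn ckj).
  by move=> [_].
by move=> Bo; split => //; split => //; rewrite (impulse_cell jn ckj) k0 jE eqxx.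
Qed.

Lemma measurable_segment n : measurable_fun setT (segment n : info_space n.+1 -> path_space d delta).
Proof.
move=> _ G mG; rewrite setTI measurable_info_space.
apply: (@known_segment n _ (fun i => fm_path delta X (i%:R * delta)%R @^-1` G)).
  move=> i; rewrite -natr1 mulrDl mul1r; exact: fm_F_path.
move=> k j jn; apply/seteqP; split => o [/= + ckj];
  by rewrite (segment_cell jn ckj).
Qed.

Lemma measurable_info_spaceS n d1 (T : measurableType d1) (f : (nat -> Omega) -> T) :
  measurable_fun setT (f : info_space n -> T) ->
  measurable_fun setT (f : info_space n.+1 -> T).
Proof.
move=> mf _ A mA; have := mf measurableT A mA.
by rewrite !measurable_info_space !setTI; exact: known_le.
Qed.

Lemma measurable_info_space_legs n d1 (T : measurableType d1) (f : (nat -> Omega) -> T) :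
  measurable_fun setT (f : info_space n -> T) ->
  measurable_fun setT (f : legs Omega -> T).
Proof.
move=> mf _ A mA; have := mf measurableT A mA.
by rewrite !measurable_info_space !setTI; exact: known_measurable.
Qed.

Lemma measurable_pre n : measurable_fun setT (pre n : info_space n -> state R d).
Proof.
case: n => [|n]; last first.
  by apply: (measurableT_comp (@measurable_path_end R d delta)); exact: measurable_segment.
move=> _ B mB; rewrite setTI measurable_info_space => k j.
rewrite leqn0 => /eqP ->.
apply: (sigma_setI (sigma_leg_past _ _)); last exact: cell_leg_past.
case: k => [|k].
  by apply: (@coordinate_leg_past 0 _ (X 0%R @^-1` B)); rewrite subnn mul0r; exact: fm_adapted.
apply: past_leg_past => //; apply: (@past_coordinate k.+1 0 (X 0%R @^-1` B)) => //.
by apply: (fm_F_measurable (lexx 0%R)); exact: fm_adapted.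
Qed.

Lemma measurable_impulse n : measurable_fun setT (impulse n : info_space n -> bool).
Proof.
apply: (measurable_fun_bool true); rewrite setTI measurable_info_space.
exact: known_impulse.
Qed.

(** The cost is continuous on targets in [U] only; filling in a point [u0] of [U]
  when there is no impulse keeps its argument there at all times. *)
Definition targetU (u0 : 'rV[R]_d) n o : state R d :=
  if impulse n o then target n o else u0.

Lemma measurable_targetU u0 n :
  measurable_fun setT (targetU u0 n : info_space n -> state R d).
Proof.
move=> _ B mB; rewrite setTI measurable_info_space.
rewrite (_ : _ @^-1` _ = ([set o | impulse n o] `&` target n @^-1` B) `|`
   (~` [set o | impulse n o] `&` [set _ | B u0])).
  apply: (sigma_setU (sigma_known n)); first exact: known_target.
  apply: (sigma_setI (sigma_known n)).
    by apply: (sigma_setC (sigma_known n)); exact: known_impulse.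
  exact: (sigma_cst (sigma_known n)).
apply/seteqP; split => o /=; rewrite /targetU; case: ifP => h.
- by left.
- by right; split.
- by case=> -[].
- by case=> -[].
Qed.

Lemma postE n o : post n o = if impulse n o then target n o else pre n o.
Proof. by []. Qed.

Lemma post_targetU u0 n o : post n o = if impulse n o then targetU u0 n o else pre n o.
Proof. by rewrite /post /targetU; case: ifP. Qed.

Lemma measurable_post n : measurable_fun setT (post n : info_space n -> state R d).
Proof.
rewrite (_ : post n = fun o => if impulse n o then targetU 0%R n o else pre n o).
  by apply: measurable_fun_ifT; [exact: measurable_impulse|
    exact: measurable_targetU|exact: measurable_pre].
by apply/funext => o; exact: post_targetU.
Qed.


Lemma tau_ge_grid k o : grid k <= tau V k o.
Proof.
elim: k => [|k IH]; first by rewrite mul0r; exact: (tau_ge0 admV).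
have [e|[j e]] := dyV k.+1 o; first by rewrite e leey.
rewrite e grid_le -grid_lt -e; apply: (le_lt_trans IH).
by apply: (@leg_start_lt_tau k.+1) => //; apply: le_lt_trans (leg_start_le_tau _ _) _;
  rewrite e ltry.
Qed.

Lemma impulse_tau n o : impulse n o -> tau V (act n o).-1 o = grid n.
Proof.
have [k [j [jn ckj]]] := cell_ex n o.
rewrite (impulse_cell jn ckj) (act_cell jn ckj) => /andP[k0 /eqP jE].
by case: ckj; case: k k0 => //= k _ -> _; rewrite jE.
Qed.

Lemma tau_impulse n k o : tau V k o = grid n -> impulse n o /\ act n o = k.+1.
Proof.
move=> tk; have : cell n k.+1 n o by rewrite cell_fresh.
by move=> ck; rewrite (impulse_cell (leqnn n) ck) (act_cell (leqnn n) ck) eqxx.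
Qed.

Lemma pre_impulseE n k o : tau V k o = grid n -> pre_impulse X V k o = pre n o.
Proof.
rewrite /pre_impulse; case: n => [|n] tk.
  have := tau_ge_grid k o; rewrite tk grid_le leqn0 => /eqP k0.
  by rewrite k0 /= mul0r subr0.
have [j [jn ckj]] := cell_before tk.
rewrite /= (segment_cell jn ckj) /path_end /fm_path; case: ckj => -> _ /=.
by rewrite tk grid_sub// -natr1 mulrDl mul1r [in RHS]addrAC.
Qed.

Section pathwise_reward.
Variables (f : 'rV[R]_d -> R) (c : 'rV[R]_d * 'rV[R]_d -> R).
Hypothesis (cf : continuous f).

Definition cost n o : R := if impulse n o then c (pre n o, target n o) else 0%R.

Lemma costE n o :
  cost n o = if impulse n o then c (pre n o, target n o) else 0%R.
Proof. by []. Qed.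

Lemma controlled_segment n o s : (n%:R * delta <= s < n.+1%:R * delta)%R ->
  controlled X V s o = X (loc n o + (s - n%:R * delta))%R (o (act n o)).
Proof.
move=> /andP[ns sn].
have [k [j [jn ckj]]] := cell_ex n o.
have sE : active_leg V s o = k.
  rewrite /active_leg; case: xgetP => [l _ /= /andP[sl tl]|].
    have [e|[i e]] := leg_start_grid l o; first by rewrite e leye_eq in sl.
    have li : (i <= n)%N.
      rewrite -ltnS -grid_lt -e; apply: le_lt_trans sl _.
      by rewrite lte_fin.
    have ct : cell n l i o by split=> //; apply: le_lt_trans tl; rewrite lee_fin.
    by have [] := cell_inj li jn ct ckj.
  move=> /(_ k) /= []; case: ckj => -> tk; apply/andP; split.
    by rewrite lee_fin (le_trans _ ns)// ler_pM2r// ler_nat.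
  have [->|[i e]] := dyV k o; first by rewrite ltry.
  rewrite e grid_lt in tk *.
  apply: (@lt_le_trans _ _ (grid n.+1)); first by rewrite lte_fin.
  by rewrite grid_le.
rewrite /controlled sE /loc (act_cell jn ckj); congr (X _ _).
by ring.
Qed.

Lemma integral_controlled n o :
  \int[lebesgue_measure]_(s in `[0%R, (n%:R * delta)%R]) (f (controlled X V s o))%:E =
  (\sum_(i < n) path_integral f (segment i o))%:E.
Proof.
pose g s := (f (controlled X V s o))%:E.
have loc0 i : (0 <= loc i o)%R.
  by have [k [j [jn ckj]]] := cell_ex i o; rewrite (loc_cell jn ckj).
have gE i : {in `[(i%:R * delta)%R, (i.+1%:R * delta)%R[ , g =1
    fun s => (f (X (loc i o + (s - i%:R * delta))%R (o (act i o))))%:E}.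
  by move=> s; rewrite in_itv/= /g => /controlled_segment ->.
have iS i : (i%:R * delta + delta = i.+1%:R * delta)%R.
  by rewrite -natr1 mulrDl mul1r.
have mgi i : measurable_fun `[(i%:R * delta)%R, (i.+1%:R * delta)%R[ g.
  have [/measurable_int + _] := path_integralE delta0 X (i%:R * delta)%R
    (o (act i o)) cf (loc0 i).
  rewrite iS => m; apply: (eq_measurable_fun
    (fun s => (f (X (loc i o + (s - i%:R * delta))%R (o (act i o))))%:E)).
    by move=> s /set_mem /= /gE ->.
  apply: measurable_funS m => //.
  by move=> s /=; rewrite !in_itv/= => /andP[-> /ltW].
have gi i : \int[lebesgue_measure]_(s in `[(i%:R * delta)%R, (i.+1%:R * delta)%R[) g s =
    (path_integral f (segment i o))%:E.
  have [/measurable_int m e] := path_integralE delta0 X (i%:R * delta)%R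
    (o (act i o)) cf (loc0 i).
  rewrite iS in m e; rewrite /segment -e.
  rewrite -[RHS]integral_itv_bndo_bndc; last first.
    apply: measurable_funS m => //.
    by move=> s /=; rewrite !in_itv/= => /andP[-> /ltW].
  by apply: eq_integral => s /set_mem /= /gE ->.
have split_itv i : `[0%R, (i.+1%:R * delta)%R[%classic =
    `[0%R, (i%:R * delta)%R[ `|` `[(i%:R * delta)%R, (i.+1%:R * delta)%R[%classic.
  rewrite -itv_bndbnd_setU// bnd_simp//.
  by rewrite ler_pM2r// ler_nat.
have mg i : measurable_fun `[0%R, (i%:R * delta)%R[ g.
  elim: i => [|i IH].
    by rewrite mul0r set_itvco0; exact: measurable_fun_set0.
  by rewrite split_itv; apply/measurable_funU.
rewrite -integral_itv_bndo_bndc; last exact: mg.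
elim: n => [|n IH].
  by rewrite mul0r set_itvco0 integral_set0 big_ord0.
rewrite split_itv integral_setU//; last 2 first.
- by rewrite -split_itv; exact: mg.
- apply/disj_set2P/seteqP; split => // s /=; rewrite !in_itv/=.
  by move=> [/andP[_ a] /andP[b _]]; move: (lt_le_trans a b); rewrite ltxx.
by rewrite IH gi big_ord_recr/= EFinD.
Qed.

Lemma sum_cost n o :
  \sum_(0 <= k <oo) (if tau V k o <= grid n
     then (c (pre_impulse X V k o, xi V k o))%:E else 0) =
  (\sum_(i < n.+1) cost i o)%:E.
Proof.
pose a k : \bar R := if tau V k o <= grid n
     then (c (pre_impulse X V k o, xi V k o))%:E else 0.
have a0 k : (n < k)%N -> a k = 0.
  move=> nk; rewrite /a ifF//; apply/negbTE; rewrite -ltNge.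
  by apply: lt_le_trans (tau_ge_grid k o); rewrite grid_lt.
have -> : \sum_(0 <= k <oo) a k = \sum_(k < n.+1) a k.
  apply/cvg_lim => //; apply: cvg_near_cst; exists n.+1 => // m /= nm.
  rewrite -(big_mkord xpredT a) (big_cat_nat _ nm)//=.
  have -> : \sum_(n.+1 <= i < m) a i = 0.
    by rewrite big_nat_cond big1// => i /andP[/andP[ni _] _]; exact: a0.
  by rewrite adde0.
rewrite -sumEFin.
have aE (k : 'I_n.+1) : a k = \sum_(i < n.+1)
    (if tau V k o == grid i then (c (pre_impulse X V k o, xi V k o))%:E else 0).
  rewrite /a; have [e|[i e]] := dyV k o.
    by rewrite e leye_eq /= big1// => i _; rewrite ifF.
  rewrite e grid_le; case: leqP => [ni|ni].
    have ni' : (i < n.+1)%N by [].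
    rewrite (bigD1 (Ordinal ni'))//= eqxx big1 ?adde0// => j ji.
    rewrite ifF//; apply/negbTE; apply: contra ji => /eqP/grid_inj ij.
    by apply/eqP/val_inj.
  rewrite big1// => j _; rewrite ifF//; apply/negbTE/eqP => /grid_inj ij.
  by move: ni; rewrite ij ltnNge -ltnS ltn_ord.
under eq_bigr => k _ do rewrite aE.
rewrite exchange_big/=.
apply: eq_bigr => i _; rewrite /cost; case: ifPn => h.
  have ti := impulse_tau h; set k := (act i o).-1 in ti.
  have kn : (k < n.+1)%N.
    by apply: leq_ltn_trans (ltn_ord i); rewrite -grid_le -ti; exact: tau_ge_grid.
  rewrite (bigD1 (Ordinal kn))//= ti eqxx big1 ?adde0.
    by rewrite (pre_impulseE ti).
  move=> l lk; rewrite ifF//; apply/negbTE; apply: contra lk => /eqP tl.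
  by have [_ e] := tau_impulse tl; apply/eqP/val_inj; rewrite /= /k e.
rewrite big1// => k _; rewrite ifF//; apply/negbTE/eqP => /tau_impulse[h' _].
by rewrite h' in h.
Qed.

(** On each cell of the time grid the controlled path is the current segment, and
  each impulse takes place at exactly one grid time. The impulse at the horizon
  itself is paid for, which accounts for the extra term. *)
Lemma total_rewardE n o : total_reward X f c V (n%:R * delta)%R o =
  (\sum_(i < n) (path_integral f (segment i o) + cost i o) + cost n o)%:E.
Proof.
rewrite /total_reward integral_controlled sum_cost big_ord_recr/= -EFinD.
by rewrite addrA -big_split.
Qed.

End pathwise_reward.

(** * Markov property on the time grid *)

Context (x : 'rV[R]_d) (Q : probability (legs Omega) R)
  (CQ : controlled_law X V x Q).

Definition leg_origin k o : state R d := if k is k'.+1 then xi V k' o else x.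

Lemma measurable_leg_origin k :
  measurable_fun setT (leg_origin k : legs Omega -> state R d).
Proof.
case: k => [|k]; first exact: measurable_cst.
move=> _ B mB; rewrite setTI; apply: (@past_measurable k.+1).
exact: past_xi.
Qed.

Lemma leg_law_set k B A : past k B -> measurable A ->
  Q (B `&` [set o | A (o k)]) = \int[Q]_(o in B) fm_law X (leg_origin k o) A.
Proof.
case: k => [|k] pB mA; last by have [_ +] := CQ; exact.
have : past 0 `<=` [set B | B = set0 \/ B = setT].
  apply: smallest_sub; last by move=> C [i].
  split.
  - by left.
  - by move=> C [->|->]; [right; rewrite setD0|left; rewrite setDv].
  - move=> F HF; have [[i Fi]|/forallNP H] := pselect (exists i, F i = setT).
      by right; apply/seteqP; split => // o _; exists i => //; rewrite Fi.
    left; apply/seteqP; split => // o [i _]; have [->//|] := HF i.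
    by move=> e; have := H i.
move=> /(_ _ pB) [->|->]; first by rewrite set0I measure0 integral_set0.
rewrite setTI CQ.1//; have /= := @integral_cst _ (legs Omega) R Q setT measurableT.
by move=> ->; rewrite probability_setT mule1.
Qed.

Lemma leg_law_fun k B (psi : Omega -> \bar R) : past k B ->
  measurable_fun setT psi -> (forall u, 0 <= psi u) ->
  \int[Q]_(o in B) psi (o k) =
  \int[Q]_(o in B) \int[fm_law X (leg_origin k o)]_u psi u.
Proof.
move=> pB mpsi psi0.
apply: (@ge0_integral_disintegration R _ _ _ (legs Omega) Omega Omega Q B
  (fun o => o k) (fun o => fm_law X (leg_origin k o)) id) => //.
- exact: past_measurable pB.
- exact: measurable_coordinate.
- move=> G mG.
  apply: (measurableT_comp (measurable_kernel (fm_law X) G mG)).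
  exact: measurable_leg_origin.
- by move=> G mG; exact: leg_law_set.
Qed.

(** On a rectangle, the construction of the controlled measure gives leg [k] its
  conditional law, and then the Markov property of the uncontrolled process applies
  at the deterministic local time [s]. *)
Lemma leg_past_markov k s B G : (0 <= s)%R -> leg_past k s B -> measurable G ->
  Q (B `&` [set o | G (fm_path delta X s (o k))]) =
  \int[Q]_(o in B) fm_law X (X s (o k)) (fm_path delta X 0%R @^-1` G).
Proof.
move=> s0 lB mG.
have mk : measurable_fun setT ((fun o => o k) : legs Omega -> Omega).
  exact: measurable_coordinate.
have mps : measurable_fun setT (fm_path delta X s) by exact: measurable_path.
have mp0 : measurable_fun setT (fm_path delta X 0%R) by exact: measurable_path.
have mp0G : measurable (fm_path delta X 0%R @^-1` G).
  by rewrite -[X in measurable X]setTI; exact: mp0.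
have mpsG : measurable (fm_path delta X s @^-1` G).
  by rewrite -[X in measurable X]setTI; exact: mps.
have mlaw : measurable_fun setT
    (fun u => fm_law X (X s u) (fm_path delta X 0%R @^-1` G)).
  exact: measurable_fm_law.
have meas_coord A : measurable A -> measurable ([set o | A (o k)] : set (legs Omega)).
  by move=> mA; rewrite -[X in measurable X]setTI; exact: mk.
have mB : measurable (B : set (legs Omega)).
  by apply: (@past_measurable k.+1); exact: (leg_past_past s0).
transitivity (\int[Q]_(o in B) (\1_[set o | G (fm_path delta X s (o k))] o)%:E).
  rewrite integral_indic//; first by rewrite setIC.
  exact: (meas_coord (fm_path delta X s @^-1` G)).
apply: (@eq_integral_pi_system R _ (legs Omega) Q (rect k s)) => //.
- move=> _ [C [A [pC FA ->]]]; apply: measurableI.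
    exact: past_measurable pC.
  by apply: meas_coord; exact: (fm_F_measurable s0 FA).
- move=> _ _ [C1 [A1 [pC1 FA1 ->]]] [C2 [A2 [pC2 FA2 ->]]].
  exists (C1 `&` C2), (A1 `&` A2); split.
  + exact: (sigma_setI (sigma_past k)).
  + exact: fm_FI.
  + by rewrite setIACA.
- exists setT, setT; split.
  + exact: (sigma_setT (sigma_past k)).
  + exact: fm_FT.
  + by rewrite setIT.
- apply/measurable_EFinP/measurable_indic.
  exact: (meas_coord (fm_path delta X s @^-1` G)).
- exact: (measurableT_comp mlaw mk).
- rewrite integral_indic ?setIT//; last exact: (meas_coord (fm_path delta X s @^-1` G)).
  by apply: le_lt_trans (probability_le1 _ _) _; rewrite ?ltry//;
    exact: (meas_coord (fm_path delta X s @^-1` G)).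
move=> _ [C [A [pC FA ->]]].
have mA := fm_F_measurable s0 FA.
rewrite integral_indic; last 2 first.
- by apply: measurableI; [exact: past_measurable pC|exact: meas_coord].
- exact: (meas_coord (fm_path delta X s @^-1` G)).
transitivity (Q (C `&` [set o | (A `&` fm_path delta X s @^-1` G) (o k)])).
  by congr (Q _); rewrite setIC -setIA.
rewrite (@leg_law_set k C (A `&` fm_path delta X s @^-1` G))//; last exact: measurableI.
transitivity (\int[Q]_(o in C) \int[fm_law X (leg_origin k o)]_u
    ((fun u => fm_law X (X s u) (fm_path delta X 0%R @^-1` G)) \_ A) u).
  by apply: eq_integral => o _; rewrite path_markov_set// integral_mkcond.
rewrite -(@leg_law_fun k C
  ((fun u => fm_law X (X s u) (fm_path delta X 0%R @^-1` G)) \_ A))//.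
- by rewrite integral_mkcondr.
- by apply/(measurable_restrictT _ mA); exact: measurable_funTS.
- by move=> u; rewrite /patch; case: ifP.
Qed.

(** The cells are countably many, and on each of them the segment is the path of a
  fixed leg seen from a fixed local time. *)
Lemma known_markov n B (phi : path_space d delta -> \bar R) : known n B ->
  measurable_fun setT phi -> (forall p, 0 <= phi p) ->
  \int[Q]_(o in B) phi (segment n o) =
  \int[Q]_(o in B) path_mean X phi (path_start (segment n o)).
Proof.
move=> KB mphi phi0.
have mB := known_measurable KB.
have mseg : measurable_fun setT (segment n : legs Omega -> path_space d delta).
  exact: (measurable_info_space_legs (@measurable_segment n)).
have ml : measurable_fun setT (fun o : legs Omega => phi (segment n o)).
  exact: measurableT_comp.
have mr : measurable_fun setT
    (fun o : legs Omega => path_mean X phi (path_start (segment n o))).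
  apply: (measurableT_comp (measurable_path_mean delta0 X mphi phi0)).
  exact: (measurableT_comp (@measurable_path_start R d delta)).
have mc i : measurable (B `&` cell_enum n i : set (legs Omega)).
  rewrite /cell_enum; case: (pickle_inv i) => [[k j]|]; last by rewrite setI0.
  case: ifP => [jn|_]; last by rewrite setI0.
  apply: (@past_measurable k.+1); apply: (leg_past_past (grid_ge0 (n - j))).
  exact: KB.
have BE : B = \bigcup_i (B `&` cell_enum n i).
  by rewrite -setI_bigcupr bigcup_cell_enum setIT.
rewrite {}BE !ge0_integral_bigcup//; first last.
- exact/trivIset_setIl/trivIset_cell_enum.
- exact: measurable_funTS.
- exact/trivIset_setIl/trivIset_cell_enum.
- by move=> o _; exact: path_mean_ge0.
- exact: measurable_funTS.
apply: eq_eseriesr => i _; move: (mc i); rewrite /cell_enum.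
case: (pickle_inv i) => [[k j]|]; last by rewrite setI0 !integral_set0.
case: ifP => [jn mBc|_]; last by rewrite setI0 !integral_set0.
have s0 := grid_ge0 (n - j).
have Bc := KB k j jn.
have mk : measurable_fun setT ((fun o => o k) : legs Omega -> Omega).
  exact: measurable_coordinate.
transitivity (\int[Q]_(o in B `&` cell n k j)
    phi (fm_path delta X ((n - j)%:R * delta)%R (o k))).
  by apply: eq_integral => o /set_mem[_ ckj]; rewrite (segment_cell jn ckj).
transitivity (\int[Q]_(o in B `&` cell n k j)
    path_mean X phi (X ((n - j)%:R * delta)%R (o k))); last first.
  apply: eq_integral => o /set_mem[_ ckj]; rewrite (segment_cell jn ckj).
  by rewrite /path_start /fm_path addr0.
apply: (@ge0_integral_disintegration R _ _ _ (legs Omega) (path_space d delta) Omega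
  Q (B `&` cell n k j) (fun o => fm_path delta X ((n - j)%:R * delta)%R (o k))
  (fun o => fm_law X (X ((n - j)%:R * delta)%R (o k))) (fm_path delta X 0%R)) => //.
- by apply: measurableT_comp => //; exact: measurable_path.
- exact: measurable_path.
- move=> G mG; apply: (measurableT_comp (measurable_fm_law X s0 mG)); exact: mk.
- by move=> G mG; exact: leg_past_markov.
Qed.


Lemma borel_singleton (y : 'rV[R]_d) : borel [set y].
Proof.
rewrite -[X in borel X]setCK; apply: (sigma_setC (@borel_sigma_algebra R d)).
apply: sub_sigma_algebra; apply: closed_openC.
by apply: accessible_closed_set1; apply: hausdorff_accessible; exact: norm_hausdorff.
Qed.

Lemma fm_law_start (y : 'rV[R]_d) (B : set 'rV[R]_d) : borel B -> B y ->
  fm_law X y (X 0%R @^-1` (~` B)) = 0.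
Proof.
move=> mB By; apply/eqP; rewrite -measure_le0.
have mX0 (C : set 'rV[R]_d) : borel C -> measurable (X 0%R @^-1` C).
  by move=> mC; apply: (fm_F_measurable (lexx 0%R)); exact: fm_adapted.
have m1 := mX0 _ (borel_singleton y).
have mC : borel (~` B) by exact: (sigma_setC (@borel_sigma_algebra R d)).
suff : fm_law X y (X 0%R @^-1` [set y]) + fm_law X y (X 0%R @^-1` (~` B)) <= 1.
  by rewrite (fm_start X y) -leeBrDl// subee.
rewrite -measureU//.
- rewrite -(prob_kernel (s := fm_law X) y); apply: le_measure => //; apply/mem_set.
  by apply: measurableU => //; exact: mX0.
  exact: measurableT.
- exact: mX0.
- by apply/seteqP; split => // u /= [->].
Qed.

Let aeQ : Filter (almost_everywhere Q) := ae_filter_ringOfSetsType Q.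

(** Each leg starts from the target of the impulse almost surely. Two distinct points
  are separated by a rational number in one of their coordinates, so that countably
  many null events are enough. *)
Lemma leg_start_ae k : {ae Q, forall o, X 0%R (o k.+1) = xi V k o}.
Proof.
pose P (m : nat) o := if (choice.unpickle m : option ('I_d * rat)) is Some (i, q) then
   ~ (xi V k o 0%R i < ratr q <= X 0%R (o k.+1) 0%R i)%R /\
   ~ (X 0%R (o k.+1) 0%R i < ratr q <= xi V k o 0%R i)%R
  else True.
have null B : borel B ->
    Q ((xi V k @^-1` B) `&` [set o | (X 0%R @^-1` (~` B)) (o k.+1)]) = 0.
  move=> mB; rewrite (@leg_law_set k.+1); last 2 first.
  - exact: past_xi.
  - apply: (fm_F_measurable (lexx 0%R)); apply: fm_adapted => //.
    exact: (sigma_setC (@borel_sigma_algebra R d)).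
  by rewrite integral0_eq// => o Bo; exact: fm_law_start.
have nullB B : borel B -> {ae Q, forall o, ~ (B (xi V k o) /\ ~ B (X 0%R (o k.+1)))}.
  move=> mB; exists ((xi V k @^-1` B) `&` [set o | (X 0%R @^-1` (~` B)) (o k.+1)]).
  split; last by move=> o /= /contrapT.
  - apply: measurableI; first by apply: (@past_measurable k.+1); exact: past_xi.
    apply: (@past_measurable k.+2); apply: past_coordinate => //.
    apply: (fm_F_measurable (lexx 0%R)); apply: fm_adapted => //.
    exact: (sigma_setC (@borel_sigma_algebra R d)).
  - exact: null.
have aeP m : {ae Q, forall o, P m o}.
  rewrite /P; case: (choice.unpickle m) => [[i q]|]; last exact: aeW.
  have mB : borel [set y : 'rV[R]_d | (y 0 i < ratr q)%R].
    apply: sub_sigma_algebra.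
    apply: (@open_comp _ _ (fun y : 'rV[R]_d => y 0%R i) [set r | (r < ratr q)%R]).
      by move=> y _; exact: coord_continuous.
    exact: open_lt.
  have h1 := nullB _ mB.
  have h2 := nullB _ (sigma_setC (@borel_sigma_algebra R d) mB).
  move: h1 h2; apply: (@filterS2 _ _ aeQ) => o /= h1 h2; split => /andP[a b].
    by apply: h1; split => //; apply/negP; rewrite -leNgt.
  by apply: h2; split; [apply/negP; rewrite -leNgt|move=> h; apply: h].
have := ae_foralln aeP.
apply: (@filterS _ _ aeQ) => o H; apply/matrixP => z i; rewrite (ord1 z).
apply: contrapT => /eqP; rewrite neq_lt => /orP[] /rat_in_itvoo[q].
  rewrite in_itv/= => /andP[a b].
  have := H (choice.pickle (i, q)); rewrite /P choice.pickleK => -[_]; apply.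
  by rewrite a ltW.
rewrite in_itv/= => /andP[a b].
have := H (choice.pickle (i, q)); rewrite /P choice.pickleK => -[+ _]; apply.
by rewrite a ltW.
Qed.

Lemma post_ae n : {ae Q, forall o, path_start (segment n o) = post n o}.
Proof.
have := ae_foralln leg_start_ae.
apply: (@filterS _ _ aeQ) => o H; rewrite /post.
case: ifPn => [|h]; last by rewrite pre_noimpulse.
rewrite /impulse /path_start /segment /fm_path /target => /andP[a0 /eqP ->].
by rewrite addr0 -{1}(prednK a0) H.
Qed.

(** The conditional law of the next segment is governed by its starting point, which
  is almost surely the state after the possible impulse. The random time of the
  impulse has disappeared: all impulses are seen from the deterministic grid. *)
Lemma markov_step n (g : (nat -> Omega) -> \bar R)
    (phi : path_space d delta -> \bar R) :
  measurable_fun setT (g : info_space n -> \bar R) -> (forall o, 0 <= g o) ->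
  measurable_fun setT phi -> (forall p, 0 <= phi p) ->
  \int[Q]_o (g o * phi (segment n o)) = \int[Q]_o (g o * path_mean X phi (post n o)).
Proof.
move=> mg g0 mphi phi0.
have mseg : measurable_fun setT (segment n : legs Omega -> path_space d delta).
  exact: (measurable_info_space_legs (@measurable_segment n)).
have mm := measurable_path_mean delta0 X mphi phi0.
have mr : measurable_fun setT
    (fun o : legs Omega => path_mean X phi (path_start (segment n o))).
  apply: (measurableT_comp mm).
  exact: (measurableT_comp (@measurable_path_start R d delta)).
have mp : measurable_fun setT (fun o : legs Omega => path_mean X phi (post n o)).
  apply: (measurableT_comp mm).
  exact: (measurable_info_space_legs (@measurable_post n)).
have mgl := measurable_info_space_legs mg.
transitivity (\int[Q]_o (g o * path_mean X phi (path_start (segment n o)))).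
  apply: (@ge0_integralM_sub_sigma R _ (legs Omega) Q (known n)) => //.
  - by rewrite (sigma_algebra_id (sigma_known n)); exact: known_measurable.
  - exact: measurableT_comp.
  - by move=> o; exact: path_mean_ge0.
  - move=> B; rewrite (sigma_algebra_id (sigma_known n)) => KB.
    exact: known_markov.
apply: ae_eq_integral => //.
- exact: emeasurable_funM.
- exact: emeasurable_funM.
by apply: (@filterS _ _ aeQ) (post_ae n) => o e _; rewrite e.
Qed.

Lemma integral_pre0 (phi : state R d -> \bar R) :
  measurable_fun setT phi -> (forall y, 0 <= phi y) ->
  \int[Q]_o phi (pre 0 o) = phi x.
Proof.
move=> mphi phi0.
have mX0 : measurable_fun setT (X 0%R : Omega -> state R d) by exact: measurable_fm.
have mp : measurable_fun setT (fun u => phi (X 0%R u)).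
  exact: (measurableT_comp mphi mX0).
rewrite (@leg_law_fun 0 setT (fun u => phi (X 0%R u)))//; last first.
  exact: (sigma_setT (sigma_past 0)).
transitivity (\int[Q]_(o in setT) cst (phi x) o).
  apply: eq_integral => o _ /=.
  transitivity (\int[fm_law X x]_u cst (phi x) u).
    apply: ae_eq_integral => //.
    exists (X 0%R @^-1` (~` [set x])); split.
    - apply: (fm_F_measurable (lexx 0%R)); apply: fm_adapted => //.
      by apply: (sigma_setC (@borel_sigma_algebra R d)); exact: borel_singleton.
    - by apply: fm_law_start => //; exact: borel_singleton.
    - by move=> u /= h e; apply: h => _; rewrite e.
  by rewrite integral_cst// prob_kernel mule1.
have /= := @integral_cst _ (legs Omega) R Q setT measurableT.
by move=> ->; rewrite [X in _ * X](_ : _ = 1) ?mule1//; exact: probability_setT.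
Qed.

End controlled_process.

(** * Measurable choices *)

Section measurable_choice.
Context dT (T : measurableType dT).

Lemma measurable_glue d' (S : measurableType d') (idx : T -> nat)
    (g : nat -> T -> S) :
  (forall n, measurable [set t | idx t = n]) ->
  (forall n, measurable_fun setT (g n)) ->
  measurable_fun setT (fun t => g (idx t) t).
Proof.
move=> midx mg _ B mB; rewrite setTI.
rewrite (_ : _ @^-1` B = \bigcup_n ([set t | idx t = n] `&` g n @^-1` B)).
  apply: bigcupT_measurable => n; apply: measurableI => //.
  by rewrite -[X in measurable X]setTI; exact: mg.
by apply/seteqP; split => [t Bt|t [n _ [<- //]]]; exists (idx t).
Qed.

Lemma measurable_first_index (P : nat -> T -> bool) :
  (forall n, measurable [set t | P n t]) -> (forall t, exists n, P n t) ->
  exists idx : T -> nat, (forall t, P (idx t) t) /\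
    forall n, measurable [set t | idx t = n].
Proof.
move=> mP exP; exists (fun t => ex_minn (exP t)); split=> [t|n].
  by case: ex_minnP.
rewrite (_ : [set _ | _] = [set t | P n t] `&`
    \bigcap_(m in `I_n) ~` [set t | P m t]); last first.
  apply/seteqP; split => t /=; case: ex_minnP => m Pm mini.
    move=> <-; split => // k /= km Pk.
    by move: (mini _ Pk); rewrite leqNgt km.
  move=> [Pn H]; apply/eqP; rewrite eqn_leq mini//= leqNgt.
  by apply/negP => mn; exact: H Pm.
apply: measurableI => //.
by apply: fin_bigcap_measurable => [|m _]; [exact: finite_II|exact: measurableC].
Qed.

End measurable_choice.

Section dense_sequences.
Context (R : realType) (d : nat).

(** The graph of any function is separable: a point is chosen close to each rational
  position at which this is possible. The function is arbitrary because it will be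
  a certainty equivalent, which is measurable but whose continuity is unknown. *)
Lemma graph_dense_sequence (U : set 'rV[R]_d) (s : 'rV[R]_d -> R) :
  U !=set0 -> exists D : nat -> 'rV[R]_d, (forall n, U (D n)) /\
    forall xi (e : R), U xi -> (0 < e)%R ->
      exists n, (`|D n - xi| < e)%R /\ (`|s (D n) - s xi| < e)%R.
Proof.
move=> [u0 Uu0].
pose near (p : 'rV[rat]_d * rat * nat) u := U u /\
  (forall i, `|u 0 i - ratr (p.1.1 0 i)| < p.2.+1%:R^-1)%R /\
  (`|s u - ratr p.1.2| < p.2.+1%:R^-1)%R.
have ex (p : 'rV[rat]_d * rat * nat) :
    exists u, U u /\ ((exists v, near p v) -> near p u).
  have [[v pv]|nv] := pselect (exists v, near p v).
    by exists v; split => //; case: pv.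
  by exists u0; split.
have [F HF] := choice ex.
exists (fun n => if (choice.unpickle n : option ('rV[rat]_d * rat * nat)) is Some p
                 then F p else u0); split.
  by move=> n; case: choice.unpickle => [p|//]; exact: (HF p).1.
move=> xi e Uxi e0.
pose m := Num.bound (2 / e)%R.
have [h [hE h0 he]] : exists h : R, [/\ (m.+1%:R^-1 = h)%R, (0 < h)%R & (h + h < e)%R].
  exists (m.+1%:R^-1)%R; split => //.
  have : (2 / e < m.+1%:R)%R.
    apply: lt_le_trans (archi_boundP _) _; first by rewrite divr_ge0// ltW.
    by rewrite ler_nat.
  rewrite ltr_pdivrMr// => h; rewrite -mulr2n -[X in (X < _)%R]mulr_natl.
  by rewrite ltr_pdivrMr// mulrC.
have rat_near (a : R) : exists q : rat, (`|a - ratr q| < h)%R.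
  have /rat_in_itvoo[q] : (a - h < a + h)%R by lra.
  by rewrite in_itv/= => /andP[h1 h2]; exists q; rewrite ltr_norml; apply/andP; split; lra.
have [q Hq] := choice (fun i : 'I_d => rat_near (xi 0%R i)).
have [t Ht] := rat_near (s xi).
pose p := (\row_i q i, t, m).
have [Up [Np sp]] : near p (F p).
  apply: (HF p).2; exists xi; split => //; split => [i|] /=; rewrite hE//.
  by rewrite mxE; exact: Hq.
rewrite /= hE in Np sp.
exists (choice.pickle p); rewrite choice.pickleK; split; last first.
  move: sp Ht; rewrite !ltr_norml => /andP[a b] /andP[a' b'].
  by apply/andP; split; lra.
suff : ball (F p) e xi by rewrite mx_norm_ball.
split => // i j; rewrite (ord1 i).
have := Np j; have := Hq j; rewrite mxE.
rewrite -ball_normE/= !ltr_norml => /andP[a b] /andP[a' b'].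
by apply/andP; split; lra.
Qed.

End dense_sequences.

Section caratheodory.
Context (R : realType) (d : nat) (U : set 'rV[R]_d).
Variable c : 'rV[R]_d * 'rV[R]_d -> R.
Hypothesis cc : {within setT `*` U, continuous c}.

Lemma within_continuous_dist x xi (e : R) : U xi -> (0 < e)%R ->
  exists2 h : R, (0 < h)%R & forall x' xi', U xi' ->
    (`|x - x'| < h)%R -> (`|xi - xi'| < h)%R ->
    (`|c (x, xi) - c (x', xi')| < e)%R.
Proof.
move=> Uxi e0.
have /subspace_continuousP/(_ (x, xi)) := cc.
move=> /(_ (conj Logic.I Uxi)) /cvgrPdist_lt/(_ e e0).
rewrite /prop_near1 /within /= => -[[A B] /= [nA nB] AB].
move: nA => /nbhs_ballP[h1 /= h10 H1]; move: nB => /nbhs_ballP[h2 /= h20 H2].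
exists (Num.min h1 h2); first by rewrite lt_min h10.
move=> x' xi' Uxi'; rewrite !lt_min => /andP[x1 _] /andP[_ xi2].
apply: (AB (x', xi')) => //; split => /=.
  by apply: H1; rewrite -ball_normE.
by apply: H2; rewrite -ball_normE.
Qed.

Lemma cost_continuous xi : U xi -> continuous (fun x => c (x, xi)).
Proof.
move=> Uxi x; apply/(@cvgrPdist_lt R R _ (nbhs (x : 'rV[R]_d)) _) => e e0.
have [h h0 H] := within_continuous_dist x Uxi e0.
apply/nbhs_ballP; exists h => //= x'; rewrite -ball_normE/= => xx'.
by apply: H => //; rewrite subrr normr0.
Qed.

Lemma cost_bounded_below x : compact U ->
  exists M : R, forall xi, U xi -> (M <= c (x, xi))%R.
Proof.
move=> cU; have [|M HM] := @compact_locally_bounded R _ U (fun xi => - c (x, xi))%R cU.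
  move=> xi Uxi; have [h h0 H] := within_continuous_dist x Uxi ltr01.
  exists h, (1 - c (x, xi))%R; split => // xi' Uxi' xx'.
  have := H x xi' Uxi'; rewrite subrr normr0 => /(_ h0 xx').
  by rewrite ltr_norml => /andP[a b]; lra.
by exists (- M)%R => xi /HM; rewrite lerNl.
Qed.

(** The second argument is approximated by the first close enough term of a dense
  sequence; between the values of that index the cost is a continuous function of
  its first argument. *)
Lemma measurable_cost dT (T : measurableType dT) (a b : T -> state R d) :
  measurable_fun setT a -> measurable_fun setT b -> (forall t, U (b t)) ->
  measurable_fun setT (fun t => c (a t, b t)).
Proof.
move=> ma mb Ub; have [->|/set0P[t0 _]] := eqVneq [set: T] set0.
  exact: measurable_fun_set0.
have [|D [UD dD]] := @graph_dense_sequence R d U (cst 0%R).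
  by exists (b t0); exact: Ub.
pose P N n t := (`|(D n : 'rV[R]_d) - b t| < N.+1%:R^-1)%R.
have mP N n : measurable [set t | P N n t].
  rewrite (_ : [set _ | _] = b @^-1` (ball (D n) (N.+1%:R^-1)%R)); last first.
    by rewrite -ball_normE.
  rewrite -[X in measurable X]setTI; apply: mb => //.
  by apply: sub_sigma_algebra; exact: ball_open.
have exP N t : exists n, P N n t.
  by have [|n []] := dD (b t) (N.+1%:R^-1)%R (Ub t); [rewrite invr_gt0|exists n].
have := choice (fun N => measurable_first_index (mP N) (exP N)).
move=> [idx Hidx].
apply: (measurable_fun_cvg (h := fun N t => c (a t, D (idx N t)))) => [N|t _].
  apply: (measurable_glue (g := fun n t => c (a t, D n))).
    by case: (Hidx N).
  move=> n; have mc := continuous_measurable_state (cost_continuous (UD n)).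
  exact: (measurableT_comp mc ma).
apply/cvgrPdist_lt => e e0.
have [h h0 H] := within_continuous_dist (a t) (Ub t) e0.
have : \forall N \near \oo, (N.+1%:R^-1 < h :> R)%R.
  have /cvgrPdist_lt/(_ h h0) := @cvg_harmonic R.
  by apply: filterS => N; rewrite sub0r normrN /= ger0_norm ?invr_ge0.
apply: filterS => N Nh; apply: H => //; first by rewrite subrr normr0.
by rewrite distrC; apply: lt_trans Nh; exact: (Hidx N).1.
Qed.

End caratheodory.

(** * Exponential moments *)

Section exponential_moments.
Context (R : realType).

Lemma expR_convex (s a b : R) : (0 <= s <= 1)%R ->
  (expR (s * a + (1 - s) * b) <= s * expR a + (1 - s) * expR b)%R.
Proof.
move=> /andP[s0 s1].
set m := (s * a + (1 - s) * b)%R.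
(* the tangent of the exponential at the mean lies below both values *)
have tangent u : (expR m * (1 + (u - m)) <= expR u)%R.
  have -> : (expR u = expR m * expR (u - m))%R by rewrite -expRD addrC subrK.
  rewrite ler_wpM2l ?expR_ge0//.
  exact: expR_ge1Dx.
have h1 : (s * (expR m * (1 + (a - m))) <= s * expR a)%R by rewrite ler_wpM2l.
have h2 : ((1 - s) * (expR m * (1 + (b - m))) <= (1 - s) * expR b)%R.
  by rewrite ler_wpM2l// subr_ge0.
apply: le_trans (lerD h1 h2); rewrite le_eqVlt; apply/orP; left; apply/eqP.
rewrite [RHS](_ : _ = expR m * (1 + ((s * a + (1 - s) * b) - m)))%R; last by ring.
by rewrite -/m subrr addr0 mulr1.
Qed.


Context dT (T : measurableType dT) (m : {measure set T -> \bar R}).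
Implicit Types (u v : T -> R) (a b l s : R).

Local Notation E u := (\int[m]_t (expR (u t))%:E).

Lemma measurable_expR_fun u : measurable_fun setT u ->
  measurable_fun setT (fun t => (expR (u t))%:E).
Proof. by move=> mu; apply/measurable_EFinP; exact: measurableT_comp. Qed.

Lemma integral_expR_shift u a : measurable_fun setT u ->
  E (fun t => u t + a)%R = (expR a)%:E * E u.
Proof.
move=> mu; rewrite -ge0_integralZl//.
- by apply: eq_integral => t _; rewrite expRD EFinM muleC.
- exact: measurable_expR_fun.
Qed.

(** Logarithmic moments are convex. After both factors are normalised to mean at most
  one, this is the pointwise convexity of the exponential. *)
Lemma expR_hoelder_le s u v a b : (0 <= s <= 1)%R ->
  measurable_fun setT u -> measurable_fun setT v ->
  E u <= (expR a)%:E -> E v <= (expR b)%:E ->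
  E (fun t => s * u t + (1 - s) * v t)%R <= (expR (s * a + (1 - s) * b))%:E.
Proof.
move=> s01 mu mv ua vb; have /andP[s0 s1] := s01.
have mu' : measurable_fun setT (fun t => u t + - a)%R by exact: measurable_funD.
have mv' : measurable_fun setT (fun t => v t + - b)%R by exact: measurable_funD.
have norm w k : measurable_fun setT w -> E w <= (expR k)%:E -> E (fun t => w t + - k)%R <= 1.
  move=> mw wk; rewrite integral_expR_shift//.
  apply: (@le_trans _ _ ((expR (- k))%:E * (expR k)%:E)).
    by rewrite lee_wpmul2l// lee_fin expR_ge0.
  by rewrite -EFinM -expRD addNr expR0.
have nu := norm _ _ mu ua; have nv := norm _ _ mv vb.
have ms : measurable_fun setT (fun t => s * (u t + - a) + (1 - s) * (v t + - b))%R.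
  by apply: measurable_funD; apply: measurable_funM.
have -> : E (fun t => s * u t + (1 - s) * v t)%R =
    E (fun t => (s * (u t + - a) + (1 - s) * (v t + - b)) + (s * a + (1 - s) * b))%R.
  by apply: eq_integral => t _; congr (expR _)%:E; ring.
rewrite integral_expR_shift//.
rewrite -[leRHS]mule1 lee_wpmul2l ?lee_fin ?expR_ge0//.
have s1' : (0 <= 1 - s)%R by rewrite subr_ge0.
apply: (@le_trans _ _ (s%:E * E (fun t => u t + - a)%R + (1 - s)%:E * E (fun t => v t + - b)%R)).
  have me1 := measurable_expR_fun mu'; have me2 := measurable_expR_fun mv'.
  have e0 w (t : T) : setT t -> 0 <= (expR (w t))%:E by rewrite lee_fin expR_ge0.
  rewrite -!ge0_integralZl//; do ?[exact: e0].
  rewrite -ge0_integralD//;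
    do ?[by move=> t _; rewrite mule_ge0// lee_fin expR_ge0];
    do ?[exact: measurable_funeM].
  apply: ge0_le_integral => //.
  - exact: measurable_expR_fun.
  - by apply: emeasurable_funD; exact: measurable_funeM.
  - by move=> t _; rewrite -!EFinM -EFinD lee_fin; exact: expR_convex.
apply: (@le_trans _ _ (s%:E * 1 + (1 - s)%:E * 1)).
  by apply: leeD; rewrite lee_wpmul2l// lee_fin.
by rewrite !mule1 -EFinD addrC subrK.
Qed.

(** The same convexity, solved for the moment of [u]: a lower bound on the mixed
  moment and an upper bound on the other factor bound it from below. *)
Lemma expR_hoelder_ge s u v l b : (0 < s <= 1)%R ->
  measurable_fun setT u -> measurable_fun setT v ->
  (expR l)%:E <= E (fun t => s * u t + (1 - s) * v t)%R ->
  E v <= (expR b)%:E -> (expR ((l - (1 - s) * b) / s))%:E <= E u.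
Proof.
move=> /andP[s0 s1] mu mv le vb; rewrite leNgt; apply/negP => H.
have [a [ua al]] : exists a, E u <= (expR a)%:E /\ (a < (l - (1 - s) * b) / s)%R.
  have Eu0 : 0 <= E u by apply: integral_ge0 => t _; rewrite lee_fin expR_ge0.
  move: H; case: (E u) Eu0 => [r|//|//]; rewrite lee_fin => r0; rewrite lte_fin => rl.
  have [r1|r1] := ltP 0%R r.
    exists (ln r); rewrite lnK ?posrE//; split => //.
    by rewrite -ltr_expR lnK ?posrE.
  exists ((l - (1 - s) * b) / s - 1)%R; split; last by lra.
  by rewrite lee_fin (le_trans r1)// expR_ge0.
have := expR_hoelder_le _ mu mv ua vb => /(_ s).
rewrite (ltW s0) s1 => /(_ isT) /(le_trans le).
rewrite lee_fin ler_expR => h.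
move: al; rewrite ltr_pdivlMr// => al.
by move: h; lra.
Qed.

(** Pointwise, the larger of the two exponents decides. *)
Lemma integral_expR_add_le u v (A B : R) :
  measurable_fun setT u -> measurable_fun setT v ->
  E (fun t => 2 * u t)%R <= A%:E -> E (fun t => 2 * v t)%R <= B%:E ->
  E (fun t => u t + v t)%R <= (A + B)%:E.
Proof.
move=> mu mv uA vB.
have mu2 : measurable_fun setT (fun t => 2 * u t)%R by exact: measurable_funM.
have mv2 : measurable_fun setT (fun t => 2 * v t)%R by exact: measurable_funM.
rewrite EFinD; apply: le_trans (leeD uA vB).
rewrite -ge0_integralD//;
  do ?[by move=> t _; rewrite lee_fin expR_ge0]; do ?[exact: measurable_expR_fun].
apply: ge0_le_integral => //.
- by apply: measurable_expR_fun; exact: measurable_funD.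
- by apply: emeasurable_funD; exact: measurable_expR_fun.
move=> t _; rewrite -EFinD lee_fin.
have [uv|uv] := leP (u t) (v t).
  apply: (@le_trans _ _ (expR (2 * v t))); last by rewrite lerDr expR_ge0.
  by rewrite ler_expR; lra.
apply: (@le_trans _ _ (expR (2 * u t))); last by rewrite lerDl expR_ge0.
by rewrite ler_expR; lra.
Qed.

End exponential_moments.

(** * Multiplicative functionals of the controlled process *)

Section gain.
Context (R : realType) (d : nat) (delta : R) (delta0 : (0 < delta)%R).
Context (dO : measure_display) (Omega : measurableType dO).
Context (X : feller_markov R d Omega) (U : set 'rV[R]_d).
Context (f : 'rV[R]_d -> R) (cf : continuous f).
Context (c : 'rV[R]_d * 'rV[R]_d -> R) (cc : {within setT `*` U, continuous c}).
Context (alpha kappa : R) (rho h : state R d -> R)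
  (mrho : measurable_fun setT rho) (mh : measurable_fun setT h).

Definition step_functional (p : path_space d delta) : \bar R :=
  (expR (alpha * path_integral f p + h (path_end p)))%:E.

Definition step_mean : state R d -> \bar R := path_mean X step_functional.

Lemma step_functional_ge0 p : 0 <= step_functional p.
Proof. by rewrite lee_fin expR_ge0. Qed.

Lemma measurable_step_exponent : measurable_fun setT
  (fun p : path_space d delta => alpha * path_integral f p + h (path_end p))%R.
Proof.
apply: measurable_funD.
  by apply: measurable_funM => //; exact: measurable_path_integral.
by apply: (measurableT_comp mh); exact: measurable_path_end.
Qed.

Lemma measurable_step_functional : measurable_fun setT step_functional.
Proof. exact: (measurable_expR_fun measurable_step_exponent). Qed.

Lemma measurable_step_mean : measurable_fun setT step_mean.
Proof.
apply: measurable_path_mean => //; first exact: measurable_step_functional.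
exact: step_functional_ge0.
Qed.

Lemma step_mean_ge0 y : 0 <= step_mean y.
Proof. by apply: path_mean_ge0; exact: step_functional_ge0. Qed.

Context (V : strategy R d Omega) (admV : admissible X U V) (dyV : dyadic delta V).
Context (x : 'rV[R]_d) (Q : probability (legs Omega) R)
  (CQ : controlled_law X V x Q).
Implicit Types (o : nat -> Omega).

Local Notation info_space n := (info_space delta X V n).
Local Notation segment := (segment delta X V).
Local Notation pre := (pre delta X V).
Local Notation post := (post delta X V).
Local Notation cost := (cost delta X V c).

Lemma measurable_cost_step n :
  measurable_fun setT (cost n : info_space n -> R).
Proof.
have [|/set0P[u0 Uu0]] := eqVneq U set0.
  move=> U0; have := xi_target admV 0 (fun=> point); by rewrite U0.
have Ut o : U (targetU delta V u0 n o).
  by rewrite /targetU; case: ifP => // _; exact: (xi_target admV).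
rewrite (_ : cost n = fun o => if impulse delta V n o
    then c (pre n o, targetU delta V u0 n o) else 0%R); last first.
  by apply/funext => o; rewrite costE /targetU; case: ifP.
apply: measurable_fun_ifT => //.
  exact: (measurable_impulse delta0 admV dyV).
apply: (measurable_cost cc) => //.
  exact: (measurable_pre delta0 admV dyV (n := n)).
exact: (measurable_targetU delta0 admV dyV).
Qed.

(** The exponent of a Feynman-Kac functional. The factors [alpha] and [kappa] turn the
  reward and the cost into utility, and [rho] charges the states after the impulses;
  the two bounds on the value differ by the choice of these parameters. *)
Definition gain n o : R :=
  \sum_(i < n) (alpha * path_integral f (segment i o) + kappa * cost i o +
                rho (post i o)).

Lemma measurable_gain n : measurable_fun setT (gain n : info_space n -> R).
Proof.
elim: n => [|n IH].
  rewrite (_ : gain 0 = cst 0%R); first exact: measurable_cst.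
  by apply/funext => o; rewrite /gain big_ord0.
rewrite (_ : gain n.+1 = fun o => gain n o + (alpha * path_integral f (segment n o) +
    kappa * cost n o + rho (post n o)))%R; last first.
  by apply/funext => o; rewrite /gain big_ord_recr.
apply: measurable_funD; first exact: (measurable_info_spaceS delta0 admV dyV IH).
apply: measurable_funD; last first.
  apply: (measurable_info_spaceS delta0 admV dyV (n := n)).
  exact: (measurableT_comp mrho (measurable_post delta0 admV dyV (n := n))).
apply: measurable_funD; apply: measurable_funM => //.
  apply: (measurableT_comp (measurable_path_integral cf)).
  exact: (measurable_segment delta0 admV dyV).
apply: (measurable_info_spaceS delta0 admV dyV (n := n)).
exact: measurable_cost_step.
Qed.

Lemma measurable_gain_exponent n :
  measurable_fun setT (fun o : info_space n => gain n o + h (pre n o))%R.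
Proof.
apply: measurable_funD; first exact: measurable_gain.
exact: (measurableT_comp mh (measurable_pre delta0 admV dyV (n := n))).
Qed.

Let known_exponent n o := (gain n o + (kappa * cost n o + rho (post n o)))%R.

Let measurable_known_exponent n :
  measurable_fun setT (known_exponent n : info_space n -> R).
Proof.
apply: measurable_funD; first exact: measurable_gain.
apply: measurable_funD.
  by apply: measurable_funM => //; exact: measurable_cost_step.
exact: (measurableT_comp mrho (measurable_post delta0 admV dyV (n := n))).
Qed.

(** Everything up to the impulse at time [n * delta] is known, so that only the next
  period has to be averaged, over the uncontrolled law. *)
Lemma gain_step n :
  \int[Q]_o (expR (gain n.+1 o + h (pre n.+1 o)))%:E =
  \int[Q]_o ((expR (gain n o))%:E *
     ((expR (kappa * cost n o + rho (post n o)))%:E * step_mean (post n o))).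
Proof.
transitivity (\int[Q]_o ((expR (known_exponent n o))%:E * step_functional (segment n o))).
  apply: eq_integral => o _; rewrite /step_functional -EFinM -expRD.
  by congr (expR _)%:E; rewrite /known_exponent /gain big_ord_recr/=; ring.
rewrite (markov_step delta0 admV dyV CQ).
- by apply: eq_integral => o _; rewrite /known_exponent expRD EFinM muleA.
- exact: (measurable_expR_fun (measurable_known_exponent (n := n))).
- by move=> o; rewrite lee_fin expR_ge0.
- exact: measurable_step_functional.
- exact: step_functional_ge0.
Qed.

Lemma gain0 : \int[Q]_o (expR (gain 0 o + h (pre 0 o)))%:E = (expR (h x))%:E.
Proof.
under eq_integral do rewrite /gain big_ord0 add0r.
rewrite (integral_pre0 delta admV CQ (phi := fun y => (expR (h y))%:E))//.
exact: (measurable_expR_fun mh).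
Qed.

Let measurable_integrand n : measurable_fun setT (fun o : legs Omega =>
  (expR (gain n o))%:E *
     ((expR (kappa * cost n o + rho (post n o)))%:E * step_mean (post n o))).
Proof.
apply: (measurable_info_space_legs delta0 admV dyV (n := n)).
apply: emeasurable_funM; first exact: (measurable_expR_fun (measurable_gain (n := n))).
apply: emeasurable_funM.
  apply: (@measurable_expR_fun _ _ (info_space n)); apply: measurable_funD.
    by apply: measurable_funM => //; exact: measurable_cost_step.
  exact: (measurableT_comp mrho (measurable_post delta0 admV dyV (n := n))).
exact: (measurableT_comp measurable_step_mean (measurable_post delta0 admV dyV (n := n))).
Qed.

(** Submartingale form of the one-step inequality. *)
Lemma gain_ge n :
  (forall n o, (expR (h (pre n o)))%:E <=
     (expR (kappa * cost n o + rho (post n o)))%:E * step_mean (post n o)) ->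
  (expR (h x))%:E <= \int[Q]_o (expR (gain n o + h (pre n o)))%:E.
Proof.
move=> H; elim: n => [|n IH]; first by rewrite gain0.
apply: (le_trans IH); rewrite gain_step; apply: ge0_le_integral => //.
- apply: (measurable_info_space_legs delta0 admV dyV (n := n)).
  exact: (measurable_expR_fun (measurable_gain_exponent (n := n))).
- by move=> o _; rewrite expRD EFinM lee_wpmul2l// lee_fin expR_ge0.
Qed.

(** Supermartingale form, up to a factor [expR D] for each step. *)
Lemma gain_le (D : R) n :
  (forall n o, (expR (kappa * cost n o + rho (post n o)))%:E *
     step_mean (post n o) <= (expR (D + h (pre n o)))%:E) ->
  \int[Q]_o (expR (gain n o + h (pre n o)))%:E <= (expR (n%:R * D + h x))%:E.
Proof.
move=> H; elim: n => [|n IH]; first by rewrite gain0 mul0r add0r.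
rewrite gain_step.
apply: (@le_trans _ _ (\int[Q]_o (expR (gain n o + h (pre n o) + D))%:E)).
  apply: ge0_le_integral => //.
  - by move=> o _; rewrite !mule_ge0 ?lee_fin ?expR_ge0//; exact: step_mean_ge0.
  - apply: (measurable_info_space_legs delta0 admV dyV (n := n)).
    apply: measurable_expR_fun; apply: measurable_funD => //.
    exact: measurable_gain_exponent.
  - move=> o _; rewrite -addrA [X in _ <= X%:E]expRD EFinM [(h _ + _)%R]addrC.
    by rewrite lee_wpmul2l// lee_fin expR_ge0.
rewrite integral_expR_shift; last first.
  apply: (measurable_info_space_legs delta0 admV dyV (n := n)).
  exact: measurable_gain_exponent.
apply: (@le_trans _ _ ((expR D)%:E * (expR (n%:R * D + h x))%:E)).
  by rewrite lee_wpmul2l// lee_fin expR_ge0.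
by rewrite -EFinM -expRD lee_fin ler_expR -natr1; lra.
Qed.

End gain.

(** * Consequences of the growth assumptions *)

Section entropic_utility_bounds.
Context (R : realType) dT (T : measurableType dT) (m : {measure set T -> \bar R}).
Implicit Types (Z : T -> R) (a r : R).

Lemma entropic_utilityE a Z : a != 0%R ->
  entropic_utility m a (fun t => (Z t)%:E) =
  (a^-1)%:E * lne (\int[m]_t (expR (a * Z t))%:E).
Proof. by move=> a0; rewrite /entropic_utility (negbTE a0). Qed.

Let ge0_int Z : 0 <= \int[m]_t (expR (Z t))%:E.
Proof. by apply: integral_ge0 => t _; rewrite lee_fin expR_ge0. Qed.

Let lne_le Z r : (lne (\int[m]_t (expR (Z t))%:E) <= r%:E) =
  (\int[m]_t (expR (Z t))%:E <= (expR r)%:E).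
Proof.
rewrite -[in LHS](expeRK r%:E) lee_lne//.
  by rewrite in_itv/= leey andbT.
by rewrite in_itv/= leey andbT lee_fin expR_ge0.
Qed.

Let le_lne Z r : (r%:E <= lne (\int[m]_t (expR (Z t))%:E)) =
  ((expR r)%:E <= \int[m]_t (expR (Z t))%:E).
Proof.
rewrite -[in LHS](expeRK r%:E) lee_lne//.
  by rewrite in_itv/= leey andbT lee_fin expR_ge0.
by rewrite in_itv/= leey andbT.
Qed.

Lemma entropic_utility_le_pos a Z r : (0 < a)%R ->
  entropic_utility m a (fun t => (Z t)%:E) <= r%:E ->
  \int[m]_t (expR (a * Z t))%:E <= (expR (a * r))%:E.
Proof.
move=> a0; rewrite entropic_utilityE ?gt_eqF// => h.
by rewrite -lne_le EFinM -lee_pdivrMl.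
Qed.

(** A negative risk parameter reverses inequalities: upper bounds on the utility are
  lower bounds on the exponential moment. *)
Lemma entropic_utility_le_neg a Z r : (a < 0)%R ->
  (entropic_utility m a (fun t => (Z t)%:E) <= r%:E) =
  ((expR (a * r))%:E <= \int[m]_t (expR (a * Z t))%:E).
Proof.
move=> a0; rewrite entropic_utilityE ?lt_eqF// -le_lne.
by rewrite lee_ndivrMl// EFinM.
Qed.

Lemma entropic_utility_ge_neg a Z r : (a < 0)%R ->
  (r%:E <= entropic_utility m a (fun t => (Z t)%:E)) =
  (\int[m]_t (expR (a * Z t))%:E <= (expR (a * r))%:E).
Proof.
move=> a0; rewrite entropic_utilityE ?lt_eqF// -lne_le.
by rewrite lee_ndivlMl// EFinM.
Qed.

End entropic_utility_bounds.

Section growth.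
Context (R : realType) (d : nat) (delta : R) (delta0 : (0 < delta)%R).
Context (dO : measure_display) (Omega : measurableType dO).
Context (X : feller_markov R d Omega).
Context (omega : 'rV[R]_d -> R) (comega : continuous omega)
  (omega0 : forall x, (0 <= omega x)%R).

Lemma weighted_norm_bound (g : 'rV[R]_d -> R) : weighted_norm omega g < +oo ->
  exists2 K : R, (0 <= K)%R & forall x, (`|g x| <= K * (1 + omega x))%R.
Proof.
rewrite /weighted_norm => /[dup] fin.
set N := ereal_sup _ => _.
have p x : (0 < 1 + omega x)%R by rewrite ltr_wpDr.
have ub x : (`|g x| / (1 + omega x))%:E <= N.
  by apply: ereal_sup_ubound; exists x.
have N0 : 0 <= N by apply: le_trans (ub 0%R); rewrite lee_fin divr_ge0// ltW.
move: fin ub N0; rewrite -/N; case: N => [r|//|//] _ ub N0.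
exists r => // x; have := ub x.
by rewrite lee_fin ler_pdivrMr.
Qed.

(** Monotonicity and affinity of the path integral, along actual paths. *)
Lemma path_integral_le (f g : 'rV[R]_d -> R) s o : continuous f -> continuous g ->
  (0 <= s)%R -> (forall x, (f x <= g x)%R) ->
  (path_integral f (fm_path delta X s o) <= path_integral g (fm_path delta X s o))%R.
Proof.
move=> cf cg s0 fg.
have [fi fe] := path_integralE delta0 X 0%R o cf s0.
have [gi ge] := path_integralE delta0 X 0%R o cg s0.
by rewrite -lee_fin -fe -ge; apply: le_integral => // u _; rewrite lee_fin.
Qed.

Lemma path_integral_affine (g : 'rV[R]_d -> R) (K : R) s o : continuous g ->
  (0 <= s)%R ->
  path_integral (fun x => K * (1 + g x))%R (fm_path delta X s o) =
  (K * (delta + path_integral g (fm_path delta X s o)))%R.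
Proof.
move=> cg s0.
have cK : continuous (fun x : 'rV[R]_d => K * (1 + g x))%R.
  move=> x; apply: (@continuousM R _ (cst K) (fun y => 1 + g y)%R).
    exact: cst_continuous.
  by apply: (@continuousD R R^o 'rV[R]_d (cst 1%R) g); [exact: cst_continuous|exact: cg].
have [Ki Ke] := path_integralE delta0 X 0%R o cK s0.
have [gi ge] := path_integralE delta0 X 0%R o cg s0.
have c1 : continuous (cst 1%R : 'rV[R]_d -> R) by move=> x; exact: cst_continuous.
have [i1 e1] := path_integralE delta0 X 0%R o c1 s0.
have mI : measurable (`[0%R, (0 + delta)%R]%classic : set (measurableTypeR R)).
  exact: measurable_itv.
apply: EFin_inj; rewrite -Ke.
under eq_integral do rewrite EFinM EFinD.
rewrite (integralZl mI (integrableD mI i1 gi)).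
rewrite (integralD mI i1 gi) ge EFinM EFinD; congr (_ * (_ + _)).
under eq_integral do rewrite /=.
have e2 : lebesgue_measure (`[0%R, (0 + delta)%R]%classic : set R) = delta%:E.
  by rewrite lebesgue_measure_itv/= add0r lte_fin delta0 -EFinB subr0.
by rewrite (integral_cst _ mI) mul1e; exact: e2.
Qed.

Lemma path_integral0E (g : 'rV[R]_d -> R) o : continuous g ->
  \int[lebesgue_measure]_(u in `[0%R, delta]) (g (X u o))%:E =
  (path_integral g (fm_path delta X 0%R o))%:E.
Proof.
move=> cg; have [_ <-] := path_integralE delta0 X 0%R o cg (lexx 0%R).
by rewrite add0r; apply: eq_integral => u _; rewrite subr0 add0r.
Qed.


Lemma growth_moments : assumption_growth X delta omega ->
  exists (b1 : R) (M1 M2 : R -> R), (0 < b1 < 1)%R /\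
    forall a y, (0 < a)%R ->
      \int[fm_law X y]_o
        (expR (a * path_integral omega (fm_path delta X 0%R o)))%:E <=
        (expR (a * (omega y + M1 a)))%:E /\
      \int[fm_law X y]_o (expR (a * omega (X delta o)))%:E <=
        (expR (a * (b1 * omega y + M2 a)))%:E.
Proof.
move=> [b1 [M1 [M2 [b01 H]]]]; exists b1, M1, M2; split=> // a y a0.
have [h1 h2] := H a y; split; last exact: entropic_utility_le_pos.
apply: entropic_utility_le_pos => //; move: h1.
by under [in X in X -> _]eq_fun do rewrite path_integral0E//.
Qed.

Lemma step_meanE (f : 'rV[R]_d -> R) (alpha : R) (h : state R d -> R) y :
  step_mean delta X f alpha h y = \int[fm_law X y]_o
    (expR (alpha * path_integral f (fm_path delta X 0%R o) + h (X delta o)))%:E.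
Proof.
rewrite /step_mean /path_mean /step_functional.
by apply: eq_integral => o _; rewrite /path_end /fm_path add0r.
Qed.

Lemma measurable_path_integral_fm (g : 'rV[R]_d -> R) : continuous g ->
  measurable_fun setT (fun o => path_integral g (fm_path delta X 0%R o)).
Proof.
move=> cg; apply: (measurableT_comp (measurable_path_integral cg)).
exact: measurable_path.
Qed.

Lemma measurable_fm_end (h : state R d -> R) : measurable_fun setT h ->
  measurable_fun setT (fun o => h (X delta o)).
Proof. by move=> mh; apply: (measurableT_comp mh); apply: measurable_fm; exact: ltW. Qed.

(** The reward and the terminal value are dominated by multiples of the weight, whose
  own exponential moments over a period are controlled at every risk parameter. *)
Lemma step_mean_bound (f w : 'rV[R]_d -> R) (K a : R) :
  continuous f -> continuous w -> assumption_growth X delta omega ->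
  (0 <= K)%R -> (forall x, `|f x| <= K * (1 + omega x))%R ->
  (forall x, `|w x| <= K * (1 + omega x))%R ->
  exists2 C : R, (0 <= C)%R & forall y,
    step_mean delta X f a (fun z => a * w z)%R y <= (expR (C * (1 + omega y)))%:E.
Proof.
move=> cf cw /growth_moments[b1 [M1 [M2 [/andP[b0 b11] HM]]]] K0 fK wK.
(* the factor 2 pays for the separation of the integral from the terminal value *)
pose k := (2 * `|a| * K + 1)%R.
have ak0 : (0 <= 2 * `|a| * K)%R by rewrite !mulr_ge0.
have k0 : (0 < k)%R by rewrite ltr_pwDr.
have akb (u v : R) : (`|u| <= K * v)%R -> (0 <= v)%R -> (2 * (a * u) <= k * v)%R.
  move=> uv v0; apply: le_trans (ler_norm _) _; rewrite !normrM ger0_norm//.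
  apply: (@le_trans _ _ (2 * (`|a| * (K * v))))%R.
    by rewrite !ler_wpM2l.
  by rewrite /k; lra.
pose C0 := (k * delta + k + k * `|M1 k| + k * `|M2 k|)%R.
have C00 : (0 <= C0)%R by rewrite !addr_ge0// mulr_ge0// ltW.
exists (C0 + 1)%R; first by rewrite addr_ge0.
move=> y; rewrite step_meanE.
have o0 := omega0 y.
have [h1 h2] := HM k y k0.
apply: (@le_trans _ _ (expR (C0 * (1 + omega y)) + expR (C0 * (1 + omega y)))%:E).
  apply: integral_expR_add_le.
  - by apply: measurable_funM => //; exact: measurable_path_integral_fm.
  - apply: measurable_funM => //; apply: measurable_fm_end.
    exact: continuous_measurable_state.
  - apply: (@le_trans _ _ (\int[fm_law X y]_o
        (expR (k * path_integral omega (fm_path delta X 0%R o) + k * delta))%:E)).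
      apply: ge0_le_integral => //.
      + apply: measurable_expR_fun; do 2 apply: measurable_funM => //.
        exact: measurable_path_integral_fm.
      + apply: measurable_expR_fun; apply: measurable_funD => //.
        by apply: measurable_funM => //; exact: measurable_path_integral_fm.
      move=> o _; rewrite lee_fin ler_expR -mulrDr [(_ + delta)%R]addrC.
      have cK (L : R) : continuous (fun x : 'rV[R]_d => L * (1 + omega x))%R.
        move=> x; apply: (@continuousM R _ (cst L) (fun y => 1 + omega y)%R).
          exact: cst_continuous.
        by apply: (@continuousD R R^o 'rV[R]_d (cst 1%R) omega);
          [exact: cst_continuous|exact: comega].
      have aff L := @path_integral_affine omega L 0%R o comega (lexx 0%R).
      have le1 := @path_integral_le f _ 0%R o cf (cK K) (lexx _)
        (fun x => le_trans (ler_norm _) (fK x)).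
      have le2 := @path_integral_le _ f 0%R o (cK (- K)%R) cf (lexx _) _.
      have c0 : continuous (cst 0%R : 'rV[R]_d -> R) by move=> x; exact: cst_continuous.
      have le3 := @path_integral_le _ omega 0%R o (cK 0%R) comega (lexx _) _.
      rewrite aff in le1; rewrite aff in le2; rewrite aff mul0r in le3.
      have {}le3 := le3 (fun x => _).
      apply: akb; last first.
        by rewrite addr_ge0 ?(ltW delta0)// le3// => x; rewrite mul0r.
      rewrite ler_norml -mulNr le1 le2// => x.
      by have := fK x; rewrite ler_norml mulNr => /andP[].
    rewrite integral_expR_shift; last first.
      by apply: measurable_funM => //; exact: measurable_path_integral_fm.
    apply: (@le_trans _ _ ((expR (k * delta))%:E * (expR (k * (omega y + M1 k)))%:E)).
      by rewrite lee_wpmul2l// lee_fin expR_ge0.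
    rewrite -EFinM -expRD lee_fin ler_expR.
    have h : (k * M1 k <= k * `|M1 k|)%R by rewrite ler_wpM2l ?ler_norm// ltW.
    have hk : (0 <= k * delta)%R by rewrite mulr_ge0// ltW.
    have hm1 : (0 <= k * `|M1 k|)%R by rewrite mulr_ge0// ltW.
    have hm2 : (0 <= k * `|M2 k|)%R by rewrite mulr_ge0// ltW.
    have : (k * omega y <= C0 * omega y)%R by rewrite ler_wpM2r// /C0; lra.
    have : (k * delta + k * `|M1 k| <= C0)%R by rewrite /C0; lra.
    by lra.
  apply: (@le_trans _ _ (\int[fm_law X y]_o (expR (k * omega (X delta o) + k))%:E)).
    apply: ge0_le_integral => //.
    + apply: measurable_expR_fun; do 2 apply: measurable_funM => //.
      by apply: measurable_fm_end; exact: continuous_measurable_state.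
    + apply: measurable_expR_fun; apply: measurable_funD => //.
      apply: measurable_funM => //.
      by apply: measurable_fm_end; exact: continuous_measurable_state.
    move=> o _; rewrite lee_fin ler_expR.
    rewrite -[X in (_ + X)%R]mulr1 -mulrDr [(_ + 1)%R]addrC.
    by apply: akb; rewrite ?addr_ge0.
  rewrite integral_expR_shift; last first.
    by apply: measurable_funM => //; apply: measurable_fm_end;
       exact: continuous_measurable_state.
  apply: (@le_trans _ _ ((expR k)%:E * (expR (k * (b1 * omega y + M2 k)))%:E)).
    by rewrite lee_wpmul2l// lee_fin expR_ge0.
  rewrite -EFinM -expRD lee_fin ler_expR.
  have h : (k * M2 k <= k * `|M2 k|)%R by rewrite ler_wpM2l ?ler_norm// ltW.
  have hk : (0 <= k * delta)%R by rewrite mulr_ge0// ltW.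
  have hm1 : (0 <= k * `|M1 k|)%R by rewrite mulr_ge0// ltW.
  have hm2 : (0 <= k * `|M2 k|)%R by rewrite mulr_ge0// ltW.
  have : (k * omega y <= C0 * omega y)%R by rewrite ler_wpM2r// /C0; lra.
  have : (k * (b1 * omega y) <= k * omega y)%R.
    by rewrite ler_wpM2l ?(ltW k0)// ler_piMl// ltW.
  have : (k + k * `|M2 k| <= C0)%R by rewrite /C0; lra.
  by lra.
rewrite lee_fin (_ : (C0 + 1) * _ = C0 * (1 + omega y) + (1 + omega y))%R; last by ring.
rewrite expRD.
have := expR_ge1Dx (1 + omega y); have := expR_ge0 (C0 * (1 + omega y)).
set A := expR (C0 * _); set B := expR (1 + _) => A0 B1.
rewrite -mulr2n -[X in (X <= _)%R]mulr_natr ler_wpM2l//; lra.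
Qed.

End growth.

(** * The Bellman equation in multiplicative form *)

Section bellman_equation.
Context (R : realType) (d : nat) (delta : R) (delta0 : (0 < delta)%R).
Context (dO : measure_display) (Omega : measurableType dO).
Context (X : feller_markov R d Omega) (U : set 'rV[R]_d).
Context (omega : 'rV[R]_d -> R) (comega : continuous omega)
  (omega0 : forall x, (0 <= omega x)%R).
Context (growth : assumption_growth X delta omega).
Context (f : 'rV[R]_d -> R) (cf : continuous f).
Context (w : 'rV[R]_d -> R) (cw : continuous w).
Context (K : R) (K0 : (0 <= K)%R) (fK : forall x, (`|f x| <= K * (1 + omega x))%R)
  (wK : forall x, (`|w x| <= K * (1 + omega x))%R).
Context (c : 'rV[R]_d * 'rV[R]_d -> R) (gamma : R) (gamma0 : (gamma < 0)%R).
Context (lambda : R) (bell : bellman X U delta f c gamma w lambda).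

Local Notation mean a := (step_mean delta X f a (fun z => a * w z)%R).

Let reward o := (path_integral f (fm_path delta X 0%R o) + w (X delta o))%R.

Lemma step_utilityE y : step_utility X delta f gamma w y =
  entropic_utility (fm_law X y) gamma (fun o => (reward o)%:E).
Proof.
rewrite /step_utility; congr (entropic_utility _ _ _); apply/funext => o.
by rewrite (path_integral0E delta0 X o cf).
Qed.

Lemma meanE a y : mean a y = \int[fm_law X y]_o (expR (a * reward o))%:E.
Proof.
rewrite step_meanE//; apply: eq_integral => o _; congr (expR _)%:E.
exact/esym/mulrDr.
Qed.

Lemma measurable_reward : measurable_fun setT reward.
Proof.
apply: measurable_funD; first exact: measurable_path_integral_fm.
by apply: measurable_fm_end => //; exact: continuous_measurable_state.
Qed.

(** The step utility is bounded above by the Bellman equation and below by the moment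
  bounds, hence it is a real number [r]. The maximum in the equation then splits into
  two inequalities and, where waiting is not optimal, nearly optimal targets. *)
Lemma bellman_certainty_equivalent : exists r : state R d -> R,
  [/\ measurable_fun setT r,
      forall y, mean gamma y = (expR (gamma * r y))%:E,
      forall y, (r y <= w y + lambda)%R,
      forall y xi, U xi -> (r xi + c (y, xi) <= w y + lambda)%R
    & forall y, (r y < w y + lambda)%R -> forall e : R, (0 < e)%R ->
        exists xi, U xi /\ (w y + lambda - e < r xi + c (y, xi))%R].
Proof.
have [C _ HC] := step_mean_bound delta0 comega omega0 gamma cf cw growth K0 fK wK.
have step_le y : step_utility X delta f gamma w y <= (w y + lambda)%:E.
  by rewrite bell le_max lexx.
have mean_ge y : (expR (gamma * (w y + lambda)))%:E <= mean gamma y.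
  by rewrite meanE -(entropic_utility_le_neg _ _ _ gamma0) -step_utilityE.
have fin y : mean gamma y = (fine (mean gamma y))%:E.
  rewrite fineK// ge0_fin_numE; first by apply: le_lt_trans (HC y) _; rewrite ltry.
  exact: step_mean_ge0.
have pos y : (0 < fine (mean gamma y))%R.
  by rewrite -lte_fin -fin; apply: lt_le_trans (mean_ge y); rewrite lte_fin expR_gt0.
pose r y := (gamma^-1 * ln (fine (mean gamma y)))%R.
have gn0 : gamma != 0%R by rewrite lt_eqF.
have rE y : mean gamma y = (expR (gamma * r y))%:E.
  by rewrite /r mulVKf// lnK ?posrE// -fin.
have stepE y : step_utility X delta f gamma w y = (r y)%:E.
  apply/eqP; rewrite eq_le step_utilityE.
  by rewrite entropic_utility_le_neg// entropic_utility_ge_neg// -meanE rE !lexx.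
exists r; split => //.
- apply: measurable_funM => //.
  have mm : measurable_fun setT (mean gamma).
    apply: measurable_step_mean => //; apply: measurable_funM => //.
    exact: continuous_measurable_state.
  by apply: measurableT_comp => //; apply: (measurableT_comp (fine_measurable _)) mm.
- by move=> y; rewrite -lee_fin -stepE.
- move=> y xi Uxi; rewrite -lee_fin bell le_max; apply/orP; right.
  by apply: ereal_sup_ubound; exists xi => //; rewrite stepE EFinD.
move=> y ry e e0.
set S := [set step_utility X delta f gamma w xi + (c (y, xi))%:E | xi in U].
have supE : ereal_sup S = (w y + lambda)%:E.
  have := bell y; rewrite -/S stepE /maxe; case: ifP => _ h; first by rewrite h.
  by move: ry; have [->] := h; rewrite ltxx.
have fS : ereal_sup S \is a fin_num by rewrite supE.
have [_ [xi Uxi <-]] := ub_ereal_sup_adherent e0 fS.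
rewrite supE stepE -!EFinD lte_fin => h.
by exists xi.
Qed.

(** Logarithmic moments are convex in the risk parameter, so their values at [gamma]
  and at [2 * gamma] bound the values on the segment between from above, and the
  values beyond [gamma] towards 0 from below. The loss is proportional to the change
  of the parameter and to the weight. *)
Lemma step_mean_rescale (r : state R d -> R) :
  (forall y, mean gamma y = (expR (gamma * r y))%:E) ->
  (forall y, (r y <= w y + lambda)%R) ->
  exists2 C : R, (0 <= C)%R &
    (forall theta y, (0 < theta <= 1)%R ->
       (expR (theta * (gamma * r y) - (1 - theta) * (C * (1 + omega y))))%:E <=
         mean (theta * gamma) y) /\
    (forall p y, (1 <= p <= 2)%R ->
       mean (p * gamma) y <=
         (expR (p * (gamma * r y) + (p - 1) * (C * (1 + omega y))))%:E).
Proof.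
move=> rE rw.
have [C0 C00 HC] := step_mean_bound delta0 comega omega0 (2 * gamma)%R cf cw growth K0 fK wK.
pose C := (C0 + 2 * - gamma * (K + `|lambda|))%R.
have g0 : (0 <= - gamma)%R by rewrite oppr_ge0 ltW.
exists C; first by rewrite addr_ge0// !mulr_ge0// addr_ge0.
have CE y : (C0 * (1 + omega y) - 2 * gamma * r y <= C * (1 + omega y))%R.
  have o0 := omega0 y.
  have h1 : (r y <= (K + `|lambda|) * (1 + omega y))%R.
    apply: (le_trans (rw y)); have := wK y; have := ler_norm (w y).
    have := ler_norm lambda.
    have : (0 <= `|lambda| * omega y)%R by rewrite mulr_ge0.
    by lra.
  have : (- gamma * r y <= - gamma * ((K + `|lambda|) * (1 + omega y)))%R.
    by rewrite ler_wpM2l.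
  by rewrite /C; lra.
have mZ a : measurable_fun setT (fun o => a * reward o)%R.
  by apply: measurable_funM => //; exact: measurable_reward.
split=> [theta y /andP[t0 t1]|p y /andP[p1 p2]].
  (* [gamma] is the mean of [theta * gamma] and [2 * gamma] with weights [s] and
    [1 - s] *)
  pose s := (2 - theta)^-1%R.
  have ne : (0 < 2 - theta)%R by lra.
  have s01 : (0 < s <= 1)%R by rewrite invr_gt0 ne invf_le1//; lra.
  have sE : (1 - s = (1 - theta) * s)%R by rewrite /s; field; rewrite gt_eqF.
  have sne : s != 0%R by rewrite gt_eqF//; case/andP: s01.
  have := @expR_hoelder_ge R _ _ (fm_law X y) s (fun o => theta * gamma * reward o)%R
    (fun o => 2 * gamma * reward o)%R (gamma * r y) (C0 * (1 + omega y)) s01 (mZ _) (mZ _).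
  have {}HC := HC y; rewrite meanE in HC.
  move=> H; rewrite meanE; apply: le_trans (H _ HC).
    rewrite lee_fin ler_expR sE.
    have -> : ((gamma * r y - (1 - theta) * s * (C0 * (1 + omega y))) / s =
       (2 - theta) * (gamma * r y) - (1 - theta) * (C0 * (1 + omega y)))%R.
      by rewrite /s; field; rewrite gt_eqF.
    have : ((1 - theta) * (C0 * (1 + omega y) - 2 * gamma * r y) <=
       (1 - theta) * (C * (1 + omega y)))%R.
      by rewrite ler_wpM2l// subr_ge0.
    by lra.
  rewrite -rE meanE le_eqVlt; apply/orP; left; apply/eqP.
  apply: eq_integral => o _.
  by congr (expR _)%:E; rewrite /s; field; rewrite gt_eqF.
(* [p * gamma] is the mean of [gamma] and [2 * gamma] with weights [2 - p] and
  [p - 1] *)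
have s01 : (0 <= 2 - p <= 1)%R by lra.
have := @expR_hoelder_le R _ _ (fm_law X y) (2 - p)%R (fun o => gamma * reward o)%R
  (fun o => 2 * gamma * reward o)%R (gamma * r y) (C0 * (1 + omega y)) s01 (mZ _) (mZ _).
have {}HC := HC y; rewrite meanE in HC.
have rE' : \int[fm_law X y]_o (expR (gamma * reward o))%:E <= (expR (gamma * r y))%:E.
  by rewrite -rE meanE.
move=> /(_ rE' HC) H.
rewrite [leLHS](_ : _ = \int[fm_law X y]_o
   (expR ((2 - p) * (gamma * reward o) + (1 - (2 - p)) * (2 * gamma * reward o)))%:E); last first.
  by rewrite meanE; apply: eq_integral => o _; congr (expR _)%:E; ring.
apply: (le_trans H); rewrite lee_fin ler_expR.
have : ((p - 1) * (C0 * (1 + omega y) - 2 * gamma * r y) <=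
   (p - 1) * (C * (1 + omega y)))%R.
  by rewrite ler_wpM2l// subr_ge0.
by lra.
Qed.

End bellman_equation.

(** * Exponential moments of the controlled process *)

Section lyapunov.
Context (R : realType) (d : nat) (delta : R) (delta0 : (0 < delta)%R).
Context (dO : measure_display) (Omega : measurableType dO).
Context (X : feller_markov R d Omega) (U : set 'rV[R]_d) (cU : compact U).
Context (omega : 'rV[R]_d -> R) (comega : continuous omega)
  (omega0 : forall x, (0 <= omega x)%R).
Context (growth : assumption_growth X delta omega).

Lemma omega_bounded : exists2 W : R, (0 <= W)%R & forall xi, U xi -> (omega xi <= W)%R.
Proof.
have [|M HM] := @compact_locally_bounded R _ U omega cU.
  move=> t _; have /cvgrPdist_lt/(_ 1%R ltr01)/nbhs_ballP[e /= e0 He] := comega (x := t).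
  exists e, (omega t + 1)%R; split => // v _ tv.
  have := He v; rewrite -ball_normE => /(_ tv) /=.
  by rewrite ltr_norml => /andP[a b]; lra.
exists (Num.max M 0%R); first by rewrite le_max lexx orbT.
by move=> xi Uxi; rewrite le_max HM.
Qed.

Definition weight_sum (V : strategy R d Omega) (C : R) n (o : nat -> Omega) : R :=
  \sum_(i < n) C * (1 + omega (post delta X V i o)).

Context (x : 'rV[R]_d).

Section fixed_strategy.
Context (V : strategy R d Omega) (admV : admissible X U V) (dyV : dyadic delta V).
Context (Q : probability (legs Omega) R) (CQ : controlled_law X V x Q).

Local Notation pre := (pre delta X V).
Local Notation post := (post delta X V).

(* the weights are accumulated by a gain without reward and without cost *)
Let c0 : 'rV[R]_d * 'rV[R]_d -> R := cst 0%R.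
Let cc0 : {within setT `*` U, continuous c0}.
Proof. by move=> y; exact: cst_continuous. Qed.

Let gain0E rho n o : gain delta X omega c0 0 0 rho V n o = (\sum_(i < n) rho (post i o))%R.
Proof. by apply: eq_bigr => i _; rewrite !mul0r !add0r. Qed.

Let step_mean0E a y : step_mean delta X omega 0 (fun z => a * omega z)%R y =
  \int[fm_law X y]_o (expR (a * omega (X delta o)))%:E.
Proof.
by rewrite step_meanE//; apply: eq_integral => o _; rewrite mul0r add0r.
Qed.

Let momega : measurable_fun setT (omega : state R d -> R).
Proof. exact: continuous_measurable_state. Qed.

Let maomega a : measurable_fun setT (fun z : state R d => a * omega z)%R.
Proof. exact: measurable_funM. Qed.

Lemma measurable_weight_sum C n :
  measurable_fun setT (weight_sum V C n : legs Omega -> R).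
Proof.
have mrho : measurable_fun setT (fun z : state R d => C * (1 + omega z))%R.
  by apply: measurable_funM => //; exact: measurable_funD.
rewrite (_ : weight_sum V C n =
  gain delta X omega c0 0 0 (fun z => C * (1 + omega z))%R V n).
  apply: (measurable_info_space_legs delta0 admV dyV (n := n)).
  exact: (measurable_gain delta0 comega cc0 0 0 mrho admV dyV).
by apply/funext => o; rewrite gain0E.
Qed.

Lemma measurable_omega_pre a n :
  measurable_fun setT ((fun o => a * (1 + omega (pre n o)))%R : legs Omega -> R).
Proof.
apply: measurable_funM => //; apply: measurable_funD => //.
apply: (measurableT_comp momega).
apply: (measurable_info_space_legs delta0 admV dyV (n := n)).
exact: (measurable_pre delta0 admV dyV (n := n)).
Qed.

Lemma omega_post_le (W : R) n o : (forall xi, U xi -> (omega xi <= W)%R) -> (0 <= W)%R ->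
  (omega (post n o) <= omega (pre n o) + W)%R.
Proof.
move=> HW W0; rewrite postE; case: ifP => _; last by rewrite lerDl.
by rewrite ler_wpDl//; apply: HW; exact: (xi_target admV).
Qed.


Let E u := \int[Q]_o (expR (u o))%:E.

(** The weight is a Lyapunov function. A period multiplies it by [b1] at most, up to
  constants, and [L * (1 - b1) = C], so the potential [L * omega] loses enough in
  each period to pay for the weight collected there. *)
Lemma weight_sum_moment (b1 W C m : R) n : (0 < b1 < 1)%R -> (0 < C)%R ->
  (forall xi, U xi -> (omega xi <= W)%R) -> (0 <= W)%R ->
  let L := (C / (1 - b1))%R in
  (forall y, \int[fm_law X y]_o (expR (L * omega (X delta o)))%:E <=
     (expR (L * (b1 * omega y + m)))%:E) ->
  E (weight_sum V C n) <=
    (expR (n%:R * (C + L * `|m| + L * W) + L * omega x))%:E.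
Proof.
move=> /andP[b0 b11] C0 HW W0 L HL.
have b1' : (0 < 1 - b1)%R by rewrite subr_gt0.
have L0 : (0 < L)%R by rewrite divr_gt0.
have LE : (L * (1 - b1) = C)%R by rewrite /L divfK// gt_eqF.
have mrho : measurable_fun setT (fun z : state R d => C * (1 + omega z))%R.
  by apply: measurable_funM => //; exact: measurable_funD.
have := gain_le delta0 comega cc0 (alpha := 0%R) (kappa := 0%R) mrho (maomega L)
  admV dyV CQ (D := (C + L * `|m| + L * W)%R) n.
move=> H; apply: (le_trans _ (H _)).
  apply: ge0_le_integral => //.
  - by apply: measurable_expR_fun; exact: measurable_weight_sum.
  - apply: (measurable_info_space_legs delta0 admV dyV (n := n)).
    apply: measurable_expR_fun.
    exact: (measurable_gain_exponent delta0 comega cc0 0 0 mrho (maomega L) admV dyV).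
  move=> o _; rewrite lee_fin ler_expR gain0E lerDl.
  by rewrite mulr_ge0 ?omega0// ltW.
move=> k o; rewrite mul0r add0r step_mean0E.
apply: (@le_trans _ _ ((expR (C * (1 + omega (post k o))))%:E *
    (expR (L * (b1 * omega (post k o) + m)))%:E)).
  by rewrite lee_wpmul2l// lee_fin expR_ge0.
rewrite -EFinM -expRD lee_fin ler_expR.
have h1 := omega_post_le k o HW W0.
have h2 : (L * omega (post k o) <= L * (omega (pre k o) + W))%R.
  by rewrite ler_wpM2l// ltW.
have h3 : (L * m <= L * `|m|)%R by rewrite ler_wpM2l ?ler_norm// ltW.
have h4 : (L * (1 - b1) * omega (post k o) = C * omega (post k o))%R by rewrite LE.
by lra.
Qed.

(** Convexity of the exponential, applied to the mean of [omega] and a constant with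
  weights [b1] and [1 - b1], turns the drift of [omega] into an affine recursion with
  contraction factor [b1] for the exponential moments, which stay bounded. *)
Lemma omega_pre_moment (b1 W a m : R) n : (0 < b1 < 1)%R -> (0 < a)%R ->
  (forall xi, U xi -> (omega xi <= W)%R) ->
  (forall y, \int[fm_law X y]_o (expR (a * omega (X delta o)))%:E <=
     (expR (a * (b1 * omega y + m)))%:E) ->
  E (fun o => a * omega (pre n o))%R <=
    (expR (a * omega x) +
     (b1 * expR (a * W) + (1 - b1) * expR (a * m / (1 - b1))) / (1 - b1))%:E.
Proof.
move=> /andP[b0 b11] a0 HW HL.
have b1' : (0 < 1 - b1)%R by rewrite subr_gt0.
set H := (b1 * _ + _)%R.
have H0 : (0 <= H)%R by rewrite addr_ge0// mulr_ge0 ?expR_ge0// ltW.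
have mE k : measurable_fun setT
    ((fun o => (expR (a * omega (pre k o)))%:E) : legs Omega -> \bar R).
  apply: (measurable_info_space_legs delta0 admV dyV (n := k)).
  apply: (@measurable_expR_fun _ _ (info_space delta X V k)).
  exact: (measurableT_comp (maomega a) (measurable_pre delta0 admV dyV (n := k))).
elim: n => [|n IH].
  have := gain0 delta omega c0 0 0 (fun=> 0%R) (maomega a) admV CQ.
  rewrite /E => h.
  rewrite [leLHS](_ : _ = (expR (a * omega x))%:E); last first.
    by rewrite -h; apply: eq_integral => o _; rewrite /gain big_ord0 add0r.
  by rewrite lee_fin lerDl divr_ge0// ltW.
have := gain_step delta0 comega cc0 0 0 (@measurable_cst _ _ (state R d) R setT 0%R) (maomega a) admV dyV CQ n.
move=> h.
rewrite [leLHS](_ : _ = \int[Q]_o \int[fm_law X (post n o)]_u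
    (expR (a * omega (X delta u)))%:E); last first.
  transitivity (\int[Q]_o (expR (gain delta X omega c0 0 0 (cst 0%R) V n.+1 o +
      a * omega (pre n.+1 o)))%:E).
    by apply: eq_integral => o _; rewrite gain0E big1 ?add0r.
  rewrite h; apply: eq_integral => o _.
  by rewrite gain0E big1// mul0r !add0r expR0 !mul1e step_mean0E.
apply: (@le_trans _ _ (\int[Q]_o (b1%:E * (expR (a * omega (pre n o)))%:E + H%:E))).
  apply: ge0_le_integral => //.
  - by move=> o _; apply: integral_ge0 => u _; rewrite lee_fin expR_ge0.
  - apply: (measurable_info_space_legs delta0 admV dyV (n := n)).
    have := measurable_step_mean delta0 X comega 0%R (maomega a).
    move=> ms; rewrite (_ : (fun o => _) = fun o => step_mean delta X omega 0
      (fun z => a * omega z)%R (post n o)); last first.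
      by apply/funext => o; rewrite step_mean0E.
    exact: (measurableT_comp ms (measurable_post delta0 admV dyV (n := n))).
  - by apply: emeasurable_funD => //; apply: measurable_funeM.
  move=> o _; apply: (le_trans (HL _)).
  rewrite -EFinM -EFinD lee_fin.
  rewrite (_ : (a * _ = b1 * (a * omega (post n o)) + (1 - b1) * (a * m / (1 - b1))))%R; last first.
    by field; rewrite gt_eqF.
  apply: le_trans (expR_convex _ _ _) _; first by rewrite !ltW.
  rewrite /H addrA lerD2r -mulrDr ler_wpM2l ?(ltW b0)//.
  rewrite postE; case: ifP => _; last by rewrite lerDl expR_ge0.
  apply: (@le_trans _ _ (expR (a * W))); last by rewrite lerDr expR_ge0.
  by rewrite ler_expR ler_wpM2l ?(ltW a0)//; apply: HW; exact: (xi_target admV).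
rewrite ge0_integralD//;
  do ?[by move=> o _; rewrite mule_ge0// lee_fin ?expR_ge0// ltW];
  do ?[by move=> o _; rewrite lee_fin]; do ?[exact: measurable_funeM].
have -> : \int[Q]_(o in setT) H%:E = H%:E.
  have /= := @integral_cst _ (legs Omega) R Q setT measurableT H%:E.
  by move=> ->; rewrite [X in _ * X](_ : _ = 1) ?mule1//; exact: probability_setT.
rewrite ge0_integralZl//; do ?[by move=> o _; rewrite lee_fin expR_ge0];
  do ?[by rewrite lee_fin ltW].
apply: (@le_trans _ _ (b1%:E * (expR (a * omega x) + H / (1 - b1))%:E + H%:E)).
  by rewrite leeD2r// lee_wpmul2l// lee_fin ltW.
rewrite -EFinM -EFinD lee_fin mulrDr -addrA lerD//.
  by rewrite ler_piMl ?expR_ge0// ltW.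
by rewrite le_eqVlt; apply/orP; left; apply/eqP; field; rewrite gt_eqF.
Qed.

End fixed_strategy.

(** The rate [D1] is fixed before the coefficient [K] of the final state: in the
  applications [K] explodes as the change of the risk parameter goes to zero, and
  only the constant [D2] may depend on it. *)
Lemma weight_growth (C : R) : (0 <= C)%R ->
  exists2 D1 : R, (0 <= D1)%R & forall K : R, (0 <= K)%R ->
    exists D2 : R, forall (V : strategy R d Omega) (Q : probability (legs Omega) R),
      admissible X U V -> dyadic delta V -> controlled_law X V x Q ->
      forall n, \int[Q]_o (expR (weight_sum V C n o +
           K * (1 + omega (pre delta X V n o))))%:E <= (expR (n%:R * D1 + D2))%:E.
Proof.
move=> C0; have [W W0 HW] := omega_bounded.
have [b1 [M1 [M2 [b01 HM]]]] := growth_moments delta0 comega growth.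
have /andP[b0 b11] := b01.
have b1' : (0 < 1 - b1)%R by rewrite subr_gt0.
pose C' := (2 * C + 1)%R.
have C'0 : (0 < C')%R by rewrite ltr_wpDl// mulr_ge0.
pose L := (C' / (1 - b1))%R.
have L0 : (0 < L)%R by rewrite divr_gt0.
pose D1 := (C' + L * `|M2 L| + L * W)%R.
have D10 : (0 <= D1)%R.
  apply: addr_ge0; last by apply: mulr_ge0 => //; exact: ltW L0.
  by apply: addr_ge0; [exact: ltW C'0|apply: mulr_ge0 => //; exact: ltW L0].
exists D1 => //.
move=> K K0.
pose a := (2 * K + 1)%R.
have a0 : (0 < a)%R by rewrite ltr_wpDl// mulr_ge0.
pose B := (expR (2 * K) * (expR (a * omega x) +
  (b1 * expR (a * W) + (1 - b1) * expR (a * M2 a / (1 - b1))) / (1 - b1)))%R.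
have B0 : (0 <= B)%R.
  rewrite mulr_ge0 ?expR_ge0// addr_ge0 ?expR_ge0// divr_ge0 ?(ltW b1')//.
  by rewrite addr_ge0// mulr_ge0 ?expR_ge0// ltW.
exists (ln (expR (L * omega x) + B)) => V Q admV dyV CQ n.
have mws := measurable_weight_sum admV dyV C n.
have mop := measurable_omega_pre admV dyV K n.
have maop : measurable_fun setT ((fun o => a * omega (pre delta X V n o))%R : legs Omega -> R).
  rewrite (_ : (fun o => _) = fun o => a * (1 + omega (pre delta X V n o)) + - a)%R; last first.
    by apply/funext => o; ring.
  by apply: measurable_funD => //; exact: measurable_omega_pre.
have nD10 : (0 <= n%:R * D1)%R by rewrite mulr_ge0.
apply: (@le_trans _ _ (expR (n%:R * D1 + L * omega x) + B)%:E).
  apply: integral_expR_add_le => //.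
  - apply: (le_trans _ (weight_sum_moment admV dyV CQ n b01 C'0 HW W0 _)); last first.
      by move=> y; have [_] := HM L y L0.
    apply: ge0_le_integral => //.
    + by apply: measurable_expR_fun; exact: measurable_funM.
    + by apply: measurable_expR_fun; exact: (measurable_weight_sum admV dyV).
    move=> o _; rewrite lee_fin ler_expR /weight_sum mulr_sumr ler_sum// => i _.
    rewrite mulrA ler_wpM2r//; first by rewrite addr_ge0.
    by rewrite /C' lerDl.
  - apply: (@le_trans _ _ (\int[Q]_o (expR (a * omega (pre delta X V n o) + 2 * K))%:E)).
      apply: ge0_le_integral => //.
      + by apply: measurable_expR_fun; exact: measurable_funM.
      + by apply: measurable_expR_fun; exact: measurable_funD.
      move=> o _; rewrite lee_fin ler_expR /a.
      by have := omega0 (pre delta X V n o); lra.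
    rewrite integral_expR_shift// /B EFinM lee_wpmul2l ?lee_fin ?expR_ge0//.
    apply: (omega_pre_moment admV dyV CQ) => //.
    by move=> y; have [_] := HM a y a0.
rewrite lee_fin [leRHS]expRD lnK; last by rewrite posrE ltr_pwDl ?expR_gt0.
rewrite expRD [leRHS]mulrDr lerD2l ler_peMl//.
by rewrite -[X in (X <= _)%R]expR0 ler_expR.
Qed.

End lyapunov.

(** * The Bellman constant is an upper bound *)

Section cumulative_reward.
Context (R : realType) (d : nat) (delta : R) (delta0 : (0 < delta)%R).
Context (dO : measure_display) (Omega : measurableType dO).
Context (X : feller_markov R d Omega) (U : set 'rV[R]_d).
Context (omega f : 'rV[R]_d -> R) (cf : continuous f).
Context (c : 'rV[R]_d * 'rV[R]_d -> R).
Context (V : strategy R d Omega) (admV : admissible X U V) (dyV : dyadic delta V).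

Lemma gain_affine a b C l n o :
  gain delta X f c a a (fun y => b * (C * (1 + omega y)) - a * l)%R V n o =
  (a * gain delta X f c 1 1 (fun=> - l)%R V n o +
   b * weight_sum delta X omega V C n o)%R.
Proof.
rewrite /gain /weight_sum !mulr_sumr -big_split/=.
by apply: eq_bigr => i _; ring.
Qed.

Lemma total_reward_gain l n o :
  total_reward X f c V (n%:R * delta)%R o =
  (gain delta X f c 1 1 (fun=> - l)%R V n o + n%:R * l + cost delta X V c n o)%:E.
Proof.
rewrite (total_rewardE delta0 admV dyV)//; congr (_ + _)%:E.
rewrite /gain [in RHS](eq_bigr (fun i : 'I_n => - l + (path_integral f (segment delta X V i o) +
   cost delta X V c i o)))%R; last by move=> i _; ring.
rewrite [in RHS]big_split/= sumr_const card_ord -mulr_natl; ring.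
Qed.

Lemma measurable_at_horizon (w : 'rV[R]_d -> R) C l n : continuous omega ->
  continuous w -> {within setT `*` U, continuous c} ->
  [/\ measurable_fun setT (gain delta X f c 1 1 (fun=> - l)%R V n : legs Omega -> R),
    measurable_fun setT (weight_sum delta X omega V C n : legs Omega -> R),
    measurable_fun setT ((fun o => w (pre delta X V n o)) : legs Omega -> R)
  & measurable_fun setT (cost delta X V c n : legs Omega -> R)].
Proof.
move=> comega cw cc; have legs_of := measurable_info_space_legs delta0 admV dyV (n := n).
split.
- apply: legs_of.
  exact: (measurable_gain delta0 cf cc 1 1 (@measurable_cst _ _ (state R d) R setT _) admV dyV).
- exact: (measurable_weight_sum delta0 comega admV dyV).
- apply: legs_of.
  exact: (measurableT_comp (continuous_measurable_state cw)
    (measurable_pre delta0 admV dyV (n := n))).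
- by apply: legs_of; exact: (measurable_cost_step delta0 cc admV dyV).
Qed.

End cumulative_reward.

Section upper_bound.
Context (R : realType) (d : nat) (delta : R) (delta0 : (0 < delta)%R).
Context (dO : measure_display) (Omega : measurableType dO).
Context (X : feller_markov R d Omega) (U : set 'rV[R]_d) (cU : compact U).
Context (omega : 'rV[R]_d -> R) (comega : continuous omega)
  (omega0 : forall x, (0 <= omega x)%R).
Context (growth : assumption_growth X delta omega).
Context (f : 'rV[R]_d -> R) (cf : continuous f).
Context (w : 'rV[R]_d -> R) (cw : continuous w).
Context (K : R) (K0 : (0 <= K)%R) (fK : forall x, (`|f x| <= K * (1 + omega x))%R)
  (wK : forall x, (`|w x| <= K * (1 + omega x))%R).
Context (c : 'rV[R]_d * 'rV[R]_d -> R) (cc : {within setT `*` U, continuous c})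
  (c_le0 : forall y xi, U xi -> (c (y, xi) <= 0)%R).
Context (gamma : R) (gamma0 : (gamma < 0)%R).
Context (lambda : R) (bell : bellman X U delta f c gamma w lambda).

(** At the risk parameter [theta * gamma], [theta < 1], the accumulated utility plus [w]
  is a submartingale under every strategy, once the weights [C * (1 + omega)] are
  added with the factor [1 - theta]. Hoelder's inequality then returns to the
  parameter [gamma], removing the weights and the unbounded terminal value [w]. *)
Lemma utility_le_bellman (x : 'rV[R]_d) (e : R) : (0 < e)%R -> exists D : R,
  forall (V : strategy R d Omega) (Q : probability (legs Omega) R),
    admissible X U V -> dyadic delta V -> controlled_law X V x Q ->
    forall n, entropic_utility Q gamma (total_reward X f c V (n%:R * delta)%R) <=
      (n%:R * (lambda + e) + D)%:E.
Proof.
move=> e0.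
have [r [mr rE rw rc _]] := bellman_certainty_equivalent delta0 comega omega0
  growth cf cw K0 fK wK gamma0 bell.
have [C C0 [HC _]] := step_mean_rescale delta0 comega omega0 growth cf cw K0 fK wK
  gamma0 rE rw.
have [D1 D10 HD] := weight_growth delta0 cU comega omega0 growth x C0.
pose g := (- gamma)%R; have g0 : (0 < g)%R by rewrite oppr_gt0.
(* Hoelder's inequality multiplies the growth rate [D1] of the weights by
  [(1 - theta) / theta], which is [s] for the choice of [theta] below; [s] is such
  that the product does not exceed [e * g]. *)
pose s := (e * g / (D1 + 1))%R.
have D11 : (0 < D1 + 1)%R by rewrite ltr_wpDl.
have s0 : (0 < s)%R by rewrite divr_gt0// mulr_gt0.
have sD1 : (s * D1 <= e * g)%R.
  have <- : (s * (D1 + 1) = e * g)%R by rewrite /s divfK// gt_eqF.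
  by rewrite ler_wpM2l ?(ltW s0)// lerDl.
have [|D2 HD2] := HD (g * K / s)%R; first by rewrite divr_ge0 ?(ltW s0)// mulr_ge0// ltW.
pose theta := ((1 + s)^-1)%R.
have s1 : (0 < 1 + s)%R by rewrite ltr_wpDr// ltW.
have t0 : (0 < theta)%R by rewrite invr_gt0.
have tE : (1 - theta = s * theta)%R by rewrite /theta; field; rewrite gt_eqF.
have t1 : (theta <= 1)%R by rewrite -subr_ge0 tE mulr_ge0// ltW.
have t01 : (0 < theta <= 1)%R by rewrite t0.
exists (w x - s * D2 / gamma)%R => V Q admV dyV CQ n.
have mw : measurable_fun setT (w : state R d -> R) by exact: continuous_measurable_state.
have mom : measurable_fun setT (omega : state R d -> R) by exact: continuous_measurable_state.
pose rho := (fun y : state R d => (1 - theta) * (C * (1 + omega y)) - theta * gamma * lambda)%R.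
have mrho : measurable_fun setT rho.
  apply: measurable_funB => //; apply: measurable_funM => //.
  by apply: measurable_funM => //; exact: measurable_funD.
have mh : measurable_fun setT (fun z : state R d => theta * gamma * w z)%R.
  exact: measurable_funM.
pose G := (fun o => gain delta X f c 1 1 (fun=> - lambda)%R V n o).
pose S := (fun o => weight_sum delta X omega V C n o).
have [mG mS mwp mc] := measurable_at_horizon delta0 cf admV dyV C lambda n comega cw cc.
have step m o : (w (pre delta X V m o) + lambda >= cost delta X V c m o +
    r (post delta X V m o))%R.
  rewrite costE postE; case: ifP => _; last by rewrite add0r.
  by rewrite addrC; apply: rc; exact: (xi_target admV).
have tg0 : (0 <= theta * g)%R by rewrite mulr_ge0// ltW.
have sub m o : (expR (theta * gamma * w (pre delta X V m o)))%:E <=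
    (expR (theta * gamma * cost delta X V c m o + rho (post delta X V m o)))%:E *
    step_mean delta X f (theta * gamma) (fun z => theta * gamma * w z)%R
      (post delta X V m o).
  apply: (@le_trans _ _ ((expR (theta * gamma * cost delta X V c m o +
      rho (post delta X V m o)))%:E * (expR (theta * (gamma * r (post delta X V m o)) -
      (1 - theta) * (C * (1 + omega (post delta X V m o)))))%:E)); last first.
    by rewrite lee_wpmul2l ?lee_fin ?expR_ge0//; exact: HC.
  rewrite -EFinM -expRD lee_fin ler_expR /rho.
  have := ler_wpM2l tg0 (step m o); rewrite /g.
  by lra.
have sg : (1 - theta = s * theta)%R by [].
have mgw : measurable_fun setT ((fun o => S o + gamma / s * w (pre delta X V n o))%R
    : legs Omega -> R).
  by apply: measurable_funD => //; exact: measurable_funM.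
have mgG : measurable_fun setT ((fun o => gamma * G o)%R : legs Omega -> R).
  exact: measurable_funM.
have := @expR_hoelder_ge R _ _ Q theta _ _ (theta * gamma * w x)%R (n%:R * D1 + D2)%R
  t01 mgG mgw.
have low : (expR (theta * gamma * w x))%:E <= \int[Q]_o (expR (theta * (gamma * G o) +
    (1 - theta) * (S o + gamma / s * w (pre delta X V n o))))%:E.
  apply: le_trans (gain_ge delta0 cf cc mrho mh admV dyV CQ n sub) _.
  rewrite le_eqVlt; apply/orP; left; apply/eqP; apply: eq_integral => o _.
  rewrite /rho (gain_affine delta X omega f c V) -/(G o) -/(S o) tE; congr (expR _)%:E.
  by field; rewrite gt_eqF.
have upp : \int[Q]_o (expR (S o + gamma / s * w (pre delta X V n o)))%:E <=
    (expR (n%:R * D1 + D2))%:E.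
  apply: le_trans (HD2 V Q admV dyV CQ n).
  apply: ge0_le_integral => //.
  - exact: measurable_expR_fun.
  - apply: measurable_expR_fun; apply: measurable_funD => //.
    exact: (measurable_omega_pre delta0 comega admV dyV).
  move=> o _; rewrite lee_fin ler_expR lerD2l.
  have -> : (gamma / s * w (pre delta X V n o) = g / s * - w (pre delta X V n o))%R.
    by rewrite /g; ring.
  rewrite [leRHS](_ : _ = g / s * (K * (1 + omega (pre delta X V n o))))%R; last by ring.
  apply: ler_wpM2l; first exact/ltW/divr_gt0.
  by apply: le_trans (wK _); rewrite -normrN; exact: ler_norm.
move=> /(_ low upp) main.
rewrite (_ : total_reward X f c V _ = fun o =>
    (G o + n%:R * lambda + cost delta X V c n o)%:E); last first.
  by apply/funext => o; rewrite (total_reward_gain delta0 cf c admV dyV lambda).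
rewrite entropic_utility_le_neg//.
apply: (@le_trans _ _ (\int[Q]_o (expR (gamma * G o + gamma * (n%:R * lambda)))%:E)); last first.
  apply: ge0_le_integral => //.
  - by apply: measurable_expR_fun; exact: measurable_funD.
  - apply: measurable_expR_fun; apply: measurable_funM => //.
    by apply: measurable_funD => //; exact: measurable_funD.
  move=> o _; rewrite lee_fin ler_expR -mulrDr ler_nM2l// gerDl costE.
  by case: ifP => // _; apply: c_le0; exact: (xi_target admV).
rewrite integral_expR_shift//.
apply: (@le_trans _ _ ((expR (gamma * (n%:R * lambda)))%:E *
    (expR ((theta * gamma * w x - (1 - theta) * (n%:R * D1 + D2)) / theta))%:E)); last first.
  by rewrite lee_wpmul2l// lee_fin expR_ge0.
rewrite -EFinM -expRD lee_fin ler_expR tE.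
have -> : ((theta * gamma * w x - s * theta * (n%:R * D1 + D2)) / theta =
  gamma * w x - s * (n%:R * D1 + D2))%R by field; rewrite gt_eqF.
have -> : (gamma * (n%:R * (lambda + e) + (w x - s * D2 / gamma)) =
  gamma * (n%:R * lambda) - n%:R * (e * g) + gamma * w x - s * D2)%R.
  by rewrite /g; field; rewrite lt_eqF.
have : (n%:R * (s * D1) <= n%:R * (e * g))%R by rewrite ler_wpM2l.
by lra.
Qed.

End upper_bound.

(** * Stationary strategies *)

Section stationary_strategy.
Context (R : realType) (d : nat) (delta : R) (delta0 : (0 < delta)%R).
Context (dO : measure_display) (Omega : measurableType dO).
Context (X : feller_markov R d Omega) (U : set 'rV[R]_d).
Context (D : pred 'rV[R]_d) (mD : borel [set y | D y]).
Context (sel : 'rV[R]_d -> 'rV[R]_d) (Usel : forall y, U (sel y))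
  (msel : forall B, borel B -> borel (sel @^-1` B)).

(** The bound [b] is 0 for the initial leg and 1 for the others, since a leg is not
  interrupted at the very time at which an impulse has started it. *)
Definition first_hit (b : nat) (u : Omega) : option nat :=
  if pselect (exists i, (b <= i)%N && D (X (i%:R * delta)%R u)) is left ex
  then Some (ex_minn ex) else None.

Lemma first_hitP b u i : first_hit b u = Some i <->
  [/\ (b <= i)%N, D (X (i%:R * delta)%R u) &
    forall j, (b <= j < i)%N -> ~~ D (X (j%:R * delta)%R u)].
Proof.
rewrite /first_hit; case: pselect => [ex|nex]; last first.
  by split => // -[bi Di _]; exfalso; apply: nex; exists i; rewrite bi.
case: ex_minnP => m /andP[bm Dm] mini; split.
  move=> [<-]; split => // j /andP[bj jm]; apply/negP => Dj.
  by have := mini j; rewrite bj Dj leqNgt jm => /(_ isT).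
move=> [bi Di H]; congr Some; apply/eqP; rewrite eqn_leq mini ?bi//=.
rewrite leqNgt; apply/negP => mi.
by have := H m; rewrite bm mi => /(_ isT); rewrite Dm.
Qed.

Lemma first_hit_le b u i : (b <= i)%N -> D (X (i%:R * delta)%R u) ->
  exists2 j, (j <= i)%N & first_hit b u = Some j.
Proof.
move=> bi Di; rewrite /first_hit; case: pselect => [ex|[]]; last first.
  by exists i; rewrite bi.
by exists (ex_minn ex) => //; case: ex_minnP => m _; apply; rewrite bi.
Qed.

Definition hit_time b u : \bar R :=
  if first_hit b u is Some i then (i%:R * delta)%:E else +oo.

Lemma hit_time_ge0 b u : 0 <= hit_time b u.
Proof. by rewrite /hit_time; case: first_hit => [i|//]; rewrite lee_fin mulr_ge0// ltW. Qed.

Fixpoint stationary_tau (n : nat) (o : nat -> Omega) : \bar R :=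
  (if n is n'.+1 then stationary_tau n' o else 0) + hit_time (0 < n)%N (o n).

(** Off the event that the impulse takes place the target is a constant: leg [n] may
  then never start, and its path must not influence the strategy. *)
Definition stationary_xi (n : nat) (o : nat -> Omega) : 'rV[R]_d :=
  if stationary_tau n o < +oo
  then sel (X (fine (hit_time (0 < n)%N (o n))) (o n)) else sel 0%R.

Definition stationary_strategy : strategy R d Omega :=
  Strategy stationary_tau stationary_xi.

Local Notation V := stationary_strategy.

Lemma stationary_tauE n o : tau V n o = leg_start V n o + hit_time (0 < n)%N (o n).
Proof. by case: n. Qed.

Lemma stationary_leg_start_ge0 n o : 0 <= leg_start V n o.
Proof.
elim: n => [//|n IH]; rewrite /leg_start stationary_tauE.
by rewrite adde_ge0// hit_time_ge0.
Qed.

Lemma stationary_dyadic : dyadic delta V.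
Proof.
elim=> [|n IH] o; rewrite stationary_tauE /hit_time.
  by case: first_hit => [i|]; [right; exists i; rewrite add0e|left].
case: first_hit => [i|]; last first.
  left; rewrite addey// -ltNye; apply: lt_le_trans (stationary_leg_start_ge0 n.+1 o).
  exact: ltNyr.
rewrite /leg_start; have [->|[k ->]] := IH o; [by left|right].
by exists (k + i)%N; rewrite -EFinD natrD mulrDl.
Qed.

Lemma stationary_tau_le n (t : R) o : tau V n o <= t%:E <->
  exists i, leg_start V n o + (i%:R * delta)%:E <= t%:E /\
    first_hit (0 < n)%N (o n) = Some i.
Proof.
rewrite stationary_tauE /hit_time; split; last by move=> [i [h ->]].
case: first_hit => [i h|]; first by exists i.
rewrite addey ?leye_eq// -ltNye.
by apply: lt_le_trans (stationary_leg_start_ge0 n o); exact: ltNyr.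
Qed.

Lemma fm_F_first_hit b i B : borel B ->
  fm_F X (i%:R * delta)%R [set u | first_hit b u = Some i /\ B (X (i%:R * delta)%R u)].
Proof.
have [SF _ _] := fm_filtration X.
have i0 k : (0 <= k%:R * delta)%R by rewrite mulr_ge0// ltW.
have SG := SF _ (i0 i).
have le k : (k <= i)%N -> (k%:R * delta <= i%:R * delta)%R.
  by move=> ki; rewrite ler_pM2r// ler_nat.
have FX k A : (k <= i)%N -> borel A -> fm_F X (i%:R * delta)%R (X (k%:R * delta)%R @^-1` A).
  by move=> ki mA; apply: (fm_F_le (i0 k) (le _ ki)); exact: fm_adapted.
move=> mB.
rewrite (_ : [set _ | _] = [set _ | (b <= i)%N] `&` X (i%:R * delta)%R @^-1` [set y | D y] `&`
   (~` \bigcup_(j in [set j | (b <= j < i)%N]) X (j%:R * delta)%R @^-1` [set y | D y]) `&`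
   X (i%:R * delta)%R @^-1` B).
  apply: (sigma_setI SG); last exact: FX.
  apply: (sigma_setI SG); last first.
    apply: (sigma_setC SG); apply: (sigma_bigcup_cond SG) => j /andP[_ ji].
    by apply: FX => //; exact: ltnW.
  apply: (sigma_setI SG); last exact: FX.
  exact: (sigma_cst SG).
apply/seteqP; split => u /=.
  move=> [/first_hitP[bi Di H] Bu]; split => //; split => //.
  by move=> [j /= /H /negP].
move=> [[[bi Di] H] Bu]; split => //; apply/first_hitP; split => // j bj.
by apply/negP => Dj; apply: H; exists j.
Qed.

(** The impulse has occurred by time [t] when leg [n] has started and has run long
  enough to show its first hit: for each index of this hit, this is one of the
  generators of the information at time [t]. *)
Lemma stationary_info n t B : borel B ->
  info X V n t ([set o | tau V n o <= t%:E] `&`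
     [set o | B (X (fine (hit_time (0 < n)%N (o n))) (o n))]).
Proof.
move=> mB.
rewrite (_ : _ `&` _ = \bigcup_i [set o | leg_start V n o + (i%:R * delta)%:E <= t%:E /\
   [set u | first_hit (0 < n)%N u = Some i /\ B (X (i%:R * delta)%R u)] (o n)]).
  apply: (sigma_bigcup (smallest_sigma_algebra _ _)) => i.
  apply: sub_sigma_algebra; exists n, (i%:R * delta)%R; eexists; split; last by [].
  - by [].
  - by rewrite mulr_ge0// ltW.
  - exact: fm_F_first_hit.
apply/seteqP; split => o /=.
  move=> [/stationary_tau_le[i [h1 h2]]]; rewrite /hit_time h2 => Bo.
  by exists i => //; split.
move=> [i _ [h1 [h2 Bo]]]; split; first by apply/stationary_tau_le; exists i.
by rewrite /hit_time h2.
Qed.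

Lemma stationary_admissible : admissible X U V.
Proof.
have borelT : borel [set: 'rV[R]_d] by exact: (sigma_setT (@borel_sigma_algebra R d)).
have info_tau_le n t : info X V n t [set o | tau V n o <= t%:E].
  by have := stationary_info (n := n) (t := t) borelT; rewrite (_ : [set o | setT _] = setT) ?setIT.
have info_xi n t B : borel B -> info X V n t ((xi V n @^-1` B) `&` [set o | tau V n o <= t%:E]).
  move=> mB; have := stationary_info (n := n) (t := t) (msel mB).
  congr (info X V n t _); apply/seteqP; split => o /= [h1 h2]; split => //.
    by rewrite /stationary_xi (le_lt_trans h1)// ltry.
  by move: h1; rewrite /stationary_xi (le_lt_trans h2)// ltry.
split.
- by move=> n o; rewrite stationary_tauE adde_ge0 ?hit_time_ge0// stationary_leg_start_ge0.
- move=> n o; rewrite (stationary_tauE n.+1) /leg_start.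
  have [->|[k ->]] := stationary_dyadic n o; first by rewrite ltxx.
  move=> _; rewrite /hit_time; case E : first_hit => [i|]; last by rewrite addey ?ltry.
  have [i0 _ _] := (first_hitP _ _ _).1 E.
  by rewrite -EFinD lte_fin ltrDl mulr_gt0// ltr0n.
- move=> n o too; rewrite stationary_tauE /leg_start too addye// -ltNye.
  by apply: lt_le_trans (hit_time_ge0 _ _); exact: ltNyr.
- by move=> n t _; exact: info_tau_le.
- by move=> n o; rewrite /= /stationary_xi; case: ifP.
- move=> n B mB; split; last by move=> t _; exact: info_xi.
  have S : sigma_algebra setT (info_oo X V n) by exact: smallest_sigma_algebra.
  have oo t A : (0 <= t)%R -> info X V n t A -> info_oo X V n A.
    by move=> t0 iA; apply: sub_sigma_algebra; exists t.
  pose T := \bigcup_(N : nat) [set o | tau V n o <= N%:R%:E].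
  have ooT : info_oo X V n T.
    by apply: (sigma_bigcup S) => N; exact: oo (info_tau_le _ _).
  have TE : T = [set o | tau V n o < +oo].
    apply/seteqP; split => o /=; first by move=> [N _ /le_lt_trans]; apply; exact: ltry.
    have /= [->|[k E]] := stationary_dyadic n o; first by rewrite ltxx.
    move=> _; exists (Num.bound (k%:R * delta)%R) => //=.
    by rewrite E lee_fin ltW// archi_boundP// mulr_ge0// ltW.
  rewrite (_ : _ @^-1` B = (\bigcup_(N : nat) ((xi V n @^-1` B) `&`
      [set o | tau V n o <= N%:R%:E])) `|` (~` T `&` [set _ | B (sel 0%R)])).
    apply: (sigma_setU S).
      by apply: (sigma_bigcup S) => N; exact: oo (info_xi _ _ _ mB).
    apply: (sigma_setI S); first exact: (sigma_setC S).
    exact: (sigma_cst S).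
  rewrite -setI_bigcupr -/T TE; apply/seteqP; split => o /=.
    rewrite /stationary_xi; case: ifP => h Bo; [by left|right].
    by split => //; apply/negP; rewrite h.
  case=> [[//]|[/negP/negbTE h Bo]].
  by rewrite /stationary_xi h.
Qed.

(** Away from impulses the current leg has been tested at all grid times since the one
  allowed by [b], and has not entered [D]. *)
Lemma stationary_impulse n o : impulse delta V n o = D (pre delta X V n o).
Proof.
have admV := stationary_admissible; have dyV := stationary_dyadic.
have [h|h] := boolP (impulse delta V n o).
  have tn := impulse_tau delta0 admV dyV h.
  rewrite -(pre_impulseE delta0 admV dyV tn) /pre_impulse tn.
  move: tn; set k := (act _ _ _ _).-1; rewrite stationary_tauE /hit_time.
  case E : first_hit => [i|]; last first.
    rewrite addey// -ltNye; apply: lt_le_trans (stationary_leg_start_ge0 k o).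
    exact: ltNyr.
  have [_ Di _] := (first_hitP _ _ _).1 E.
  case: (leg_start V k o) => // r /= [e].
  have -> : (n%:R * delta - r = i%:R * delta)%R by move: e; lra.
  exact/esym.
have [k [j [jn ckj]]] := cell_ex delta0 admV dyV n o.
have := h; rewrite (impulse_cell delta0 admV dyV jn ckj) => nkj.
apply/esym/negbTE/negP.
rewrite (pre_noimpulse delta0 admV dyV h) (segment_cell delta0 admV dyV jn ckj).
rewrite /path_start /fm_path addr0 => Di.
case: ckj => sk; rewrite stationary_tauE sk /hit_time.
have bi : ((0 < k)%N <= n - j)%N.
  move: nkj; rewrite negb_and; case: (0 < k)%N => //=; rewrite subn_gt0.
  by rewrite ltn_neqAle jn andbT.
have [i ij ->] := first_hit_le bi Di.
rewrite -EFinD lte_fin -mulrDl -natrD ltr_pM2r// ltr_nat ltnNge.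
by rewrite -(subnKC jn) leq_add2l ij.
Qed.

Lemma stationary_target n o : impulse delta V n o ->
  target delta V n o = sel (pre delta X V n o).
Proof.
have admV := stationary_admissible; have dyV := stationary_dyadic => h.
have tn := impulse_tau delta0 admV dyV h.
rewrite -(pre_impulseE delta0 admV dyV tn) /pre_impulse /target.
set k := (act _ _ _ _).-1 in tn *.
have fin : stationary_tau k o < +oo by move: tn => /= ->; rewrite ltry.
rewrite [xi V k o]/= /stationary_xi fin tn; congr (sel (X _ _)).
move: tn; rewrite stationary_tauE /hit_time.
case E : first_hit => [i|]; last first.
  rewrite addey// -ltNye; apply: lt_le_trans (stationary_leg_start_ge0 k o).
  exact: ltNyr.
by case: (leg_start V k o) => // r /= [e]; move: e; lra.
Qed.

End stationary_strategy.

(** * Nearly optimal strategies *)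

Section lower_bound.
Context (R : realType) (d : nat) (delta : R) (delta0 : (0 < delta)%R).
Context (dO : measure_display) (Omega : measurableType dO).
Context (X : feller_markov R d Omega) (U : set 'rV[R]_d) (cU : compact U) (U0 : U !=set0).
Context (omega : 'rV[R]_d -> R) (comega : continuous omega)
  (omega0 : forall x, (0 <= omega x)%R).
Context (growth : assumption_growth X delta omega).
Context (f : 'rV[R]_d -> R) (cf : continuous f).
Context (w : 'rV[R]_d -> R) (cw : continuous w).
Context (K : R) (K0 : (0 <= K)%R) (fK : forall x, (`|f x| <= K * (1 + omega x))%R)
  (wK : forall x, (`|w x| <= K * (1 + omega x))%R).
Context (c : 'rV[R]_d * 'rV[R]_d -> R) (cc : {within setT `*` U, continuous c})
  (cK : forall y xi, U xi -> (- (K * (1 + omega y)) <= c (y, xi))%R).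
Context (gamma : R) (gamma0 : (gamma < 0)%R).
Context (lambda : R) (bell : bellman X U delta f c gamma w lambda).

(** A nearly optimal target can be chosen measurably: the first suitable term
  of a sequence that is dense in [U] together with the values of [r]. *)
Lemma measurable_selector (r : state R d -> R) (e : R) : measurable_fun setT r ->
  (forall y, (r y < w y + lambda)%R -> forall e : R, (0 < e)%R ->
     exists xi, U xi /\ (w y + lambda - e < r xi + c (y, xi))%R) ->
  (0 < e)%R -> exists sel : state R d -> state R d,
  [/\ measurable_fun setT sel, forall y, U (sel y) &
    forall y, (r y < w y + lambda)%R ->
      (w y + lambda - e < r (sel y) + c (y, sel y))%R].
Proof.
move=> mr opt e0; have [D [UD dD]] := graph_dense_sequence r U0.
have mw : measurable_fun setT (w : state R d -> R) by exact: continuous_measurable_state.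
have mwl : measurable_fun setT (fun y : state R d => w y + lambda)%R.
  exact: measurable_funD.
pose P n (y : state R d) := ~~ (r y < w y + lambda)%R ||
  (w y + lambda - e < r (D n) + c (y, D n))%R.
have mP n : measurable [set y | P n y].
  rewrite -[X in measurable X]setTI.
  suff : measurable_fun setT (P n) by apply.
  apply: measurable_or; first by apply: measurable_neg; exact: measurable_fun_ltr.
  apply: measurable_fun_ltr; first exact: measurable_funB.
  apply: measurable_funD => //; apply: continuous_measurable_state.
  exact: (cost_continuous cc (UD n)).
have exP y : exists n, P n y.
  have [ry|ry] := boolP (r y < w y + lambda)%R; last by exists 0%N; rewrite /P ry.
  have e4 : (0 < e / 4)%R by rewrite divr_gt0.
  have e2 : (0 < e / 2)%R by rewrite divr_gt0.
  have [xi [Uxi hxi]] := opt y ry _ e2.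
  have [h h0 H] := within_continuous_dist cc y Uxi e4.
  have [|n [n1 n2]] := dD xi (Num.min h (e / 4))%R Uxi; first by rewrite lt_min h0.
  exists n; rewrite /P ry /=; move: n1 n2; rewrite !lt_min => /andP[n1 _] /andP[_ n2].
  have := H y (D n) (UD n); rewrite subrr normr0 => /(_ h0).
  rewrite distrC => /(_ n1); move: n2; rewrite !ltr_norml => /andP[a b] /andP[a' b'].
  lra.
have [idx [Pidx midx]] := measurable_first_index mP exP.
exists (fun y => D (idx y)); split => //.
  exact: (@measurable_glue _ (state R d) _ (state R d) idx (fun n _ => D n) midx).
by move=> y ry; have := Pidx y; rewrite /P ry.
Qed.

(** The strategy intervenes where waiting for one period is not optimal, and then
  moves to a nearly optimal target; it loses at most [e / 2] per period. At the risk
  parameter [p * gamma], [p > 1], the accumulated utility plus [w] is a supermartingale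
  under it, once the weights are subtracted with the factor [p - 1]. Hoelder's
  inequality returns to [gamma], and absorbs the weights, the terminal value and the
  cost of a last impulse at the horizon. *)
Lemma utility_ge_bellman (x : 'rV[R]_d) (e : R) : (0 < e)%R ->
  exists V : strategy R d Omega, [/\ admissible X U V, dyadic delta V &
    exists D : R, forall Q : probability (legs Omega) R, controlled_law X V x Q ->
    forall n, (n%:R * (lambda - e) + D)%:E <=
      entropic_utility Q gamma (total_reward X f c V (n%:R * delta)%R)].
Proof.
move=> e0.
have [r [mr rE rw rc ropt]] := bellman_certainty_equivalent delta0 comega omega0
  growth cf cw K0 fK wK gamma0 bell.
have [C C0 [_ HC]] := step_mean_rescale delta0 comega omega0 growth cf cw K0 fK wK
  gamma0 rE rw.
have [D1 D10 HD] := weight_growth delta0 cU comega omega0 growth x C0.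
pose l := (lambda - e / 2)%R.
have e2 : (0 < e / 2)%R by rewrite divr_gt0.
have [sel [msel Usel osel]] := measurable_selector mr ropt e2.
have mw : measurable_fun setT (w : state R d -> R) by exact: continuous_measurable_state.
have mom : measurable_fun setT (omega : state R d -> R) by exact: continuous_measurable_state.
pose D := [pred y : state R d | (r y < w y + lambda)%R].
have mD : borel [set y | D y].
  have mwl : measurable_fun setT (fun y : state R d => w y + lambda)%R.
    exact: measurable_funD.
  by have := measurable_fun_ltr mr mwl measurableT (Y := [set true]) I; rewrite setTI.
have msel' B : borel B -> borel (sel @^-1` B).
  by move=> mB; have := msel measurableT B mB; rewrite setTI.
pose V := stationary_strategy delta X D sel.
have admV : admissible X U V by exact: stationary_admissible.
have dyV : dyadic delta V by exact: stationary_dyadic.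
have step m o : (w (pre delta X V m o) + l <=
    cost delta X V c m o + r (post delta X V m o))%R.
  rewrite costE postE (stationary_impulse delta0 X mD Usel msel').
  case: ifP => [Dp|/negbT].
    rewrite (stationary_target delta0 mD Usel msel'); last first.
      by rewrite (stationary_impulse delta0 X mD Usel msel').
    by have := osel _ Dp; rewrite /l; lra.
  by rewrite -leNgt /l; lra.
exists V; split => //.
pose g := (- gamma)%R; have g0 : (0 < g)%R by rewrite oppr_gt0.
have eg : (0 < e * g)%R by exact: mulr_gt0.
have D11 : (0 < D1 + 1)%R by rewrite ltr_wpDl.
(* [s = 1 - 1 / p] multiplies the growth rate [D1] of the weights in Hoelder's
  inequality; [s <= 1 / 2] keeps [p] in the range of [step_mean_rescale] *)
have [s [s0 s2 sD1]] : exists s : R, [/\ (0 < s)%R, (s <= 2^-1)%R & (s * D1 <= e / 2 * g)%R].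
  have den : (0 < 2 * (D1 + 1 + e * g))%R by rewrite mulr_gt0// addr_gt0.
  exists (e * g / (2 * (D1 + 1 + e * g)))%R; split.
  - exact: divr_gt0.
  - by rewrite ler_pdivrMr//; lra.
  - rewrite mulrAC ler_pdivrMr//.
    have : (0 <= e * g * (1 + e * g))%R by rewrite mulr_ge0 ?(ltW eg)// addr_ge0// ltW.
    by lra.
pose p := ((1 - s)^-1)%R.
have s1 : (0 < 1 - s)%R by lra.
have p12 : (1 <= p <= 2)%R.
  rewrite /p invf_ge1// gerBl (ltW s0)/=.
  by rewrite -[leRHS]invrK lef_pV2 ?posrE ?invr_gt0//; lra.
have p0 : (0 < p)%R by rewrite invr_gt0.
have pE : (p - 1 = s * p)%R by rewrite /p; field; rewrite gt_eqF.
have [|D2 HD2] := HD (2 * (g * K / s))%R.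
  by rewrite mulr_ge0// divr_ge0 ?(ltW s0)// mulr_ge0// ltW.
exists (w x + s * D2 / gamma)%R => Q CQ n.
pose rho := (fun y : state R d => - (p - 1) * (C * (1 + omega y)) - p * gamma * l)%R.
have mrho : measurable_fun setT rho.
  apply: measurable_funB => //; apply: measurable_funM => //.
  by apply: measurable_funM => //; exact: measurable_funD.
have mh : measurable_fun setT (fun z : state R d => p * gamma * w z)%R.
  exact: measurable_funM.
pose G := (fun o => gain delta X f c 1 1 (fun=> - l)%R V n o).
pose S := (fun o => weight_sum delta X omega V C n o).
have [mG mS mwp mc] := measurable_at_horizon delta0 cf admV dyV C l n comega cw cc.
have mop a : measurable_fun setT
    ((fun o => a * (1 + omega (pre delta X V n o)))%R : legs Omega -> R).
  exact: (measurable_omega_pre delta0 comega admV dyV).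
have pg0 : (0 <= p * g)%R by rewrite mulr_ge0// ltW.
have sup m o : (expR (p * gamma * cost delta X V c m o + rho (post delta X V m o)))%:E *
    step_mean delta X f (p * gamma) (fun z => p * gamma * w z)%R (post delta X V m o) <=
    (expR (0 + p * gamma * w (pre delta X V m o)))%:E.
  apply: (@le_trans _ _ ((expR (p * gamma * cost delta X V c m o +
      rho (post delta X V m o)))%:E * (expR (p * (gamma * r (post delta X V m o)) +
      (p - 1) * (C * (1 + omega (post delta X V m o)))))%:E)).
    by rewrite lee_wpmul2l ?lee_fin ?expR_ge0//; exact: HC.
  rewrite -EFinM -expRD lee_fin ler_expR /rho.
  have := ler_wpM2l pg0 (step m o); rewrite /g.
  by lra.
pose u o := (p * (gamma * G o) - (p - 1) * S o + p * gamma * w (pre delta X V n o))%R.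
pose v o := (S o + (g * K / s * (1 + omega (pre delta X V n o)) -
  gamma / s * w (pre delta X V n o)))%R.
have mu : measurable_fun setT (u : legs Omega -> R).
  apply: measurable_funD; last exact: measurable_funM.
  by apply: measurable_funB; apply: measurable_funM => //; exact: measurable_funM.
have mv : measurable_fun setT (v : legs Omega -> R).
  by apply: measurable_funD => //; apply: measurable_funB => //; exact: measurable_funM.
have ub : \int[Q]_o (expR (u o))%:E <= (expR (p * gamma * w x))%:E.
  have := gain_le delta0 cf cc mrho mh admV dyV CQ n sup.
  rewrite mulr0 add0r; apply: le_trans.
  rewrite le_eqVlt; apply/orP; left; apply/eqP; apply: eq_integral => o _.
  rewrite /rho (gain_affine delta X omega f c V) -/(G o) -/(S o) /u; congr (expR _)%:E.
  by ring.
have vb : \int[Q]_o (expR (v o))%:E <= (expR (n%:R * D1 + D2))%:E.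
  apply: le_trans (HD2 V Q admV dyV CQ n).
  apply: ge0_le_integral => //.
  - exact: measurable_expR_fun.
  - by apply: measurable_expR_fun; exact: measurable_funD.
  move=> o _; rewrite lee_fin ler_expR lerD2l.
  have gs : (0 <= g / s)%R by exact/ltW/divr_gt0.
  have := ler_wpM2l gs (le_trans (ler_norm _) (wK (pre delta X V n o))).
  by rewrite /g; lra.
have s01 : (0 <= 1 - s <= 1)%R by lra.
have main := expR_hoelder_le s01 mu mv ub vb.
rewrite (_ : total_reward X f c V _ = fun o =>
    (G o + n%:R * l + cost delta X V c n o)%:E); last first.
  by apply/funext => o; rewrite (total_reward_gain delta0 cf c admV dyV l).
rewrite entropic_utility_ge_neg//.
have muv : measurable_fun setT ((fun o => (1 - s) * u o + (1 - (1 - s)) * v o)%R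
    : legs Omega -> R).
  by apply: measurable_funD; exact: measurable_funM.
apply: (@le_trans _ _ (\int[Q]_o (expR (((1 - s) * u o + (1 - (1 - s)) * v o) +
    gamma * (n%:R * l)))%:E)).
  apply: ge0_le_integral => //.
  - apply: measurable_expR_fun; apply: measurable_funM => //.
    by apply: measurable_funD => //; exact: measurable_funD.
  - by apply: measurable_expR_fun; exact: measurable_funD.
  move=> o _; rewrite lee_fin ler_expR.
  have -> : ((1 - s) * u o + (1 - (1 - s)) * v o =
      gamma * G o + g * (K * (1 + omega (pre delta X V n o))))%R.
    by rewrite /u /v pE /p; field; rewrite !gt_eqF.
  have cost_ge : (- (K * (1 + omega (pre delta X V n o))) <= cost delta X V c n o)%R.
    rewrite costE; case: ifP => _; first by apply: cK; exact: (xi_target admV).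
    by rewrite oppr_le0 mulr_ge0// addr_ge0.
  have := ler_wpM2l (ltW g0) cost_ge; rewrite /g.
  by lra.
rewrite integral_expR_shift//.
apply: (@le_trans _ _ ((expR (gamma * (n%:R * l)))%:E *
    (expR ((1 - s) * (p * gamma * w x) + (1 - (1 - s)) * (n%:R * D1 + D2)))%:E)).
  by rewrite lee_wpmul2l// lee_fin expR_ge0.
rewrite -EFinM -expRD lee_fin ler_expR.
have -> : ((1 - s) * (p * gamma * w x) = gamma * w x)%R.
  by rewrite /p; field; rewrite gt_eqF.
have -> : (gamma * (n%:R * (lambda - e) + (w x + s * D2 / gamma)) =
  gamma * (n%:R * l) + n%:R * (e / 2 * g) + gamma * w x + s * D2)%R.
  by rewrite /g /l; field; rewrite lt_eqF.
have : (n%:R * (s * D1) <= n%:R * (e / 2 * g))%R by rewrite ler_wpM2l.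
by lra.
Qed.

End lower_bound.

(** * The value of the control problem *)

Section inferior_limits.
Context (R : realType).
Implicit Types (u : (\bar R)^nat) (a : \bar R).

Lemma limn_einf_le u a : (\forall n \near \oo, u n <= a) -> limn_einf u <= a.
Proof.
move=> ua; rewrite limn_einf_lim; apply: lime_le; first exact: is_cvg_einfs.
apply: filterS ua => n; apply: le_trans.
by apply: ereal_inf_lbound; exists n => //=.
Qed.

Lemma limn_einf_ge u a : (\forall n \near \oo, a <= u n) -> a <= limn_einf u.
Proof.
move=> [N _ H]; rewrite limn_einf_lim; apply: lime_ge; first exact: is_cvg_einfs.
exists N => // n /= Nn; apply: le_ereal_inf_tmp => _ [m /= nm <-].
by apply: H => /=; exact: leq_trans nm.
Qed.

End inferior_limits.

Section average_utility.
Context (R : realType) (delta : R) (delta0 : (0 < delta)%R).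

Let eventually_absorbed (e D : R) : (0 < e)%R ->
  \forall n \near \oo, (0 < n)%N /\ (D <= n%:R * e)%R.
Proof.
move=> e0; exists (Num.bound `|D / e|%R).+1 => // n /= Nn.
split; first by case: n Nn.
rewrite -ler_pdivrMr//; apply: (le_trans (ler_norm _)).
apply/ltW/(lt_le_trans (archi_boundP _)) => //.
by rewrite ler_nat ltnW.
Qed.

Lemma average_le (U : nat -> \bar R) (l e D : R) : (0 < e)%R ->
  (forall n, U n <= (n%:R * (l + e) + D)%:E) ->
  limn_einf (fun n => ((n%:R * delta)^-1)%:E * U n) <= ((l + 2 * e) / delta)%:E.
Proof.
move=> e0 H; apply: limn_einf_le; apply: filterS (eventually_absorbed D e0).
move=> n [n0 nD].
have nd : (0 < n%:R * delta)%R by rewrite mulr_gt0// ltr0n.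
apply: (@le_trans _ _ (((n%:R * delta)^-1)%:E * (n%:R * (l + 2 * e))%:E)).
  rewrite lee_wpmul2l ?lee_fin ?invr_ge0 ?(ltW nd)//.
  by apply: le_trans (H n) _; rewrite lee_fin; lra.
rewrite -EFinM lee_fin le_eqVlt; apply/orP; left; apply/eqP; field.
by rewrite !gt_eqF// ltr0n.
Qed.

Lemma average_ge (U : nat -> \bar R) (l e D : R) : (0 < e)%R ->
  (forall n, (n%:R * (l - e) + D)%:E <= U n) ->
  ((l - 2 * e) / delta)%:E <= limn_einf (fun n => ((n%:R * delta)^-1)%:E * U n).
Proof.
move=> e0 H; apply: limn_einf_ge; apply: filterS (eventually_absorbed (- D) e0).
move=> n [n0 nD].
have nd : (0 < n%:R * delta)%R by rewrite mulr_gt0// ltr0n.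
apply: (@le_trans _ _ (((n%:R * delta)^-1)%:E * (n%:R * (l - 2 * e))%:E)).
  rewrite -EFinM lee_fin le_eqVlt; apply/orP; left; apply/eqP; field.
  by rewrite !gt_eqF// ltr0n.
rewrite lee_wpmul2l ?lee_fin ?invr_ge0 ?(ltW nd)//.
by apply: le_trans (H n); rewrite lee_fin; lra.
Qed.

End average_utility.

Theorem proposition4p3 (R : realType) (d : nat)
    (dO : measure_display) (Omega : measurableType dO)
    (X : feller_markov R d Omega)
    (U : set 'rV[R]_d) (delta : R)
    (f : 'rV[R]_d -> R) (c : 'rV[R]_d * 'rV[R]_d -> R)
    (omega : 'rV[R]_d -> R)
    (P : 'rV[R]_d -> strategy R d Omega -> probability (legs Omega) R)
    (gamma : R) (w : 'rV[R]_d -> R) (lambda : R) :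
  compact U ->
  (0 < delta)%R ->
  continuous omega ->
  (forall x, (0 <= omega x)%R) ->
  assumption_reward f omega ->
  assumption_cost U c omega ->
  assumption_growth X delta omega ->
  assumption_minorization X U delta omega ->
  (forall x V, admissible X U V -> controlled_law X V x (P x V)) ->
  (gamma < 0)%R ->
  C_omega omega w ->
  bellman X U delta f c gamma w lambda ->
  forall x, (lambda / delta)%:E =
    ereal_sup [set objective X delta gamma f c V (P x V) | V in
                 [set V | admissible X U V /\ dyadic delta V]].
Proof.
move=> cU delta0 comega omega0 [cf fw] [cc [c0 c00 cle] chat] growth minor PQ gamma0
  [cw ww] bell x.
(* a minorising measure charges [U] *)
have U0 : U !=set0.
  apply/set0P/eqP => UE; have [m [nu [_ + _]]] := minor 1%R ltr01.
  by rewrite UE measure0 ltxx.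
have [Kf Kf0 HKf] := weighted_norm_bound omega0 fw.
have [Kw Kw0 HKw] := weighted_norm_bound omega0 ww.
have [Kc Kc0 HKc] := weighted_norm_bound omega0 chat.
pose K := (Kf + Kw + Kc)%R.
have K0 : (0 <= K)%R by rewrite !addr_ge0.
have o1 y : (0 <= 1 + omega y)%R by rewrite addr_ge0.
have fK y : (`|f y| <= K * (1 + omega y))%R.
  apply: (le_trans (HKf y)); rewrite ler_wpM2r// /K; lra.
have wK y : (`|w y| <= K * (1 + omega y))%R.
  apply: (le_trans (HKw y)); rewrite ler_wpM2r// /K; lra.
have cK y xi : U xi -> (- (K * (1 + omega y)) <= c (y, xi))%R.
  move=> Uxi.
  have : (inf [set c (y, xi) | xi in U] <= c (y, xi))%R.
    apply: ge_inf; last by exists xi.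
    have [M HM] := cost_bounded_below cc y cU.
    by exists M => _ [z Uz <-]; exact: HM.
  apply: le_trans; have := HKc y; rewrite ler_norml => /andP[h _].
  by apply: le_trans h; rewrite lerN2 ler_wpM2r// /K; lra.
have c_le0 y xi : U xi -> (c (y, xi) <= 0)%R.
  by move=> Uxi; apply: (le_trans (cle y xi Uxi)); exact: ltW.
apply/eqP; rewrite eq_le; apply/andP; split.
  apply/lee_addgt0Pr => e e0.
  have e2 : (0 < e * delta / 2)%R by rewrite divr_gt0// mulr_gt0.
  have [V [admV dyV [D HD]]] := utility_ge_bellman delta0 cU U0 comega omega0 growth
    cf cw K0 fK wK cc cK gamma0 bell x e2.
  have := average_ge delta0 e2 (HD _ (PQ x V admV)).
  rewrite (_ : ((lambda - _) / _ = lambda / delta - e)%R); last first.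
    by field; rewrite gt_eqF.
  rewrite EFinB leeBlDr// => /le_trans; apply; rewrite leeD2r//.
  by apply: ereal_sup_ubound; exists V.
apply: ge_ereal_sup => _ [V [admV dyV] <-].
apply/lee_addgt0Pr => e e0.
have e2 : (0 < e * delta / 2)%R by rewrite divr_gt0// mulr_gt0.
have [D HD] := utility_le_bellman delta0 cU comega omega0 growth cf cw K0 fK wK cc
  c_le0 gamma0 bell x e2.
have := average_le delta0 e2 (HD V _ admV dyV (PQ x V admV)).
rewrite (_ : ((lambda + _) / _ = lambda / delta + e)%R)//.
by field; rewrite gt_eqF.
Qed.
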